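(* Let $(s^0,x^0)\in\mathbb K^r\times\mathbb K^n$ be a nondegenerate point (see context) which is a solution of the Bethe ansatz equations $\tilde\Phi_l(s,x)=1$, $l=1,\dots,r$. With $L_m,C_m,w,\mu,\tilde\psi_m$ as defined in the context from $(s^0,x^0)$, define $I:\mathbb Z^n\to V_{\mathbb K}$ by $$I(k)=\sum_{i_1,\dots,i_r=0}^{p-1}w(i_1e_1+\dots+i_re_r,k)\,\mu(i_1e_1+\dots+i_re_r,k).$$ Then $I$ is a flat section of the discrete connection $(L_m)$: $$I(k+f_m)=L_m(k)I(k)\qquad\text{for all }k\in\mathbb Z^n,\ m=1,\dots,n.$$ Furthermore $I$, if nonzero, is an eigensection of the $p$-curvature functions: $$C_m(k)I(k)=\tilde\psi_m(0,0)I(k)\qquad\text{for all }k\in\mathbb Z^n,\ m=1,\dots,n.$$ If $\kappa=1$, then $I$ takes values in $\mathrm{Sing}\,V_{\mathbb K}=\{v\in V_{\mathbb K}: e\,v=0\}$.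
   Context: Let $\mathbb K$ be a field of characteristic $p>2$ with prime subfield $\mathbb F_p$, let $n,r\ge1$ be integers, $a,\kappa\in\mathbb K^\times$, $\Lambda_1,\dots,\Lambda_n\in\mathbb K$. Let $e_1,\dots,e_r$ and $f_1,\dots,f_n$ be the standard basis vectors of $\mathbb Z^r$ and $\mathbb Z^n$, $s=(s_1,\dots,s_r)$, $x=(x_1,\dots,x_n)$; $s+ae_i$ (resp. $x+af_i$) is $s$ (resp. $x$) with $i$-th coordinate increased by $a$. Fiber. $\mathfrak{gl}_2$ over $\mathbb K$ has standard generators $e_{ij}$; set $e=e_{12}$, $f=e_{21}$, $h_1=e_{11}$, $h_2=e_{22}$. $M_\Lambda$ is the Verma module with basis $f^kv_\Lambda$, $k\ge0$, where $ev_\Lambda=0$, $h_1v_\Lambda=\Lambda v_\Lambda$, $h_2v_\Lambda=0$. $V_{\mathbb K}$ is the subspace of $M_{\Lambda_1}\otimes\dots\otimes M_{\Lambda_n}$ with basis $f^{\vec r}=f^{r_1}v_{\Lambda_1}\otimes\dots\otimes f^{r_n}v_{\Lambda_n}$, $\vec r=(r_1,\dots,r_n)\in\mathbb Z_{\ge0}^n$, $r_1+\dots+r_n=r$. The generator $e$ acts on the tensor product diagonally. $R$-matrix. $R_{\Lambda_1,\Lambda_2}(x)\in\mathrm{End}(M_{\Lambda_1}\otimes M_{\Lambda_2})(x)$ is the unique operator, rational in $x$, with $R(x)(f\otimes1+1\otimes f)=(f\otimes1+1\otimes f)R(x)$, $R(x)(f\otimes h_2+(h_1-x)\otimes f)=(f\otimes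 h_1+(h_2-x)\otimes f)R(x)$, $R(x)\,v_{\Lambda_1}\otimes v_{\Lambda_2}=v_{\Lambda_1}\otimes v_{\Lambda_2}$ (here $R=R_{\Lambda_1,\Lambda_2}$). It preserves weight subspaces. $R^{(i,j)}_{\Lambda_i,\Lambda_j}$ denotes its action on the $i$-th and $j$-th tensor factors (first factor of $R$ on the $i$-th). Also $\kappa^{h_2^{(m)}}f^{\vec r}=\kappa^{r_m}f^{\vec r}$. qKZ functions on $V_{\mathbb K}$: $$K_m(x)=R^{(m,m-1)}_{\Lambda_m,\Lambda_{m-1}}(x_m-x_{m-1}+a)\cdots R^{(m,1)}_{\Lambda_m,\Lambda_1}(x_m-x_1+a)\,\kappa^{h_2^{(m)}}\,R^{(m,n)}_{\Lambda_m,\Lambda_n}(x_m-x_n)\cdots R^{(m,m+1)}_{\Lambda_m,\Lambda_{m+1}}(x_m-x_{m+1}).$$ They satisfy $K_m(x+af_l)K_l(x)=K_l(x+af_m)K_m(x)$. The $p$-curvature functions are $\tilde K_m(x)=K_m(x+(p-1)af_m)\cdots K_m(x+af_m)K_m(x)$. Rank-one functions: $$\Phi_l(s,x)=\kappa\prod_{i=1}^n\frac{s_l-x_i+\Lambda_i}{s_l-x_i+a}\prod_{j\ne l}\frac{(s_l-s_j+a)(s_l-s_j-1)}{(s_l-s_j)(s_l-s_j+1+a)},\qquad \Psi_m(s,x)=\prod_{j=1}^r\frac{s_j-x_m}{s_j-x_m+\Lambda_m-a},$$ $\tilde\Phi_l(s,x)=\prod_{i=0}^{p-1}\Phi_l(s+iae_l,x)$,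 $\tilde\Psi_m(s,x)=\prod_{i=0}^{p-1}\Psi_m(s,x+iaf_m)$. Weight function: $W(s,x)=\sum_{\vec r}W_{\vec r}(s,x)f^{\vec r}$, where $$W_{\vec r}=\frac1{r_1!\cdots r_n!}\sum_{\sigma\in S_r}\Bigl[\prod_{i=1}^n\ \prod_{j=r_1+\dots+r_{i-1}+1}^{r_1+\dots+r_i}\Bigl(\prod_{i'<i}(s_j-x_{i'}+\Lambda_{i'})\prod_{i''>i}(s_j-x_{i''})\Bigr)\prod_{1\le j'<j''\le r}\frac{s_{j'}-s_{j''}+1}{s_{j'}-s_{j''}}\Bigr]_{s_j\mapsto s_{\sigma(j)}};$$ computed over $\mathbb Q$ this is a polynomial in $s,x,\Lambda$ with integer coefficients, which is then reduced modulo $p$. Nondegenerate point: $(s^0,x^0)$ is called nondegenerate if for all $c\in\mathbb F_p$ the following elements of $\mathbb K$ are nonzero: $s^0_k-x^0_i+ca$ and $s^0_k-x^0_i+\Lambda_i+ca$ (all $k,i$); $s^0_k-s^0_j+ca$ and $s^0_k-s^0_j+1+ca$ (all $k\neq j$); $x^0_i-x^0_m-\Lambda_i+b+ca$ (all $i\ne m$ and $b=0,\dots,r-1$). This guarantees that all functions above are regular, $\Phi_l,\Psi_m$ nonzero and $K_m$ invertible, on the $a\mathbb Z^{r+n}$-orbit of $(s^0,x^0)$. Lifts to the lattice: for $(j,k)\in\mathbb Z^r\times\mathbb Z^n$, $L_m(k)=K_m(x^0+ak)$, $C_m(k)=\tilde K_m(x^0+ak)$, $\phi_l(j,k)=\Phi_l(s^0+aj,x^0+ak)$,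 $\psi_m(j,k)=\Psi_m(s^0+aj,x^0+ak)$, $\tilde\psi_m(j,k)=\tilde\Psi_m(s^0+aj,x^0+ak)$ (independent of $(j,k)$), $w(j,k)=W(s^0+aj,x^0+ak)$. The transport coefficients $\mu:\mathbb Z^r\times\mathbb Z^n\to\mathbb K^\times$ are determined (consistently, by flatness of $(\phi_l,\psi_m)$) by $\mu(0,0)=1$, $\mu(j+e_l,k)=\mu(j,k)\phi_l(j,k)$, $\mu(j,k+f_m)=\mu(j,k)\psi_m(j,k)$. *)

(* Defs.v *)
(* Rmatrix, weight_poly and transport are definite descriptions: epsilon is
   applied to a predicate satisfied by exactly one object (for transport, at a
   nondegenerate point), which is the one the mathematics refers to. *)
From Stdlib Require Import ClassicalEpsilon.
From HB Require Import structures.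
From mathcomp Require Import all_boot all_order perm all_algebra.
From mathcomp Require Import mpoly.

Set Implicit Arguments.
Unset Strict Implicit.
Unset Printing Implicit Defensive.

Import Order.TTheory GRing.Theory Num.Theory.

Local Open Scope ring_scope.

(* M_{Lambda_1} (x) ... (x) M_{Lambda_n} is modelled by {mpoly F[n]}: the basis
   vector f^{m_1} v_{Lambda_1} (x) ... (x) f^{m_n} v_{Lambda_n} is the monomial
   'X_[m], and V is the subspace r.-homog. *)
Section Verma.
Variables (F : fieldType) (n : nat).

Definition linext k (T : 'X_{1..n} -> {mpoly F[k]}) (v : {mpoly F[n]}) :
    {mpoly F[k]} :=
  \sum_(m <- msupp v) v@_m *: T m.

Lemma linextX k (T : 'X_{1..n} -> {mpoly F[k]}) m : linext T 'X_[m] = T m.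
Proof. by rewrite /linext msuppX big_seq1 mcoeffX eqxx scale1r. Qed.

(* gl_2 acting on the i-th tensor factor:
     h1 f^k v = (Lambda - k) f^k v,   h2 f^k v = k f^k v,
     e f^k v = k (Lambda - k + 1) f^(k-1) v. *)
Definition vf (i : 'I_n) := linext (fun m => 'X_[(m + U_(i))%MM] : {mpoly F[n]}).

Definition vh2 (i : 'I_n) :=
  linext (fun m => (m i)%:R *: 'X_[m] : {mpoly F[n]}).

Definition vh1 (Lam : 'I_n -> F) (i : 'I_n) :=
  linext (fun m => (Lam i - (m i)%:R) *: 'X_[m] : {mpoly F[n]}).

Definition ve (Lam : 'I_n -> F) (i : 'I_n) :=
  linext (fun m => ((m i)%:R * (Lam i - (m i)%:R + 1)) *: 'X_[(m - U_(i))%MM]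
                     : {mpoly F[n]}).

Definition ve_diag (Lam : 'I_n -> F) (v : {mpoly F[n]}) : {mpoly F[n]} :=
  \sum_(i < n) ve Lam i v.

Definition is_sing (Lam : 'I_n -> F) (r : nat) (v : {mpoly F[n]}) : Prop :=
  v \is r.-homog /\ ve_diag Lam v = 0.

End Verma.

(* Value at c of a rational function, computed in lowest terms because the
   representative \n_ / \d_ of a fraction need not be reduced. *)
Definition rateval (K : fieldType) (q : {fraction {poly K}}) (c : K) : K :=
  let N := \n_(repr q) in
  let D := \d_(repr q) in
  (N %/ gcdp N D).[c] / (D %/ gcdp N D).[c].

Section RMatrix.
Variable K : fieldType.

Local Notation Kx := {fraction {poly K}}.

Definition ratX : Kx := tofrac ('X : {poly K}).

Definition Lam2 (L1 L2 : K) (i : 'I_2) : Kx :=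
  tofrac (if i == 0 then L1 else L2)%:P.

Definition is_Rmatrix (L1 L2 : K)
    (R : {linear {mpoly Kx[2]} -> {mpoly Kx[2]}}) : Prop :=
  let f := @vf Kx 2 in
  let h1 := vh1 (Lam2 L1 L2) in
  let h2 := @vh2 Kx 2 in
  [/\ forall v, R (f 0 v + f 1 v) = f 0 (R v) + f 1 (R v),
      forall v, R (f 0 (h2 1 v) + (h1 0 (f 1 v) - ratX *: f 1 v))
                = f 0 (h1 1 (R v)) + (h2 0 (f 1 (R v)) - ratX *: f 1 (R v))
    & R 1 = 1].

Definition Rmatrix (L1 L2 : K) : {linear {mpoly Kx[2]} -> {mpoly Kx[2]}} :=
  epsilon (inhabits (idfun : {linear {mpoly Kx[2]} -> {mpoly Kx[2]}}))
          (is_Rmatrix L1 L2).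

(* R_{L1,L2}(c) on the i-th (first) and j-th (second) tensor factors, i != j. *)
Definition Ract n (i j : 'I_n) (L1 L2 c : K) : {mpoly K[n]} -> {mpoly K[n]} :=
  linext (fun m =>
    let v := Rmatrix L1 L2 'X_[[multinom if t == 0%R then m i else m j | t < 2]] in
    \sum_(m' <- msupp v) rateval v@_m' c *:
      'X_[[multinom if t == i then m' 0%R else if t == j then m' 1%R else m t
          | t < n]]).

End RMatrix.

(* Symmetrization formula for W_rho, meaningful in characteristic 0 only;
   block i consists of the j with rho_1 + ... + rho_(i-1) <= j < rho_1 + ... + rho_i,
   j being counted from 0. *)
Section Weight.
Variables (n r : nat).

Definition block_start (rho : 'X_{1..n}) (i : 'I_n) : nat :=
  (\sum_(i' < n | i' < i) rho i')%N.

Definition weight_term (F : fieldType) (x Lam : 'I_n -> F) (rho : 'X_{1..n})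
    (s : 'I_r -> F) : F :=
  (\prod_(i < n) \prod_(j < r | (block_start rho i <= j < block_start rho i + rho i)%N)
     ((\prod_(i' < n | (i' < i)%N) (s j - x i' + Lam i')) *
      (\prod_(i'' < n | (i < i'')%N) (s j - x i''))))
  * \prod_(j' < r) \prod_(j'' < r | (j' < j'')%N)
      ((s j' - s j'' + 1) / (s j' - s j'')).

Definition weight_formula (F : fieldType) (s : 'I_r -> F) (x Lam : 'I_n -> F)
    (rho : 'X_{1..n}) : F :=
  ((\prod_(i < n) (rho i)`!)%N%:R)^-1
  * \sum_(sigma : 'S_r) weight_term x Lam rho (s \o sigma).

(* The variables are s_1, .., s_r, x_1, .., x_n, Lambda_1, .., Lambda_n. *)
Definition ivar_s (j : 'I_r) : 'I_(r + (n + n)) := lshift (n + n) j.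
Definition ivar_x (i : 'I_n) : 'I_(r + (n + n)) := rshift r (lshift n i).
Definition ivar_Lam (i : 'I_n) : 'I_(r + (n + n)) := rshift r (rshift n i).

Definition is_weight_poly (rho : 'X_{1..n}) (P : {mpoly int[r + (n + n)]}) : Prop :=
  let X t : {fraction {mpoly rat[r + (n + n)]}} := tofrac 'X_t in
  tofrac (map_mpoly (intr : int -> rat) P)
    = weight_formula (X \o ivar_s) (X \o ivar_x) (X \o ivar_Lam) rho.

Definition weight_poly (rho : 'X_{1..n}) : {mpoly int[r + (n + n)]} :=
  epsilon (inhabits 0) (is_weight_poly rho).

Definition weight_coef (K : fieldType) (Lam : 'I_n -> K)
    (s : 'rV[K]_r) (x : 'rV[K]_n) (rho : 'X_{1..n}) : K :=
  (map_mpoly (intr : int -> K) (weight_poly rho)).@[fun t =>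
    match split t with
    | inl j => s 0 j
    | inr u => match split u with inl i => x 0 i | inr i => Lam i end
    end].

Definition weight (K : fieldType) (Lam : 'I_n -> K)
    (s : 'rV[K]_r) (x : 'rV[K]_n) : {mpoly K[n]} :=
  \sum_(rho : 'X_{1..n < r.+1} | mdeg rho == r) weight_coef Lam s x rho *: 'X_[rho].

End Weight.

Section Connection.
Variables (K : fieldType) (n r p : nat) (a kappa : K) (Lam : 'I_n -> K).

(* (s, x) + t a (i-th basis vector), in either group of variables *)
Definition bump_coord d (v : 'rV[K]_d) (i : 'I_d) (t : nat) : 'rV[K]_d :=
  v + (a *+ t) *: delta_mx 0 i.

Definition qKZ (m : 'I_n) (x : 'rV[K]_n) (v : {mpoly K[n]}) : {mpoly K[n]} :=
  let v1 := foldl (fun u j => Ract m j (Lam m) (Lam j) (x 0 m - x 0 j) u)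
              v [seq j : 'I_n <- enum 'I_n | (m < j)%N] in
  let v2 := linext (fun rho => kappa ^+ rho m *: 'X_[rho] : {mpoly K[n]}) v1 in
  foldl (fun u j => Ract m j (Lam m) (Lam j) (x 0 m - x 0 j + a) u)
    v2 [seq j : 'I_n <- enum 'I_n | (j < m)%N].

Definition pcurv (m : 'I_n) (x : 'rV[K]_n) (v : {mpoly K[n]}) : {mpoly K[n]} :=
  foldl (fun u t => qKZ m (bump_coord x m t) u) v (iota 0 p).

Definition Phi (l : 'I_r) (s : 'rV[K]_r) (x : 'rV[K]_n) : K :=
  kappa
  * (\prod_(i < n) ((s 0 l - x 0 i + Lam i) / (s 0 l - x 0 i + a)))
  * \prod_(j < r | j != l)
      (((s 0 l - s 0 j + a) * (s 0 l - s 0 j - 1))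
       / ((s 0 l - s 0 j) * (s 0 l - s 0 j + 1 + a))).

Definition Psi (m : 'I_n) (s : 'rV[K]_r) (x : 'rV[K]_n) : K :=
  \prod_(j < r) ((s 0 j - x 0 m) / (s 0 j - x 0 m + Lam m - a)).

Definition PhiT (l : 'I_r) (s : 'rV[K]_r) (x : 'rV[K]_n) : K :=
  \prod_(0 <= t < p) Phi l (bump_coord s l t) x.

Definition PsiT (m : 'I_n) (s : 'rV[K]_r) (x : 'rV[K]_n) : K :=
  \prod_(0 <= t < p) Psi m s (bump_coord x m t).

(* c : nat stands for c%:R, which runs over the prime subfield. *)
Definition nondegenerate_point (s : 'rV[K]_r) (x : 'rV[K]_n) : Prop :=
  forall c : nat,
  [/\ forall k i, s 0 k - x 0 i + a *+ c != 0,
      forall k i, s 0 k - x 0 i + Lam i + a *+ c != 0,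
      forall k j, k != j -> s 0 k - s 0 j + a *+ c != 0,
      forall k j, k != j -> s 0 k - s 0 j + 1 + a *+ c != 0
    & forall i m, i != m -> forall b : nat, (b < r)%N ->
        x 0 i - x 0 m - Lam i + b%:R + a *+ c != 0].

Variables (s0 : 'rV[K]_r) (x0 : 'rV[K]_n).

Definition lattice_pt d (v0 : 'rV[K]_d) (z : 'rV[int]_d) : 'rV[K]_d :=
  v0 + a *: map_mx (intr : int -> K) z.

Definition Lconn (m : 'I_n) (k : 'rV[int]_n) := qKZ m (lattice_pt x0 k).

Definition Ccurv (m : 'I_n) (k : 'rV[int]_n) := pcurv m (lattice_pt x0 k).

Definition phi (l : 'I_r) (j : 'rV[int]_r) (k : 'rV[int]_n) : K :=
  Phi l (lattice_pt s0 j) (lattice_pt x0 k).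

Definition psi (m : 'I_n) (j : 'rV[int]_r) (k : 'rV[int]_n) : K :=
  Psi m (lattice_pt s0 j) (lattice_pt x0 k).

Definition psiT (m : 'I_n) (j : 'rV[int]_r) (k : 'rV[int]_n) : K :=
  PsiT m (lattice_pt s0 j) (lattice_pt x0 k).

Definition wlat (j : 'rV[int]_r) (k : 'rV[int]_n) : {mpoly K[n]} :=
  weight Lam (lattice_pt s0 j) (lattice_pt x0 k).

Definition is_transport (mu : 'rV[int]_r -> 'rV[int]_n -> K) : Prop :=
  [/\ forall j k, mu j k != 0,
      mu 0 0 = 1,
      forall l j k, mu (j + delta_mx 0 l) k = mu j k * phi l j k
    & forall m j k, mu j (k + delta_mx 0 m) = mu j k * psi m j k].

Definition transport : 'rV[int]_r -> 'rV[int]_n -> K :=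
  epsilon (inhabits (fun _ _ => 1)) is_transport.

Definition Isec (k : 'rV[int]_n) : {mpoly K[n]} :=
  \sum_(i : 'rV['I_p]_r)
    let j : 'rV[int]_r := map_mx (fun t : 'I_p => Posz t) i in
    transport j k *: wlat j k.

End Connection.

(* Main.v *)
(** Write the weight function as a sum over all maps A distributing the variables s_j
    among the tensor factors: W = \sum_A wterm A f^content(A), where wterm is a product of
    one factor per variable and of (s_j - s_j' + 1) / (s_j - s_j') for every pair with s_j
    placed to the left of s_j'.  Such a sum makes sense for any order of the tensor factors.
    For two factors it is the vector obtained from the vacuum by applying the monodromy
    entry B(t) at t = s_j for all j; since R intertwines the entries B(t) of the two orders,
    R exchanges two neighbouring factors in W.  Hence the first half of K_m moves the factor
    m to the last place and the second half moves it from the first place back to its own.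

    In between, the last place has to be identified with the first.  Term by term, the
    ratio of the two expressions is exactly the transport coefficient of the shift of
    x_m and of those s_j which A places in the factor m.  Under the Bethe equations the
    summand of I is p-periodic in s, so shifting these s_j does not change the sum, and
    I is flat.  The p-curvature is p-fold parallel transport, and W being p-periodic in x,
    it acts on I as the monodromy of mu.

    For e, the terms in which a given s_l is deleted telescope over the possible places of
    s_l, leaving its last place minus its first one; for kappa = 1 these two differ by the
    shift of s_l by a, and cancel in the sum. *)

From HB Require Import structures.
From Stdlib Require Import ClassicalEpsilon.
Require Import Defs.
From mathcomp Require Import all_boot all_order perm all_algebra.
From mathcomp Require Import ssrcomplements mpoly.
From mathcomp Require Import ring zify.

Set Implicit Arguments.
Unset Strict Implicit.
Unset Printing Implicit Defensive.

Import GRing.Theory.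
Local Open Scope ring_scope.

(** Three objects of the statement are chosen by epsilon, so each needs an existence proof in a form
    that can be computed with. [Rmatrix] lives over K(x): every monomial arises from the vacuum by
    operators B(t) at special t, so an intertwiner must obey a recursion with denominators x -
    Lambda_1 + b. This recursion serves both to construct it and to evaluate it at a point, and the
    conditions on x_i - x_m - Lambda_i + b, b < r, keep all denominators met up to degree r away
    from 0. [weight_poly] exists because the numerator of W over the Vandermonde product in s is an
    integral polynomial that vanishes when two of the s_j coincide; the symmetrization formula
    divides by factorials that may be 0 in K, while the sum over A specializes to K as soon as the
    s_j are distinct. [transport] is a product of powers of kappa and of Gamma-like functions of
    differences of lattice coordinates. The computations with B(t) and e rest on partial fractions
    of products of (s_j - t + 1) / (s_j - t), obtained by induction on the index set, which works
    over any field, even a finite one. *)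

Lemma eq_from (V : zmodType) (x y a b : V) : a = b -> x - y = a - b -> x = y.
Proof. by move=> -> /eqP; rewrite subrr subr_eq0 => /eqP. Qed.

(** * Partial fractions and the R-matrix *)

Section PartialFractions.
Variable F : fieldType.

Definition pairfactor (u v : F) : F := (u - v + 1) / (u - v).

Lemma pairfactorN u v : pairfactor (- u) (- v) = pairfactor v u.
Proof. by rewrite /pairfactor opprK [- u + v]addrC. Qed.

Lemma pairfactorE u v : u != v -> pairfactor u v = 1 + (u - v)^-1.
Proof.
by rewrite -subr_eq0 => uv; rewrite /pairfactor mulrDl mul1r divff.
Qed.

Lemma pairfactorE' u v : u != v -> pairfactor u v = 1 - (v - u)^-1.
Proof. by move=> uv; rewrite pairfactorE// -invrN opprB. Qed.

Lemma set_ind (I : finType) (P : {set I} -> Prop) :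
  P set0 -> (forall x (S : {set I}), x \notin S -> P S -> P (x |: S)) ->
  forall S, P S.
Proof.
move=> P0 PU S; have [k] := ubnP #|S|; elim: k S => // k IH S.
have [->//|[x xS]] := set_0Vmem S.
rewrite (cardsD1 x) xS ltnS => Sk.
by rewrite -(setD1K xS); apply: PU; rewrite ?setD11//; apply: IH.
Qed.

Section Residues.
Variables (I : finType) (s : I -> F).
Hypothesis s_inj : injective s.

(** Pole coefficients: [res S k] is that of 1/(s k - t) in the product over j in S of
    [pairfactor (s j) t], and [cores S k] that of 1/(t - s k) in the product of
    [pairfactor t (s j)]. *)
Definition res (S : {set I}) (k : I) := \prod_(j in S :\ k) pairfactor (s j) (s k).
Definition cores (S : {set I}) (k : I) := \prod_(j in S :\ k) pairfactor (s k) (s j).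

Lemma resU1 u (S : {set I}) k : u \notin S -> k \in S ->
  res (u |: S) k = pairfactor (s u) (s k) * res S k.
Proof.
move=> uS kS; rewrite /res setDUl.
have uk : u != k by apply: contraNneq uS => ->.
have -> : [set u] :\ k = [set u].
  by apply/setP => i; rewrite !inE; case: eqP => // ->; rewrite eq_sym (negPf uk).
by rewrite big_setU1 // !inE (negPf uS) andbF.
Qed.

Lemma resU1x u (S : {set I}) : u \notin S ->
  res (u |: S) u = \prod_(j in S) pairfactor (s j) (s u).
Proof. by move=> uS; rewrite /res setU1K. Qed.

Lemma sum_resU1 (f : I -> F) u (S : {set I}) : u \notin S ->
  \sum_(k in u |: S) f k * res (u |: S) k =
  f u * (\prod_(j in S) pairfactor (s j) (s u))
  + \sum_(k in S) f k * (pairfactor (s u) (s k) * res S k).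
Proof.
move=> uS; rewrite big_setU1 //= resU1x //; congr (_ + _).
by apply: eq_bigr => k kS; rewrite resU1.
Qed.

Lemma prod_pairfactor (S : {set I}) t : (forall k, k \in S -> s k != t) ->
  \prod_(j in S) pairfactor (s j) t = 1 + \sum_(k in S) (s k - t)^-1 * res S k.
Proof.
elim/set_ind: S t => [|u S uS IH] t st.
  by rewrite !big_set0 addr0.
rewrite big_setU1 //= sum_resU1 //.
have ut : s u != t by apply: st; rewrite setU11.
have uk k : k \in S -> s k != s u.
  by move=> kS; apply: contraNneq uS => /s_inj <-.
rewrite !IH //; last by move=> k kS; apply: st; rewrite setU1r.
(* The partial fractions of 1/((s k - t)(s u - t)), summed against [res S k]. *)
have E : \sum_(k in S) (s k - t)^-1 * (pairfactor (s u) (s k) * res S k)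
    + (s u - t)^-1 * \sum_(k in S) (s k - s u)^-1 * res S k
  = (s u - t)^-1 * \sum_(k in S) (s k - t)^-1 * res S k
    + \sum_(k in S) (s k - t)^-1 * res S k.
  rewrite 2!mulr_sumr -!big_split /=; apply: eq_bigr => k kS.
  rewrite pairfactorE' 1?eq_sym ?uk//.
  have := st k (setU1r u kS); rewrite -subr_eq0 => h1.
  have := uk k kS; rewrite -subr_eq0 => h2.
  have h3 : s u - t != 0 by rewrite subr_eq0.
  by field; rewrite h1 h2 h3.
by rewrite pairfactorE //; apply: (eq_from (esym E)); ring.
Qed.

(** Formally the 1/t term of [prod_pairfactor] at t = infinity; [sum_s_res] is the 1/t^2 term,
    whence the binomial coefficient. *)
Lemma sum_res (S : {set I}) : \sum_(k in S) res S k = #|S|%:R.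
Proof.
elim/set_ind: S => [|u S uS IH]; first by rewrite big_set0 cards0.
have uk k : k \in S -> s k != s u.
  by move=> kS; apply: contraNneq uS => /s_inj <-.
have E : \sum_(k in S) 1 * (pairfactor (s u) (s k) * res S k)
    + \sum_(k in S) (s k - s u)^-1 * res S k = \sum_(k in S) res S k.
  rewrite -big_split /=; apply: eq_bigr => k kS.
  by rewrite mul1r pairfactorE' ?(eq_sym (s u)) ?uk// mulrBl mul1r subrK.
under eq_bigr do rewrite -[res _ _]mul1r.
rewrite (sum_resU1 (fun=> 1) uS) mul1r prod_pairfactor// cardsU1 uS /= natrD.
by rewrite -IH; apply: (eq_from E); ring.
Qed.

Lemma sum_s_res (S : {set I}) :
  \sum_(k in S) s k * res S k = \sum_(k in S) s k - 'C(#|S|, 2)%:R.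
Proof.
elim/set_ind: S => [|u S uS IH].
  by rewrite !big_set0 cards0 bin0n subrr.
have uk k : k \in S -> s k != s u.
  by move=> kS; apply: contraNneq uS => /s_inj <-.
rewrite sum_resU1// prod_pairfactor// big_setU1//= cardsU1 uS /=.
have E : \sum_(k in S) s k * (pairfactor (s u) (s k) * res S k)
    + s u * \sum_(k in S) (s k - s u)^-1 * res S k
  = \sum_(k in S) s k * res S k - \sum_(k in S) res S k.
  rewrite mulr_sumr -sumrN -!big_split /=; apply: eq_bigr => k kS.
  rewrite pairfactorE' ?(eq_sym (s u)) ?uk//.
  have := uk k kS; rewrite -subr_eq0 => h2.
  by field.
by rewrite add1n binS bin1 natrD; apply: (eq_from E); rewrite IH sum_res; ring.
Qed.

End Residues.

(** Negating all variables exchanges the two kinds of pole coefficients, so each identity for [res]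
    has a dual for [cores]. *)
Lemma coresE (I : finType) (s : I -> F) (S : {set I}) k : cores s S k = res (\- s) S k.
Proof. by apply: eq_bigr => j _; rewrite pairfactorN. Qed.

Section Dual.
Variables (I : finType) (s : I -> F).
Hypothesis s_inj : injective s.

Let sN_inj : injective (\- s).
Proof. by move=> i j /oppr_inj/s_inj. Qed.

Lemma prod_pairfactor_r (S : {set I}) t : (forall k, k \in S -> s k != t) ->
  \prod_(j in S) pairfactor t (s j) = 1 + \sum_(k in S) (t - s k)^-1 * cores s S k.
Proof.
move=> st; have := prod_pairfactor sN_inj (S := S) (t := - t).
rewrite (eq_bigr (fun j => pairfactor t (s j))) => [->|j _]; last exact: pairfactorN.
  by congr (_ + _); apply: eq_bigr => k _; rewrite coresE opprK addrC.
by move=> k kS; rewrite (inj_eq oppr_inj) st.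
Qed.

(* The right-hand side is the coefficient of [e (f^#|S| v)] in a single Verma module. *)
Lemma sum_res_cores (lam y : F) (S : {set I}) :
  \sum_(k in S) ((s k - y + lam) * res s S k - (s k - y) * cores s S k)
  = #|S|%:R * (lam - #|S|%:R + 1).
Proof.
have E1 := sum_res s_inj S; have E2 := sum_s_res s_inj S.
have E3 := sum_res sN_inj S; have E4 := sum_s_res sN_inj S.
transitivity (\sum_(k in S) s k * res s S k + (lam - y) * \sum_(k in S) res s S k
   + \sum_(k in S) (- s k) * res (\- s) S k + y * \sum_(k in S) res (\- s) S k).
  rewrite !mulr_sumr -!big_split /=; apply: eq_bigr => k _.
  by rewrite coresE; ring.
rewrite E1 E2 E3 E4 sumrN.
have E5 : ('C(#|S|, 2)%:R * 2 : F) = #|S|%:R * #|S|%:R - #|S|%:R.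
  apply/eqP; rewrite eq_sym subr_eq -!natrM -natrD mulnC -mul_bin_diag bin1.
  by case: #|S| => //= q; rewrite addnC -mulnS.
by apply: (eq_from (esym E5)); ring.
Qed.

End Dual.
End PartialFractions.

Section LinearExtension.
Variables (K : fieldType) (n k : nat) (T : 'X_{1..n} -> {mpoly K[k]}).

(** The defining sum runs over a support that varies with v; padding with zero coefficients up to a
    common bound makes different arguments comparable. *)
Lemma linextwE w (v : {mpoly K[n]}) : (msize v <= w)%N ->
  linext T v = \sum_(m : 'X_{1..n < w}) v@_m *: T m.
Proof.
move=> vw; rewrite /linext; set I : subFinType _ := 'X_{1..n < w}.
rewrite (big_mksub I) ?msupp_uniq //=; first last.
  by move=> x /msize_mdeg_lt /leq_trans; apply.
by rewrite big_rmcond //= => j /memN_msupp_eq0 ->; rewrite scale0r.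
Qed.

Lemma linext_is_linear : linear (linext T).
Proof.
move=> c u v; pose w := maxn (msize (c *: u + v)) (maxn (msize u) (msize v)).
rewrite !(linextwE (w := w)) ?leq_max ?leqnn ?orbT //.
rewrite scaler_sumr -big_split /=; apply: eq_bigr => m _.
by rewrite mcoeffD mcoeffZ scalerDl scalerA.
Qed.

HB.instance Definition _ :=
  GRing.isLinear.Build K {mpoly K[n]} {mpoly K[k]} _ (linext T) linext_is_linear.

End LinearExtension.

Lemma big_powersetU1 (V : nmodType) (I : finType) (x : I) (S : {set I})
    (f : {set I} -> V) : x \notin S ->
  \sum_(D in powerset (x |: S)) f D =
  \sum_(D in powerset S) f (x |: D) + \sum_(D in powerset S) f D.
Proof.
move=> xS; rewrite (bigID (fun D : {set I} => x \in D)) /=; congr (_ + _).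
  rewrite (reindex_onto (fun D => x |: D) (fun D => D :\ x)) /=; last first.
    by move=> D /andP[_ xD]; rewrite setD1K.
  apply: eq_bigl => D; rewrite !powersetE setU11 andbT.
  have [DS|nDS] := boolP (D \subset S).
    rewrite setUS//= setU1K ?eqxx//.
    by apply: contraNN xS => /(subsetP DS).
  apply/negbTE; apply: contraNN nDS => /andP[DS /eqP <-].
  by rewrite subDset.
apply: eq_bigl => D; rewrite !powersetE; apply/andP/idP => [[DS xD]|DS].
  apply/subsetP => i iD; have := subsetP DS i iD; rewrite !inE.
  by case: eqP => // ei; rewrite -ei iD in xD.
split; first exact: subset_trans DS (subsetUr _ _).
by apply: contraNN xS => /(subsetP DS).
Qed.

(** * Two tensor factors: the weight function as a product of operators B(t) *)

Section TwoSites.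
Variables (K : fieldType) (n : nat) (m j : 'I_n) (xm xj Lm : K).

(* The monodromy entry [T_12(t)] acting on the tensor factors [m] and [j]. *)
Definition Bop (t : K) : {mpoly K[n]} -> {mpoly K[n]} :=
  linext (fun rho => (t - xj + (rho j)%:R) *: 'X_[rho + U_(m)]
    + (t - xm + Lm - (rho m)%:R) *: 'X_[rho + U_(j)]).

HB.instance Definition _ t := GRing.Linear.copy (Bop t) (Bop t).

Lemma BopX t rho : Bop t 'X_[rho] = (t - xj + (rho j)%:R) *: 'X_[rho + U_(m)]
    + (t - xm + Lm - (rho m)%:R) *: 'X_[rho + U_(j)].
Proof. exact: linextX. Qed.

Variables (I : finType) (s : I -> K).
Hypothesis s_inj : injective s.
Hypothesis mj : m != j.

(** The weight term for two factors with [m] to the left of [j]: D holds the variables placed at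
    [m], the rest of S sits at [j]. *)
Definition twosite_coef (S D : {set I}) : K :=
  \prod_(i in D) (s i - xj) * \prod_(i in S :\: D) (s i - xm + Lm)
  * \prod_(i in D) \prod_(i' in S :\: D) pairfactor (s i) (s i').

Definition twosite_mnm (o : 'X_{1..n}) (k l : nat) : 'X_{1..n} :=
  (o + U_(m) *+ k + U_(j) *+ l)%MM.

Definition twosite (o : 'X_{1..n}) (S : {set I}) : {mpoly K[n]} :=
  \sum_(D in powerset S) twosite_coef S D *: 'X_[twosite_mnm o #|D| #|S :\: D|].

Lemma twosite_coefU1r x (S D : {set I}) : x \notin S -> D \subset S ->
  twosite_coef (x |: S) (x |: D) =
  twosite_coef S D * ((s x - xj) * \prod_(i in S :\: D) pairfactor (s x) (s i)).
Proof.
move=> xS DS; have xD : x \notin D by apply: contraNN xS => /(subsetP DS).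
have E : (x |: S) :\: (x |: D) = S :\: D.
  apply/setP => i; rewrite !inE; case: (eqVneq i x) => //= ->.
  by rewrite (negPf xS) andbF.
rewrite /twosite_coef E !big_setU1 //=; ring.
Qed.

Lemma twosite_coefU1l x (S D : {set I}) : x \notin S -> D \subset S ->
  twosite_coef (x |: S) D =
  twosite_coef S D * ((s x - xm + Lm) * \prod_(i in D) pairfactor (s i) (s x)).
Proof.
move=> xS DS; have xD : x \notin D by apply: contraNN xS => /(subsetP DS).
have E : (x |: S) :\: D = x |: (S :\: D).
  by apply/setP => i; rewrite !inE; case: (eqVneq i x) => //= ->; rewrite xD.
rewrite /twosite_coef E big_setU1 ?inE ?(negPf xS) ?andbF //=.
rewrite [X in _ * X = _](eq_bigr (fun i => pairfactor (s i) (s x) *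
    \prod_(i' in S :\: D) pairfactor (s i) (s i'))) => [|i _]; last first.
  by rewrite big_setU1 // inE (negPf xS) andbF.
rewrite big_split /=; ring.
Qed.

Lemma twosite_mnmSm o k l : (twosite_mnm o k l + U_(m))%MM = twosite_mnm o k.+1 l.
Proof. by rewrite /twosite_mnm mulmS; apply/mnmP => i; rewrite !mnmDE; lia. Qed.

Lemma twosite_mnmSj o k l : (twosite_mnm o k l + U_(j))%MM = twosite_mnm o k l.+1.
Proof. by rewrite /twosite_mnm mulmS; apply/mnmP => i; rewrite !mnmDE; lia. Qed.

Lemma twosite0 o : twosite o set0 = 'X_[o].
Proof.
rewrite /twosite powerset0 big_set1 /twosite_coef !big_set0 set0D !big_set0.
by rewrite cards0 /twosite_mnm !mulm0n !addm0 !mulr1 scale1r.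
Qed.

(** Expanding the new pair factors in partial fractions in [s x], the part without poles is s x - xj
    plus a sum of [cores], which [sum_res] evaluates to the number of variables at [j]; this is a
    coefficient of [Bop]. The other coefficient arises likewise from [res]. *)
Lemma twositeU1 (o : 'X_{1..n}) x (S : {set I}) : o m = 0%N -> o j = 0%N -> x \notin S ->
  twosite o (x |: S) = Bop (s x) (twosite o S).
Proof.
move=> om oj xS; rewrite /twosite big_powersetU1 // linear_sum /=.
under [RHS]eq_bigr do rewrite linearZ /= BopX.
have nS (D : {set I}) : D \in powerset S -> [/\ x \notin D, #|x |: D| = #|D|.+1,
   (x |: S) :\: (x |: D) = S :\: D & #|(x |: S) :\: D| = #|S :\: D|.+1].
  rewrite powersetE => DS.
  have xD : x \notin D by apply: contraNN xS => /(subsetP DS).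
  split=> //; first by rewrite cardsU1 xD.
    apply/setP => i; rewrite !inE; case: (eqVneq i x) => //= ->.
    by rewrite (negPf xS) andbF.
  have -> : (x |: S) :\: D = x |: (S :\: D).
    by apply/setP => i; rewrite !inE; case: (eqVneq i x) => //= ->; rewrite xD.
  by rewrite cardsU1 inE (negPf xS) andbF.
have xs (i : I) : i \in S -> s i != s x.
  by move=> iS; apply: contraNneq xS => /s_inj <-.
(* [R1] and [R2] are the polar terms of the partial fraction expansions in [s x];
   they cancel when the element exchanged between [D] and its complement is summed over. *)
pose R1 (D : {set I}) e := (twosite_coef S D * (cores s (S :\: D) e * (s e - xj) / (s x - s e)))
   *: 'X_[twosite_mnm o #|D|.+1 #|S :\: D|] : {mpoly K[n]}.
pose R2 (D : {set I}) d := (twosite_coef S D * (res s D d * (s d - xm + Lm) / (s d - s x)))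
   *: 'X_[twosite_mnm o #|D| #|S :\: D|.+1] : {mpoly K[n]}.
have E1 (D : {set I}) : D \in powerset S ->
  twosite_coef (x |: S) (x |: D) *: 'X_[twosite_mnm o #|x |: D| #|(x |: S) :\: (x |: D)|]
  = twosite_coef S D *: ((s x - xj + (twosite_mnm o #|D| #|S :\: D| j)%:R)
       *: 'X_[twosite_mnm o #|D| #|S :\: D| + U_(m)]) + \sum_(e in S :\: D) R1 D e.
  move=> DS; have [xD -> -> _] := nS _ DS.
  move: DS; rewrite powersetE => DS.
  rewrite twosite_coefU1r // -scaler_suml -mulr_sumr twosite_mnmSm scalerA -scalerDl.
  congr (_ *: _); rewrite -mulrDr; congr (_ * _).
  rewrite prod_pairfactor_r //; last first.
    by move=> k; rewrite inE => /andP[_]; exact: xs.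
  rewrite /twosite_mnm !mnmDE oj !mulmnE !mnm1E (negPf mj) eqxx mul0n mul1n !add0n.
  rewrite -(sum_res (s := \- s)); last by move=> i1 i2 /oppr_inj/s_inj.
  rewrite mulrDr mulr1 -[RHS]addrA; congr (_ + _).
  rewrite mulr_sumr -big_split /=; apply: eq_bigr => e; rewrite inE => /andP[_ eS].
  have := xs e eS; rewrite eq_sym -subr_eq0 => h.
  by rewrite -coresE; field.
have E2 (D : {set I}) : D \in powerset S ->
  twosite_coef (x |: S) D *: 'X_[twosite_mnm o #|D| #|(x |: S) :\: D|]
  = twosite_coef S D *: ((s x - xm + Lm - (twosite_mnm o #|D| #|S :\: D| m)%:R)
       *: 'X_[twosite_mnm o #|D| #|S :\: D| + U_(j)]) + \sum_(d in D) R2 D d.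
  move=> DS; have [xD _ _ ->] := nS _ DS.
  move: DS; rewrite powersetE => DS.
  rewrite twosite_coefU1l // -scaler_suml -mulr_sumr twosite_mnmSj scalerA -scalerDl.
  congr (_ *: _); rewrite -mulrDr; congr (_ * _).
  rewrite prod_pairfactor //; last first.
    by move=> k /(subsetP DS); exact: xs.
  rewrite /twosite_mnm !mnmDE om !mulmnE !mnm1E eq_sym (negPf mj) eqxx mul0n mul1n addn0 add0n.
  rewrite -(sum_res s_inj) mulrDr mulr1 -[RHS]addrA; congr (_ + _).
  rewrite mulr_sumr -sumrN -big_split /=; apply: eq_bigr => d /(subsetP DS) dS.
  have := xs d dS; rewrite -subr_eq0 => h.
  by field.
rewrite (eq_bigr _ E1) (eq_bigr _ E2) !big_split /= addrACA -big_split /=.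
under [X in X + _ = _]eq_bigr do rewrite -scalerDr.
rewrite -[RHS]addr0; congr (_ + _).
have swap (f : {set I} -> I -> {mpoly K[n]}) (Q : {set I} -> I -> bool) :
  (forall (D : {set I}) e, D \subset S -> Q D e -> e \in S) ->
  \sum_(D in powerset S) \sum_(e | Q D e) f D e
  = \sum_(e in S) \sum_(D in powerset S | Q D e) f D e.
  move=> QS; rewrite (exchange_big_dep (fun e => e \in S)) //=.
  by move=> D e; rewrite powersetE; exact: QS.
rewrite (swap R1 (fun D e => e \in S :\: D)); last first.
  by move=> D e _; rewrite inE => /andP[].
rewrite (swap R2 (fun D e => e \in D)); last by move=> D e /subsetP; apply.
rewrite -big_split /=; apply: big1 => e eS.
have eSe : e \notin S :\ e by rewrite setD11.
rewrite [X in X + _]big_mkcondr [X in _ + X]big_mkcondr /R1 /R2 /= -(setD1K eS).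
rewrite !big_powersetU1 // [X in X + _ + _ = 0]big1 ?add0r; last first.
  by move=> D _; rewrite !inE eqxx.
rewrite [X in _ + (_ + X) = 0]big1 ?addr0; last first.
  move=> D; rewrite powersetE => /subsetP DS; case: ifP => // /DS.
  by rewrite (negPf eSe).
(* What survives pairs D, without e, in [R1] with e |: D in [R2]: both carry the same monomial, and
   their poles at s x = s e have opposite coefficients. *)
rewrite -big_split /=; apply: big1 => D; rewrite powersetE => DS.
have eD : e \notin D by apply: contraNN eSe => /(subsetP DS).
rewrite !inE eqxx eD /=.
have E3 : (e |: S :\ e) :\: D = e |: (S :\ e :\: D).
  by apply/setP => i; rewrite !inE; case: (eqVneq i e) => //= ->; rewrite eD.
have E4 : (e |: S :\ e) :\: (e |: D) = S :\ e :\: D.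
  by apply/setP => i; rewrite !inE; case: (eqVneq i e) => //=; rewrite andbF.
rewrite twosite_coefU1r // twosite_coefU1l // E3 E4 !cardsU1 eD !inE eqxx andbF.
rewrite !add1n -scalerDl /cores /res !setU1K // ?inE ?eqxx ?andbF //.
have := xs e eS; rewrite -subr_eq0 => h1.
have h2 : s x - s e != 0 by rewrite -opprB oppr_eq0.
have -> : (s x - s e)^-1 = - (s e - s x)^-1 by rewrite -invrN opprB.
by rewrite [X in X *: _](_ : _ = 0) ?scale0r //; ring.
Qed.

End TwoSites.

Section BopAlgebra.
Variables (K : fieldType) (n : nat) (m j : 'I_n) (xm xj Lm : K).
Hypothesis mj : m != j.
Local Notation B := (Bop m j xm xj Lm).

Lemma linear_eqX k (f g : {linear {mpoly K[n]} -> {mpoly K[k]}}) :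
  (forall rho, f 'X_[rho] = g 'X_[rho]) -> f =1 g.
Proof.
move=> fg v; rewrite [v]mpolyE !linear_sum; apply: eq_bigr => rho _.
by rewrite !linearZ /= fg.
Qed.

Lemma BopC t u v : B t (B u v) = B u (B t v).
Proof.
have jm : j != m by rewrite eq_sym.
apply: (linear_eqX (f := B t \o B u) (g := B u \o B t)) => rho /=.
rewrite !BopX !linearD !linearZ /= !BopX !mnmDE !mnm1E !eqxx (negPf mj) (negPf jm).
rewrite -[(rho + U_(j) + U_(m))%MM]addmA [(U_(j) + U_(m))%MM]addmC addmA.
rewrite !natrD; apply/mpolyP => o; rewrite !(mcoeffD, mcoeffZ) /=; ring.
Qed.

(** [Bop t] is affine in t, so two of its values determine all the others. *)
Lemma Bop_interp t u w v :
  (u - w) *: B t v = (t - w) *: B u v - (t - u) *: B w v.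
Proof.
pose f := (u - w) \*: B t; pose g := (t - w) \*: B u \- (t - u) \*: B w.
apply: (linear_eqX (f := f) (g := g)) => rho; rewrite /f /g /= !BopX.
apply/mpolyP => o; rewrite !(mcoeffD, mcoeffN, mcoeffZ).
ring.
Qed.

End BopAlgebra.

(** * Existence of the R-matrix *)

Section RmatrixModel.
Variables (F : fieldType) (X L1 L2 : F).
Hypothesis X_generic : forall b : nat, X - L1 + b%:R != 0.

Local Notation i0 := (0 : 'I_2).
Local Notation i1 := (1 : 'I_2).
Local Notation B := (Bop i0 i1 X 0 L1).
Local Notation B' := (Bop i1 i0 0 X L2).

(** [B t] applied to a monomial rho has two terms; one of them vanishes at t = - rho 1, the other at
    t = X - L1 + rho 0. Intertwining at these two values forces the recursions below. *)
Fixpoint Rcol0 (k2 : nat) : {mpoly F[2]} :=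
  if k2 is k.+1 then - (X - L1 + k%:R)^-1 *: B' (- k%:R) (Rcol0 k) else 1.

Fixpoint Rcol (k1 k2 : nat) : {mpoly F[2]} :=
  if k1 is k.+1 then (X - L1 + (k + k2)%:R)^-1 *: B' (X - L1 + k%:R) (Rcol k k2)
  else Rcol0 k2.

(** Both orders of adding a degree give the same vector: the [Bop] commute and the denominators
    depend on k1 + k2 only. *)
Lemma RcolSr k1 k2 : Rcol k1 k2.+1 =
  - (X - L1 + (k1 + k2)%:R)^-1 *: B' (- k2%:R) (Rcol k1 k2).
Proof.
elim: k1 => [|k IH] //=; rewrite IH !linearZ /= BopC // !scalerA addnS.
by rewrite mulrN mulNr mulrC.
Qed.

Definition Rmodel : {mpoly F[2]} -> {mpoly F[2]} :=
  linext (fun rho => Rcol (rho i0) (rho i1)).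

HB.instance Definition _ := GRing.Linear.copy Rmodel Rmodel.

Lemma Rmodel1 : Rmodel 1 = 1.
Proof. by rewrite /Rmodel -{1}mpolyX0 linextX !mnm0E. Qed.

(** Built into the recursion at the two special values of t; [Bop_interp] carries it to every t. *)
Lemma Rmodel_Bop t v : Rmodel (B t v) = B' t (Rmodel v).
Proof.
apply: (linear_eqX (f := Rmodel \o B t) (g := B' t \o Rmodel)) => rho /=.
rewrite BopX linearD !linearZ /= /Rmodel !linextX !mnmDE !mnm1E /=.
rewrite !addn0 !addn1 RcolSr /= !scalerA.
set k1 := rho i0; set k2 := rho i1; set Y := Rcol k1 k2.
have d0 := X_generic (k1 + k2).
apply: (scalerI d0); rewrite scalerDr !scalerA.
have dE : X - L1 + (k1 + k2)%:R = (X - L1 + k1%:R) - (- k2%:R) :> F.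
  by rewrite natrD; ring.
rewrite [in RHS]dE (Bop_interp _ _ _ _ _ t) -scaleNr; congr (_ *: _ + _ *: _).
  by rewrite mulrC divfK // subr0 opprK.
by rewrite !mulrN mulrC divfK //; ring.
Qed.

End RmatrixModel.

Section Coproducts.
Variables (F : fieldType) (X : F) (Lam : 'I_2 -> F).
Local Notation i0 := (0 : 'I_2).
Local Notation i1 := (1 : 'I_2).
Local Notation B := (Bop i0 i1 X 0 (Lam 0)).
Local Notation B' := (Bop i1 i0 0 X (Lam 1)).

HB.instance Definition _ (i : 'I_2) := GRing.Linear.copy (@vf F 2 i) (@vf F 2 i).
HB.instance Definition _ (i : 'I_2) := GRing.Linear.copy (@vh2 F 2 i) (@vh2 F 2 i).
HB.instance Definition _ (i : 'I_2) :=
  GRing.Linear.copy (@vh1 F 2 Lam i) (@vh1 F 2 Lam i).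

Let vfX (i : 'I_2) rho : @vf F 2 i 'X_[rho] = 'X_[rho + U_(i)].
Proof. exact: linextX. Qed.
Let vh2X (i : 'I_2) rho : @vh2 F 2 i 'X_[rho] = (rho i)%:R *: 'X_[rho].
Proof. exact: linextX. Qed.
Let vh1X (i : 'I_2) rho : @vh1 F 2 Lam i 'X_[rho] = (Lam i - (rho i)%:R) *: 'X_[rho].
Proof. exact: linextX. Qed.

Lemma vf_sumE v : vf 0 v + vf 1 v = B 1 v - B 0 v.
Proof.
apply: (linear_eqX (f := vf 0 \+ vf 1) (g := B 1 \- B 0)) => rho /=.
by rewrite !vfX !BopX; apply/mpolyP => o; rewrite !(mcoeffD, mcoeffN, mcoeffZ); ring.
Qed.

Lemma vf_sumE' v : vf 0 v + vf 1 v = B' 1 v - B' 0 v.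
Proof.
apply: (linear_eqX (f := vf 0 \+ vf 1) (g := B' 1 \- B' 0)) => rho /=.
by rewrite !vfX !BopX; apply/mpolyP => o; rewrite !(mcoeffD, mcoeffN, mcoeffZ); ring.
Qed.

Lemma Bop0E v : vf 0 (vh2 1 v) + (vh1 Lam 0 (vf 1 v) - X *: vf 1 v) = B 0 v.
Proof.
apply: (linear_eqX (g := B 0)
  (f := (vf 0 \o vh2 1) \+ ((vh1 Lam 0 \o vf 1) \- (X \*: vf 1)))) => rho /=.
rewrite vh2X linearZ /= !vfX vh1X BopX mnmDE mnm1E /= addn0.
by apply/mpolyP => o; rewrite !(mcoeffD, mcoeffN, mcoeffZ); ring.
Qed.

Lemma Bop0E' v : vf 0 (vh1 Lam 1 v) + (vh2 0 (vf 1 v) - X *: vf 1 v) = B' 0 v.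
Proof.
apply: (linear_eqX (g := B' 0)
  (f := (vf 0 \o vh1 Lam 1) \+ ((vh2 0 \o vf 1) \- (X \*: vf 1)))) => rho /=.
rewrite vh1X linearZ /= !vfX vh2X BopX mnmDE mnm1E /= addn0.
by apply/mpolyP => o; rewrite !(mcoeffD, mcoeffN, mcoeffZ); ring.
Qed.

(* The two defining relations involve [B 1 - B 0] and [B 0]; as [B t] is affine in [t],
   they amount to the intertwining of all the [B t]. *)
Lemma intertwinerP (R : {linear {mpoly F[2]} -> {mpoly F[2]}}) :
  [/\ forall v, R (vf 0 v + vf 1 v) = vf 0 (R v) + vf 1 (R v),
      forall v, R (vf 0 (vh2 1 v) + (vh1 Lam 0 (vf 1 v) - X *: vf 1 v))
        = vf 0 (vh1 Lam 1 (R v)) + (vh2 0 (vf 1 (R v)) - X *: vf 1 (R v))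
    & R 1 = 1]
  <-> R 1 = 1 /\ forall t v, R (B t v) = B' t (R v).
Proof.
split=> [[R1 R2 R3]|[R3 RB]].
  split=> // t v.
  have RB0 u : R (B 0 u) = B' 0 (R u) by rewrite -Bop0E R2 Bop0E'.
  have RB1 u : R (B 1 u) = B' 1 (R u).
    by have := R1 u; rewrite vf_sumE vf_sumE' linearB /= RB0 => /addIr.
  have := Bop_interp i0 i1 X 0 (Lam 0) t 1 0 v; rewrite !subr0 scale1r => ->.
  rewrite linearB !linearZ /= RB0 RB1 scalerN.
  by have := Bop_interp i1 i0 0 X (Lam 1) t 1 0 (R v); rewrite !subr0 scale1r => ->.
split=> // v; first by rewrite vf_sumE linearB /= !RB vf_sumE'.
by rewrite Bop0E RB Bop0E'.
Qed.

Hypothesis X_generic : forall b : nat, X - Lam 0 + b%:R != 0.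
Variable R : {linear {mpoly F[2]} -> {mpoly F[2]}}.
Hypothesis R_Bop : forall t v, R (B t v) = B' t (R v).

(** Any intertwiner obeys the recursion of the model, so it is available for the one that epsilon
    selects. *)
Lemma intertwinerX0 rho : R 'X_[rho + U_(i0)] =
  (X - Lam 0 + (rho i0 + rho i1)%:R)^-1 *:
    B' (X - Lam 0 + (rho i0)%:R) (R 'X_[rho]).
Proof.
have d0 := X_generic (rho i0 + rho i1).
apply: (scalerI d0); rewrite scalerA divff // scale1r -R_Bop BopX.
rewrite [X in _ + X *: _](_ : _ = 0); last by ring.
rewrite scale0r addr0 linearZ /=; congr (_ *: _).
by rewrite natrD; ring.
Qed.

Lemma intertwinerX1 rho : R 'X_[rho + U_(i1)] =
  - (X - Lam 0 + (rho i0 + rho i1)%:R)^-1 *: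
    B' (- (rho i1)%:R) (R 'X_[rho]).
Proof.
have d0 := X_generic (rho i0 + rho i1).
apply: (scalerI d0); rewrite scalerA mulrN divff // scaleN1r -R_Bop BopX.
rewrite [X in X *: _ + _](_ : _ = 0); last by ring.
rewrite scale0r add0r linearZ /= -scaleNr; congr (_ *: _).
by rewrite natrD; ring.
Qed.

End Coproducts.

Section Yangian.
Variables (K : fieldType) (L1 L2 : K).
Local Notation Kx := {fraction {poly K}}.
Local Notation i0 := (0 : 'I_2).
Local Notation i1 := (1 : 'I_2).
Local Notation l1 := (tofrac L1%:P : Kx).
Local Notation l2 := (tofrac L2%:P : Kx).
Local Notation B := (Bop i0 i1 (ratX K) 0 l1).
Local Notation B' := (Bop i1 i0 0 (ratX K) l2).

Lemma ratX_generic (b : nat) : ratX K - l1 + b%:R != 0.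
Proof.
rewrite /ratX -tofracB -(rmorph_nat (@tofrac _)) -tofracD tofrac_eq0.
rewrite -polyC_natr -addrA -polyCN -polyCD.
by rewrite -size_poly_eq0 size_XaddC.
Qed.

Lemma Rmatrix_spec : is_Rmatrix L1 L2 (Rmatrix L1 L2).
Proof.
apply: epsilon_spec; exists (Rmodel (ratX K) l1 l2 : {linear _ -> _}).
apply/(intertwinerP _ (Lam2 L1 L2)); split=> [|t v].
  exact: Rmodel1.
exact: (Rmodel_Bop l2 ratX_generic).
Qed.

Lemma Rmatrix1 : Rmatrix L1 L2 1 = 1.
Proof. by have /(intertwinerP _ (Lam2 L1 L2))[] := Rmatrix_spec. Qed.

Lemma Rmatrix_Bop t v : Rmatrix L1 L2 (B t v) = B' t (Rmatrix L1 L2 v).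
Proof. by have /(intertwinerP _ (Lam2 L1 L2))[_] := Rmatrix_spec. Qed.

Lemma RmatrixX0 rho : Rmatrix L1 L2 'X_[rho + U_(i0)] =
  (ratX K - l1 + (rho i0 + rho i1)%:R)^-1 *:
    B' (ratX K - l1 + (rho i0)%:R) (Rmatrix L1 L2 'X_[rho]).
Proof. exact: (@intertwinerX0 _ _ (Lam2 L1 L2) ratX_generic _ Rmatrix_Bop). Qed.

Lemma RmatrixX1 rho : Rmatrix L1 L2 'X_[rho + U_(i1)] =
  - (ratX K - l1 + (rho i0 + rho i1)%:R)^-1 *:
    B' (- (rho i1)%:R) (Rmatrix L1 L2 'X_[rho]).
Proof. exact: (@intertwinerX1 _ _ (Lam2 L1 L2) ratX_generic _ Rmatrix_Bop). Qed.

End Yangian.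

(** * Values of rational functions and of the R-matrix at a point *)

Section RationalValues.
Local Open Scope quotient_scope.
Local Open Scope ring_scope.
Variables (K : fieldType) (c : K).
Local Notation Kx := {fraction {poly K}}.

Definition has_value (q : Kx) (z : K) : Prop :=
  exists N D : {poly K}, [/\ D.[c] != 0, q = tofrac N / tofrac D & z = N.[c] / D.[c]].

Lemma has_valueC z : has_value (tofrac z%:P) z.
Proof. by exists z%:P, 1; rewrite hornerE oner_neq0 tofrac1 !divr1 hornerC. Qed.

Lemma has_valueX : has_value (ratX K) c.
Proof. by exists 'X, 1; rewrite hornerX hornerC oner_neq0 tofrac1 !divr1. Qed.

Lemma horner_neq0 (D : {poly K}) : D.[c] != 0 -> tofrac D != 0.
Proof. by apply: contraNneq => /eqP; rewrite tofrac_eq0 => /eqP ->; rewrite horner0. Qed.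

Lemma has_valueD q1 z1 q2 z2 :
  has_value q1 z1 -> has_value q2 z2 -> has_value (q1 + q2) (z1 + z2).
Proof.
move=> [N1 [D1 [h1 -> ->]]] [N2 [D2 [h2 -> ->]]].
exists (N1 * D2 + N2 * D1), (D1 * D2).
rewrite !hornerE mulf_neq0 // tofracD !tofracM; split=> //.
  by rewrite addf_div ?horner_neq0.
by rewrite addf_div.
Qed.

Lemma has_valueM q1 z1 q2 z2 :
  has_value q1 z1 -> has_value q2 z2 -> has_value (q1 * q2) (z1 * z2).
Proof.
move=> [N1 [D1 [h1 -> ->]]] [N2 [D2 [h2 -> ->]]].
exists (N1 * N2), (D1 * D2).
rewrite !hornerM mulf_neq0 // !tofracM; split=> //; last by rewrite mulf_div.
exact: mulf_div.
Qed.

Lemma has_valueN q z : has_value q z -> has_value (- q) (- z).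
Proof.
move=> [N [D [h -> ->]]]; exists (- N), D.
by rewrite hornerN tofracN !mulNr.
Qed.

Lemma has_valueV q (z : K) : z != 0 -> has_value q z -> has_value q^-1 z^-1.
Proof.
move=> z0 [N [D [h -> zE]]]; exists D, N; rewrite zE !invf_div; split=> //.
by apply: contraNneq z0 => N0; rewrite zE N0 mul0r.
Qed.

Lemma has_value_nat (k : nat) : has_value k%:R k%:R.
Proof.
by have := has_valueC k%:R; rewrite polyC_natr (rmorph_nat (@tofrac _)).
Qed.

Lemma numden_fraction (q : Kx) : q * tofrac \d_(repr q) = tofrac \n_(repr q).
Proof.
rewrite -{1}[q]reprK; move: (repr q) => y; unlock FracField.tofrac.
rewrite -[LHS]FracField.pi_mul; apply/eqmodP; rewrite /= FracField.equivfE.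
by rewrite /FracField.mulf ?(numden_Ratio, mulr1, oner_neq0, denom_ratioP) //= mulrC.
Qed.

(** By Gauss's lemma the reduced denominator divides any other one, so it is nonzero at c when the
    other is. *)
Lemma rateval_has_value q z : has_value q z -> rateval q c = z.
Proof.
move=> [P [Q [Qc qE ->]]]; rewrite /rateval.
have := numden_fraction q; have := denom_ratioP (repr q).
move: (\n_(repr q)) (\d_(repr q)) => N D D0 qD.
have PQ : P * D = N * Q.
  apply/eqP; rewrite -tofrac_eq !tofracM -qD qE; apply/eqP.
  by rewrite mulrAC divfK // horner_neq0.
set G := gcdp N D.
have G0 : G != 0 by rewrite gcdp_eq0 negb_and D0 orbT.
have NE := divpK (dvdp_gcdl N D); have DE := divpK (dvdp_gcdr N D).
rewrite -/G in NE DE; set N1 := N %/ G in NE *; set D1 := D %/ G in DE *.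
have PQ1 : P * D1 = N1 * Q.
  by apply: (mulIf G0); rewrite -mulrA DE PQ -NE; ring.
have cop : coprimep D1 N1.
  rewrite coprimep_sym; apply: coprimep_div_gcd; by rewrite D0 orbT.
have : D1 %| Q.
  by rewrite -(Gauss_dvdpr _ cop) -PQ1 dvdp_mulIr.
move=> /dvdpP[Q1 QE].
have D1c : D1.[c] != 0.
  by move: Qc; rewrite QE hornerM mulf_eq0 negb_or => /andP[].
have := congr1 (horner^~ c) PQ1; rewrite !hornerM => h.
by apply/eqP; rewrite eqr_div // h mulrC.
Qed.

End RationalValues.

Section RmatrixValues.
Variables (K : fieldType) (c L1 L2 : K).
Local Notation Kx := {fraction {poly K}}.
Local Notation i0 := (0 : 'I_2).
Local Notation i1 := (1 : 'I_2).

Definition has_mvalue (v : {mpoly Kx[2]}) (w : {mpoly K[2]}) : Prop :=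
  forall o, has_value c v@_o w@_o.

Lemma has_mvalueX o : has_mvalue 'X_[o] 'X_[o].
Proof. by move=> o'; rewrite !mcoeffX; apply: has_value_nat. Qed.

Lemma has_mvalueD v1 w1 v2 w2 :
  has_mvalue v1 w1 -> has_mvalue v2 w2 -> has_mvalue (v1 + v2) (w1 + w2).
Proof. by move=> h1 h2 o; rewrite !mcoeffD; apply: has_valueD. Qed.

Lemma has_mvalueZ q z v w :
  has_value c q z -> has_mvalue v w -> has_mvalue (q *: v) (z *: w).
Proof. by move=> h1 h2 o; rewrite !mcoeffZ; apply: has_valueM. Qed.

Lemma has_value0_eq (z : K) : has_value c 0 z -> z = 0.
Proof.
by move/rateval_has_value <-; apply: rateval_has_value (has_value_nat c 0).
Qed.

(** Evaluation at c may kill coefficients: w can have a smaller support than v, while [Ract] sums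
    over the support before evaluation. *)
Lemma linext_msupp k n (T : 'X_{1..n} -> {mpoly K[k]}) (v : {mpoly Kx[n]})
    (w : {mpoly K[n]}) :
  (forall o, v@_o = 0 -> w@_o = 0) ->
  linext T w = \sum_(o <- msupp v) w@_o *: T o.
Proof.
move=> vw; pose N := maxn (msize v) (msize w).
rewrite (@linextwE _ _ _ _ N) ?leq_maxr //; apply/esym.
set I : subFinType _ := 'X_{1..n < N}.
rewrite (big_mksub I) ?msupp_uniq //=; last first.
  by move=> o /msize_mdeg_lt /leq_trans; apply; rewrite leq_maxl.
rewrite big_rmcond //= => o /memN_msupp_eq0 /vw ->; exact: scale0r.
Qed.

Lemma has_mvalue_linext (T : 'X_{1..2} -> {mpoly Kx[2]}) U v w :
  has_mvalue v w -> (forall o, has_mvalue (T o) (U o)) ->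
  has_mvalue (linext T v) (linext U w).
Proof.
move=> vw TU; rewrite (linext_msupp U (v := v)); last first.
  by move=> o vo; apply: has_value0_eq; rewrite -vo; apply: vw.
rewrite /linext; elim: (msupp v) => [|o s IH]; last first.
  by rewrite !big_cons; apply: has_mvalueD (IH); apply: has_mvalueZ.
by rewrite !big_nil => o; rewrite !mcoeff0; apply: (has_value_nat c 0).
Qed.

Lemma has_mvalue_Bop t z v w : has_value c t z -> has_mvalue v w ->
  has_mvalue (Bop i1 i0 0 (ratX K) (tofrac L2%:P) t v) (Bop i1 i0 0 c L2 z w).
Proof.
move=> tz vw; apply: has_mvalue_linext => // o.
have hN := @has_valueN K c; have hX := has_valueX c; have hC := has_valueC c.
have hn := has_value_nat c; have h0 := has_value_nat c 0.
apply: has_mvalueD; apply: has_mvalueZ (has_mvalueX _).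
  exact: has_valueD (has_valueD tz (hN _ _ hX)) (hn _).
exact: has_valueD (has_valueD (has_valueD tz (hN _ _ h0)) (hC _)) (hN _ _ (hn _)).
Qed.

Definition Rvalue (o : 'X_{1..2}) : {mpoly K[2]} :=
  let v := Rmatrix L1 L2 'X_[o] in
  \sum_(o' <- msupp v) rateval v@_o' c *: 'X_[o'].

Lemma has_mvalue_rateval v w : has_mvalue v w ->
  w = \sum_(o <- msupp v) rateval v@_o c *: 'X_[o].
Proof.
move=> vw.
have := linext_msupp (fun o => 'X_[o] : {mpoly K[2]}) (v := v) (w := w).
rewrite /linext -mpolyE => ->.
  by apply: eq_bigr => o _; rewrite (rateval_has_value (vw o)).
by move=> o vo; apply: has_value0_eq; rewrite -vo; apply: vw.
Qed.

(** The denominators that the recursion meets on the way from the vacuum to degree d do not vanish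
    at c. *)
Definition Rregular (d : nat) : Prop :=
  forall b : nat, (b < d)%N -> c - L1 + b%:R != 0.

Lemma Rvalue_step (o : 'X_{1..2}) : (c - L1 + (o i0 + o i1)%:R != 0) ->
  has_mvalue (Rmatrix L1 L2 'X_[o]) (Rvalue o) ->
  [/\ has_mvalue (Rmatrix L1 L2 'X_[o + U_(i0)]) (Rvalue (o + U_(i0))),
      has_mvalue (Rmatrix L1 L2 'X_[o + U_(i1)]) (Rvalue (o + U_(i1))),
      Rvalue (o + U_(i0)) = (c - L1 + (o i0 + o i1)%:R)^-1 *:
        Bop i1 i0 0 c L2 (c - L1 + (o i0)%:R) (Rvalue o)
    & Rvalue (o + U_(i1)) = - (c - L1 + (o i0 + o i1)%:R)^-1 *:
        Bop i1 i0 0 c L2 (- (o i1)%:R) (Rvalue o)].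
Proof.
move=> d0 ho.
have hN := @has_valueN K c; have hX := has_valueX c; have hC := has_valueC c.
have hn := has_value_nat c.
have hB k : has_value c (ratX K - tofrac L1%:P + k%:R) (c - L1 + k%:R).
  exact: has_valueD (has_valueD hX (hN _ _ (hC _))) (hn _).
have h0 : has_mvalue (Rmatrix L1 L2 'X_[o + U_(i0)])
   ((c - L1 + (o i0 + o i1)%:R)^-1 *: Bop i1 i0 0 c L2 (c - L1 + (o i0)%:R) (Rvalue o)).
  by rewrite RmatrixX0; apply: has_mvalueZ; [apply: has_valueV | apply: has_mvalue_Bop].
have h1 : has_mvalue (Rmatrix L1 L2 'X_[o + U_(i1)])
   (- (c - L1 + (o i0 + o i1)%:R)^-1 *: Bop i1 i0 0 c L2 (- (o i1)%:R) (Rvalue o)).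
  rewrite RmatrixX1; apply: has_mvalueZ; first by apply: hN; apply: has_valueV.
  exact: has_mvalue_Bop (hN _ _ (hn _)) ho.
have E0 : Rvalue (o + U_(i0)) = _ := esym (has_mvalue_rateval h0).
have E1 : Rvalue (o + U_(i1)) = _ := esym (has_mvalue_rateval h1).
by rewrite E0 E1; split.
Qed.

Lemma mdeg2 (o : 'X_{1..2}) : mdeg o = (o i0 + o i1)%N.
Proof. by rewrite mdegE big_ord_recl big_ord1; congr (_ + o _)%N; apply/val_inj. Qed.

Lemma Rvalue1 : Rvalue 0%MM = 1.
Proof.
by apply/esym/has_mvalue_rateval; rewrite mpolyX0 Rmatrix1 -!mpolyX0; apply: has_mvalueX.
Qed.

Lemma has_mvalue_Rvalue (o : 'X_{1..2}) : Rregular (mdeg o) ->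
  has_mvalue (Rmatrix L1 L2 'X_[o]) (Rvalue o).
Proof.
move dE: (mdeg o) => d; elim: d o dE => [|d IH] o oE reg.
  have -> : o = 0%MM by apply/eqP; rewrite -mdeg_eq0 oE.
  by rewrite Rvalue1 mpolyX0 Rmatrix1 -!mpolyX0; apply: has_mvalueX.
have [i oi] : exists i, (0 < o i)%N.
  apply/existsP; rewrite -[X in is_true X]negbK negb_exists; apply/forallP => o0.
  by move: oE; rewrite mdegE big1 // => i _; have := o0 i; case: (o i).
have oK : (o - U_(i) + U_(i))%MM = o.
  by apply: submK; apply/mnm_lepP => k; rewrite mnm1E; case: eqP => // <-.
have oE' : mdeg (o - U_(i))%MM = d.
  by apply/eqP; rewrite -eqSS -oE -{2}oK mdegD mdeg1 addn1.
have IHo : has_mvalue (Rmatrix L1 L2 'X_[o - U_(i)]) (Rvalue (o - U_(i))).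
  by apply: IH oE' _ => b bd; apply: reg; apply: ltnW.
have [|h0 h1 _ _] := Rvalue_step _ IHo; first by rewrite -mdeg2 oE'; apply: reg.
have [iE|iE] : i = i0 \/ i = i1; last by move: h1; rewrite -!iE oK.
  by case: i {oi oK oE' IHo h0 h1} => [[|[|//]] lt]; [left|right]; apply/val_inj.
by move: h0; rewrite -!iE oK.
Qed.

End RmatrixValues.

Lemma linear_eq_sumX (K : fieldType) n k (I : finType) (P : pred I) (c : I -> K)
    (o : I -> 'X_{1..n}) (f g : {linear {mpoly K[n]} -> {mpoly K[k]}}) :
  (forall i, P i -> f 'X_[o i] = g 'X_[o i]) ->
  f (\sum_(i | P i) c i *: 'X_[o i]) = g (\sum_(i | P i) c i *: 'X_[o i]).
Proof.
by move=> fg; rewrite !linear_sum; apply: eq_bigr => i Pi; rewrite !linearZ /= fg.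
Qed.

(** * R acting on two of the n tensor factors *)

Section RactIntertwining.
Variables (K : fieldType) (n : nat) (m j : 'I_n) (L1 L2 c : K).
Hypothesis mj : m != j.
Local Notation i0 := (0 : 'I_2).
Local Notation i1 := (1 : 'I_2).

Definition insert2 (rho : 'X_{1..n}) (o : 'X_{1..2}) : 'X_{1..n} :=
  [multinom if t == m then o i0 else if t == j then o i1 else rho t | t < n].

Definition extract2 (rho : 'X_{1..n}) : 'X_{1..2} :=
  [multinom if t == 0%R then rho m else rho j | t < 2].

Definition embed2 rho : {mpoly K[2]} -> {mpoly K[n]} :=
  linext (fun o => 'X_[insert2 rho o]).

HB.instance Definition _ rho := GRing.Linear.copy (embed2 rho) (embed2 rho).

HB.instance Definition _ :=
  GRing.Linear.copy (Ract m j L1 L2 c) (Ract m j L1 L2 c).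

Lemma embed2X rho o : embed2 rho 'X_[o] = 'X_[insert2 rho o].
Proof. exact: linextX. Qed.

Lemma RactX rho :
  Ract m j L1 L2 c 'X_[rho] = embed2 rho (Rvalue c L1 L2 (extract2 rho)).
Proof.
rewrite /Ract linextX /Rvalue linear_sum /=; apply: eq_bigr => o _.
by rewrite linearZ /= embed2X.
Qed.

Lemma insert2Um rho o : (insert2 rho o + U_(m))%MM = insert2 rho (o + U_(i0)).
Proof.
apply/mnmP => t; rewrite !mnmE /= (eq_sym m t).
by case: (eqVneq t m) => // _; rewrite !addn0.
Qed.

Lemma insert2Uj rho o : (insert2 rho o + U_(j))%MM = insert2 rho (o + U_(i1)).
Proof.
apply/mnmP => t; rewrite !mnmE /= (eq_sym j t).
case: (eqVneq t m) => [->|_]; first by rewrite (negPf mj) !addn0.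
by case: (eqVneq t j) => // _; rewrite !addn0.
Qed.

Lemma embed2_Bop rho t w :
  embed2 rho (Bop i1 i0 0 c L2 t w) = Bop j m 0 c L2 t (embed2 rho w).
Proof.
apply: (linear_eqX (f := embed2 rho \o Bop i1 i0 0 c L2 t)
  (g := Bop j m 0 c L2 t \o embed2 rho)) => o /=.
rewrite BopX linearD !linearZ /= !embed2X BopX insert2Um insert2Uj.
by rewrite !mnmE eqxx eq_sym (negPf mj) eqxx.
Qed.

Lemma extract2Um rho : extract2 (rho + U_(m)) = (extract2 rho + U_(i0))%MM.
Proof.
apply/mnmP => t; rewrite !mnmE eqxx (negPf mj) addn0 (eq_sym 0).
by case: eqP; rewrite ?addn0.
Qed.

Lemma extract2Uj rho : extract2 (rho + U_(j)) = (extract2 rho + U_(i1))%MM.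
Proof.
apply/mnmP => t; rewrite !mnmE eqxx (eq_sym j) (negPf mj) addn0.
by case: t => [[|[|//]] lt] /=; rewrite ?addn0.
Qed.

Lemma embed2U rho i : i \in [:: m; j] -> embed2 (rho + U_(i)) =1 embed2 rho.
Proof.
move=> mi; apply: linear_eqX => o /=; rewrite !embed2X; congr 'X_[_].
apply/mnmP => t; rewrite !mnmE; move: mi; rewrite !inE.
case: (eqVneq t m) => // tm; case: (eqVneq t j) => // tj.
by case/orP => /eqP ->; rewrite eq_sym ?(negPf tm) ?(negPf tj) addn0.
Qed.

(** The interpolation argument of [Rmodel_Bop] at the point c. It is stated monomial by monomial
    because regularity at c is assumed only up to a degree. *)
Lemma Ract_BopX0 (rho : 'X_{1..n}) t : Rregular c L1 (rho m + rho j).+1 ->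
  Ract m j L1 L2 c (Bop m j c 0 L1 t 'X_[rho]) =
  Bop j m 0 c L2 t (Ract m j L1 L2 c 'X_[rho]).
Proof.
move=> reg.
have eE : mdeg (extract2 rho) = (rho m + rho j)%N by rewrite mdeg2 !mnmE.
have d0 : c - L1 + (rho m + rho j)%:R != 0 by apply: reg.
have ho : has_mvalue c (Rmatrix L1 L2 'X_[extract2 rho]) (Rvalue c L1 L2 (extract2 rho)).
  by apply: has_mvalue_Rvalue; rewrite eE => b bd; apply: reg; apply: ltnW.
have [|_ _ E0 E1] := Rvalue_step _ ho; first by rewrite !mnmE.
rewrite BopX linearD !linearZ /= !RactX extract2Um extract2Uj E0 E1.
rewrite !embed2U ?inE ?eqxx ?orbT // !linearZ /= !embed2_Bop !scalerA !mnmE /=.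
set Y := embed2 _ _; apply: (scalerI d0); rewrite scalerDr !scalerA.
have dE : c - L1 + (rho m + rho j)%:R = (c - L1 + (rho m)%:R) - (- (rho j)%:R) :> K.
  by rewrite natrD; ring.
rewrite [in RHS]dE (Bop_interp _ _ _ _ _ t) -scaleNr; congr (_ *: _ + _ *: _).
  by rewrite mulVKf // subr0 opprK.
by rewrite mulNr mulrN mulVKf //; ring.
Qed.

Lemma Bop_shift (i k : 'I_n) xm xj (Lm t : K) :
  Bop i k xm xj Lm t =1 Bop i k (xm - xj) 0 Lm (t - xj).
Proof.
by apply: linear_eqX => rho /=; rewrite !BopX; congr (_ *: _ + _ *: _); ring.
Qed.

Lemma Bop_shift' (i k : 'I_n) xm xj (Lm t : K) :
  Bop i k xm xj Lm t =1 Bop i k 0 (xj - xm) Lm (t - xm).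
Proof.
by apply: linear_eqX => rho /=; rewrite !BopX; congr (_ *: _ + _ *: _); ring.
Qed.

Lemma Ract_BopX (rho : 'X_{1..n}) t xm xj : c = xm - xj -> Rregular c L1 (rho m + rho j).+1 ->
  Ract m j L1 L2 c (Bop m j xm xj L1 t 'X_[rho]) =
  Bop j m xj xm L2 t (Ract m j L1 L2 c 'X_[rho]).
Proof.
by move=> cE reg; rewrite Bop_shift -cE Ract_BopX0 // [RHS]Bop_shift' -cE.
Qed.

Lemma Ract_outer (rho : 'X_{1..n}) : rho m = 0%N -> rho j = 0%N ->
  Ract m j L1 L2 c 'X_[rho] = 'X_[rho].
Proof.
move=> rm rj; rewrite RactX (_ : extract2 rho = 0%MM); last first.
  by apply/mnmP => t; rewrite !mnmE rm rj; case: ifP.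
rewrite Rvalue1 -mpolyX0 embed2X; congr 'X_[_].
by apply/mnmP => t; rewrite !mnmE; case: eqP => [->|_]; last case: eqP => [->|_].
Qed.

(* Induction on [S]: both sides are built by the operators [Bop] that [Ract] intertwines. *)
Lemma Ract_twosite (I : finType) (s : I -> K) xm xj (o : 'X_{1..n}) (S : {set I}) :
  injective s -> c = xm - xj -> Rregular c L1 #|S| -> o m = 0%N -> o j = 0%N ->
  Ract m j L1 L2 c (twosite m j xm xj L1 s o S) = twosite j m xj xm L2 s o S.
Proof.
move=> s_inj cE + om oj; have jm : j != m by rewrite eq_sym.
elim/set_ind: S => [|x S xS IH] reg; first by rewrite !twosite0 Ract_outer.
rewrite cardsU1 xS add1n in reg.
rewrite !twositeU1 // -IH; last by move=> b bd; apply: reg; apply: ltnW.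
apply: (@linear_eq_sumX _ _ _ _ _ _ _ (Ract m j L1 L2 c \o Bop m j xm xj L1 (s x))
  (Bop j m xj xm L2 (s x) \o Ract m j L1 L2 c)) => D.
rewrite powersetE => DS /=; apply: Ract_BopX => //; congr Rregular: reg.
rewrite /twosite_mnm !mnmDE !mulmnE !mnm1E om oj !eqxx (negPf mj) (negPf jm).
by rewrite !mul0n !mul1n !add0n addn0 -(cardsID D S) (setIidPr DS).
Qed.

End RactIntertwining.

(** * The weight function as a sum over distributions of the variables *)

Definition sitefactor (R : comNzRingType) n (lt : rel 'I_n) (x Lam : 'I_n -> R)
    (y : R) (i : 'I_n) : R :=
  \prod_(k | lt k i) (y - x k + Lam k) * \prod_(k | lt i k) (y - x k).

Section WeightVector.
Variables (K : fieldType) (n : nat) (I : finType).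
Implicit Types (lt : rel 'I_n) (s : I -> K) (x Lam : 'I_n -> K) (A : {ffun I -> 'I_n}).

Definition wterm lt s x Lam A : K :=
  \prod_i sitefactor lt x Lam (s i) (A i)
  * \prod_i \prod_i' (if lt (A i) (A i') then pairfactor (s i) (s i') else 1).

Definition content A : 'X_{1..n} := [multinom #|[set i | A i == t]| | t < n].

(* The weight function for the tensor product taken in the order [lt], written as
   a sum over all the ways [A] to distribute the variables among the factors. *)
Definition wvec lt s x Lam : {mpoly K[n]} :=
  \sum_A wterm lt s x Lam A *: 'X_[content A].

(** * Isolating two neighbouring factors in the weight function *)

Section Split.
Variables (lt : rel 'I_n) (s : I -> K) (x Lam : 'I_n -> K).
Variables (P : pred 'I_n) (e u v : 'I_n).
Hypothesis uv : u != v.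
Hypothesis PE : forall k, P k = (k == u) || (k == v).
Hypothesis Pe : P e.
Hypotheses (lt_uu : lt u u = false) (lt_vv : lt v v = false).
Hypotheses (lt_uv : lt u v) (lt_vu : lt v u = false).
Hypothesis lt_l : forall k f, P f -> ~~ P k -> lt f k = lt e k.
Hypothesis lt_r : forall k f, P f -> ~~ P k -> lt k f = lt k e.

Definition outersite (y : K) : K :=
  \prod_(k | ~~ P k && lt k e) (y - x k + Lam k)
  * \prod_(k | ~~ P k && lt e k) (y - x k).

Definition outerterm (C : {ffun I -> 'I_n}) : K :=
  \prod_i (if P (C i) then outersite (s i) else sitefactor lt x Lam (s i) (C i))
  * \prod_i \prod_i' (if ~~ (P (C i) && P (C i')) && lt (C i) (C i')
                      then pairfactor (s i) (s i') else 1).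

Definition outermnm (C : {ffun I -> 'I_n}) : 'X_{1..n} :=
  [multinom if P t then 0%N else #|[set i | C i == t]| | t < n].

Definition inside (C : {ffun I -> 'I_n}) : {set I} := [set i | P (C i)].

(** A collapsed map remembers only which variables lie in {u, v}, parking them all at the
    representative e; [uncollapse] redistributes them, D going to u. *)
Definition collapsed (C : {ffun I -> 'I_n}) : bool := [forall i, P (C i) ==> (C i == e)].

Definition uncollapse (C : {ffun I -> 'I_n}) (D : {set I}) : {ffun I -> 'I_n} :=
  [ffun i => if P (C i) then (if i \in D then u else v) else C i].

Let Pu : P u. Proof. by rewrite PE eqxx. Qed.
Let Pv : P v. Proof. by rewrite PE eqxx orbT. Qed.
Let P_cases k : P k -> k = u \/ k = v.
Proof. by rewrite PE => /orP[] /eqP; [left|right]. Qed.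

Lemma sitefactor_u y : sitefactor lt x Lam y u = outersite y * (y - x v).
Proof.
rewrite /sitefactor [X in _ * X](bigD1 v) //= mulrCA [RHS]mulrC.
congr (_ * (_ * _)); apply: eq_bigl => k; have [Pk|nPk] /= := boolP (P k).
- by case: (P_cases Pk) => ->; rewrite ?lt_uu ?lt_vu.
- by rewrite lt_r.
- by case: (P_cases Pk) => ->; rewrite ?lt_uu ?eqxx ?andbF.
- by rewrite lt_l //; case: eqP nPk => [->|]; rewrite ?Pv ?andbT.
Qed.

Lemma sitefactor_v y : sitefactor lt x Lam y v = outersite y * (y - x u + Lam u).
Proof.
rewrite /sitefactor [X in X * _](bigD1 u) //= -mulrA [RHS]mulrC.
congr (_ * (_ * _)); apply: eq_bigl => k; have [Pk|nPk] /= := boolP (P k).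
- by case: (P_cases Pk) => ->; rewrite ?lt_vv ?eqxx ?andbF.
- by rewrite lt_r //; case: eqP nPk => [->|]; rewrite ?Pu ?andbT.
- by case: (P_cases Pk) => ->; rewrite ?lt_vv ?lt_vu.
- by rewrite lt_l.
Qed.

Lemma wterm_uncollapse C (D : {set I}) : collapsed C -> D \subset inside C ->
  wterm lt s x Lam (uncollapse C D) =
  outerterm C * twosite_coef (x u) (x v) (Lam u) s (inside C) D.
Proof.
move=> /forallP Ce DS; set S := inside C in DS *.
have inS i : (i \in S) = P (C i) by rewrite inE.
have PD i : i \in D -> P (C i) by move=> /(subsetP DS); rewrite inS.
rewrite /wterm /outerterm /twosite_coef.
have E1 : \prod_i sitefactor lt x Lam (s i) (uncollapse C D i) =
  \prod_i (if P (C i) then outersite (s i) else sitefactor lt x Lam (s i) (C i))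
  * (\prod_(i in D) (s i - x v) * \prod_(i in S :\: D) (s i - x u + Lam u)).
  rewrite [\prod_(i in D) _]big_mkcond [\prod_(i in S :\: D) _]big_mkcond /=.
  rewrite -!big_split /=; apply: eq_bigr => i _; rewrite ffunE in_setD inS.
  have [iD|iD] := boolP (i \in D); first by rewrite PD // sitefactor_u mulr1.
  by case: ifP => _; rewrite ?sitefactor_v mul1r // mulr1.
have E2 : \prod_i \prod_i' (if lt (uncollapse C D i) (uncollapse C D i')
             then pairfactor (s i) (s i') else 1)
  = \prod_i \prod_i' (if ~~ (P (C i) && P (C i')) && lt (C i) (C i')
                      then pairfactor (s i) (s i') else 1)
  * \prod_(i in D) \prod_(i' in S :\: D) pairfactor (s i) (s i').
  rewrite [\prod_(i in D) _]big_mkcond /= -big_split /=; apply: eq_bigr => i _.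
  have -> : (if i \in D then \prod_(i' in S :\: D) pairfactor (s i) (s i') else 1)
     = \prod_i' (if (i \in D) && (i' \in S :\: D) then pairfactor (s i) (s i') else 1).
    by case: ifP => _; [rewrite big_mkcond | rewrite big1].
  rewrite -big_split /=; apply: eq_bigr => i' _; rewrite !ffunE in_setD inS.
  have CE k : P (C k) -> C k = e by move=> Pk; apply/eqP/(implyP (Ce k)).
  have [Pi|nPi] /= := boolP (P (C i)); have [Pi'|nPi'] /= := boolP (P (C i')).
  - rewrite mul1r andbT; case: (i \in D); case: (i' \in D);
    by rewrite /= ?lt_uu ?lt_vv ?lt_uv ?lt_vu.
  - by rewrite !andbF mulr1 lt_l //; [rewrite (CE i) | case: ifP].
  - rewrite (contraNF (PD i) nPi) mulr1 lt_r //; last by case: ifP.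
    by rewrite (CE i').
  - by rewrite (contraNF (PD i) nPi) mulr1.
by rewrite E1 E2; ring.
Qed.

Lemma content_uncollapse C (D : {set I}) : collapsed C -> D \subset inside C ->
  content (uncollapse C D) =
  twosite_mnm u v (outermnm C) #|D| #|inside C :\: D|.
Proof.
move=> /forallP Ce DS; apply/mnmP => t; rewrite !mnmDE !mulmnE !mnm1E !mnmE.
have PD i : i \in D -> P (C i) by move=> /(subsetP DS); rewrite inE.
have [Pt|nPt] := boolP (P t); last first.
  have [/negPf tu /negPf tv] : t != u /\ t != v.
    by apply/andP; rewrite -negb_or -PE.
  rewrite ![_ == t]eq_sym tu tv !addn0; apply: eq_card => i; rewrite !inE ffunE.
  case: ifP => // Pi; rewrite [RHS](_ : _ = false); last first.
    by apply: contraTF Pi => /eqP ->.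
  by case: ifP; rewrite eq_sym.
rewrite add0n; case: (P_cases Pt) => ->; rewrite eqxx ?(eq_sym v) (negPf uv).
  rewrite mul1n mul0n addn0; apply: eq_card => i; rewrite inE ffunE.
  have [iD|iD] := boolP (i \in D); first by rewrite PD // eqxx.
  case: ifP => [_|nPi]; first by rewrite eq_sym (negPf uv).
  by apply: contraFF nPi => /eqP ->.
rewrite mul1n mul0n add0n; apply: eq_card => i; rewrite !inE ffunE.
have [iD|iD] := boolP (i \in D); first by rewrite PD // (negPf uv).
case: ifP => [_|nPi]; first by rewrite eqxx.
by apply: contraFF nPi => /eqP ->.
Qed.

(** Since u and v are neighbours, the other sites relate to both in the same way. Hence the terms
    with a given collapsed map share an outer factor, and what remains is a two-site sum. *)
Lemma wvec_split : wvec lt s x Lam = \sum_(C | collapsed C)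
  outerterm C *: twosite u v (x u) (x v) (Lam u) s (outermnm C) (inside C).
Proof.
under [RHS]eq_bigr do rewrite /twosite scaler_sumr.
rewrite pair_big_dep /=.
pose col (A : {ffun I -> 'I_n}) : {ffun I -> 'I_n} :=
  [ffun i => if P (A i) then e else A i].
rewrite /wvec (reindex_onto (fun p => uncollapse p.1 p.2)
   (fun A : {ffun I -> 'I_n} => (col A, [set i | A i == u]))) /=; last first.
  move=> A _; apply/ffunP => i; rewrite !ffunE inE.
  case: (boolP (P (A i))) => [Pi|/negPf nPi]; last by rewrite nPi.
  by rewrite Pe; case: (P_cases Pi) => ->; rewrite ?eqxx // eq_sym (negPf uv).
have colP (A : {ffun I -> 'I_n}) :
    collapsed (col A) /\ [set i | A i == u] \subset inside (col A).
  split; first by apply/forallP => i; rewrite ffunE; case: ifP => [|->]; rewrite ?eqxx ?implybT.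
  by apply/subsetP => i; rewrite !inE ffunE => /eqP ->; rewrite Pu Pe.
apply: eq_big => [[C D]|[C D]] /=; last first.
  move=> /eqP[CE DE]; have [] := colP (uncollapse C D); rewrite CE DE => Cc DS.
  by rewrite wterm_uncollapse // content_uncollapse // scalerA.
rewrite powersetE; apply/eqP/andP => [[CE DE]|[Cc DS]].
  by have := colP (uncollapse C D); rewrite CE DE.
congr (_, _).
  apply/ffunP => i; rewrite !ffunE; case: (boolP (P (C i))) => [Pi|/negPf nPi].
    by rewrite (eqP (implyP (forallP Cc i) Pi)); case: (i \in D); rewrite ?Pu ?Pv.
  by rewrite nPi.
apply/setP => i; rewrite inE ffunE; have [iD|niD] := boolP (i \in D).
  by have := subsetP DS i iD; rewrite inE => ->; rewrite eqxx.
case: (boolP (P (C i))) => [Pi|nPi]; first by rewrite eq_sym (negPf uv).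
by apply: contraNF nPi => /eqP ->.
Qed.

End Split.

End WeightVector.

Section Exchange.
Variables (K : fieldType) (n : nat) (I : finType) (s : I -> K) (x Lam : 'I_n -> K).
Variables (lt lt' : rel 'I_n) (m j : 'I_n) (c : K).
Hypothesis s_inj : injective s.
Hypothesis mj : m != j.
Hypotheses (lt_mm : lt m m = false) (lt_jj : lt j j = false).
Hypotheses (lt_mj : lt m j) (lt_jm : lt j m = false).
Hypotheses (lt'_mm : lt' m m = false) (lt'_jj : lt' j j = false).
Hypotheses (lt'_jm : lt' j m) (lt'_mj : lt' m j = false).
Local Notation P := (fun k => (k == m) || (k == j)).
Hypothesis lt_l : forall k f, P f -> ~~ P k -> lt f k = lt m k.
Hypothesis lt_r : forall k f, P f -> ~~ P k -> lt k f = lt k m.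
Hypothesis ltE : forall k f, ~~ P k || ~~ P f -> lt' k f = lt k f.
Hypothesis cE : c = x m - x j.
Hypothesis c_reg : Rregular c (Lam m) #|I|.

Lemma Ract_wvec :
  Ract m j (Lam m) (Lam j) c (wvec lt s x Lam) = wvec lt' s x Lam.
Proof.
have jm : j != m by rewrite eq_sym.
(* The representative is [m] for both orders, so the two sums run over the same collapsed maps with
   equal outer terms. *)
rewrite (@wvec_split _ _ _ lt s x Lam P m m j) ?eqxx //.
rewrite (@wvec_split _ _ _ lt' s x Lam P m j m) ?eqxx //; first last.
- by move=> k f Pf Pk; rewrite !ltE ?Pk // lt_r.
- by move=> k f Pf Pk; rewrite !ltE ?Pk ?orbT // lt_l.
- by move=> k; rewrite orbC.
rewrite (linear_sum (Ract m j (Lam m) (Lam j) c)); apply: eq_bigr => C _.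
rewrite linearZ /=; congr (_ *: _).
  rewrite /outerterm; congr (_ * _); apply: eq_bigr => i _.
    case: ifP => [_|/negbT PC].
      by rewrite /outersite; congr (_ * _); apply: eq_bigl => k;
        case: (boolP (P k)) => //= Pk; rewrite ltE // Pk ?orbT.
    by rewrite /sitefactor; congr (_ * _); apply: eq_bigl => k; rewrite ltE // PC ?orbT.
  apply: eq_bigr => i' _; rewrite negb_and.
  by case: (boolP (_ || _)) => //= PC; rewrite ltE.
apply: Ract_twosite => //; last first.
- by rewrite mnmE eqxx orbT.
- by rewrite mnmE eqxx.
- move=> b bS; apply: c_reg; apply: leq_trans bS _; exact: max_card.
Qed.

End Exchange.

Lemma eq_wvec (K : fieldType) n (I : finType) (lt lt' : rel 'I_n) (s : I -> K) x Lam :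
  lt =2 lt' -> wvec lt s x Lam = wvec lt' s x Lam.
Proof.
move=> E; apply: eq_bigr => A _; congr (_ *: _); congr (_ * _); apply: eq_bigr => i _.
  by congr (_ * _); apply: eq_bigl => k; rewrite E.
by apply: eq_bigr => i' _; rewrite E.
Qed.

Lemma foldl_linear_sum (R : pzRingType) (V : lmodType R) (J : Type) (L : J -> {linear V -> V})
    (T : finType) (c : T -> R) (v : T -> V) (l : seq J) :
  foldl (fun u j => L j u) (\sum_t c t *: v t) l
  = \sum_t c t *: foldl (fun u j => L j u) (v t) l.
Proof.
elim: l v => [|j l IH] v //=; rewrite linear_sum /=.
by under eq_bigr do rewrite linearZ /=; rewrite IH.
Qed.

Section MovingFactor.
Variables (n : nat) (m : 'I_n).

(* The order on the tensor factors in which [m] has been moved to just before [q]. *)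
Definition ltmove (q : nat) : rel 'I_n := fun i k =>
  if i == m then (k != m) && (q <= k)%N else if k == m then (i < q)%N else (i < k)%N.

(** Inserting [m] before itself or before its successor leaves it in place. The second half of K_m
    ends at q = m, the first half starts at q = m + 1. *)
Lemma ltmove_self : ltmove m =2 (fun i k => (i < k)%N).
Proof.
move=> i k; rewrite /ltmove; case: (eqVneq i m) => [->|im].
  by rewrite [RHS]ltn_neqAle eq_sym.
by case: (eqVneq k m) => [->|].
Qed.

Lemma ltmove_selfS : ltmove m.+1 =2 (fun i k => (i < k)%N).
Proof.
move=> i k; rewrite /ltmove; case: (eqVneq i m) => [->|im].
  by case: (eqVneq k m) => [->|] //=; rewrite ltnn.
by case: (eqVneq k m) => [->|] //; rewrite ltnS leq_eqVlt (inj_eq val_inj) (negPf im).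
Qed.

Variables (K : fieldType) (r : nat) (s : 'I_r -> K) (Lam : 'I_n -> K).
Hypothesis s_inj : injective s.

Lemma Ract_ltmove (x : 'I_n -> K) (j : 'I_n) c : m != j -> c = x m - x j ->
  Rregular c (Lam m) r ->
  Ract m j (Lam m) (Lam j) c (wvec (ltmove j) s x Lam) = wvec (ltmove j.+1) s x Lam.
Proof.
move=> mj cE reg; have jm : j != m by rewrite eq_sym.
apply: Ract_wvec => //; rewrite /ltmove ?eqxx ?(negPf jm) ?jm ?ltnn ?leqnn //.
- move=> k f /orP[]/eqP->; rewrite negb_or => /andP[km kj]; rewrite ?eqxx //.
  by rewrite (negPf jm) km (negPf km) ltn_neqAle (inj_eq val_inj) (eq_sym j) kj.
- move=> k f /orP[]/eqP->; rewrite negb_or => /andP[km kj]; rewrite ?eqxx //.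
  by rewrite (negPf jm) (negPf km).
- move=> k f; rewrite !negb_or => /orP[]/andP[km kj].
    by rewrite (negPf km) ltnS leq_eqVlt (inj_eq val_inj) (negPf kj).
  by rewrite (negPf km) [in RHS]leq_eqVlt (inj_eq val_inj) (eq_sym j) (negPf kj).
- by rewrite card_ord.
Qed.

Lemma foldl_after (x : 'I_n -> K) (l := [seq j : 'I_n <- enum 'I_n | (m < j)%N]) :
  (forall j, m != j -> Rregular (x m - x j) (Lam m) r) ->
  foldl (fun u j => Ract m j (Lam m) (Lam j) (x m - x j) u)
    (wvec (fun i k : 'I_n => (i < k)%N) s x Lam) l = wvec (ltmove n) s x Lam.
Proof.
move=> reg; rewrite -(eq_wvec _ _ _ ltmove_selfS) /l.
(* Generalized to prefixes of the enumeration; the filter discards the indices up to m, whence the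
   maximum. *)
suff H q : (q <= n)%N ->
    foldl (fun u j => Ract m j (Lam m) (Lam j) (x m - x j) u)
      (wvec (ltmove m.+1) s x Lam) [seq j : 'I_n <- take q (enum 'I_n) | (m < j)%N]
    = wvec (ltmove (maxn q m.+1)) s x Lam.
  by have := H n (leqnn n); rewrite take_oversize ?size_enum_ord // (maxn_idPl (ltn_ord m)).
elim: q => [|q IH] qn.
  by rewrite take0 /= max0n.
pose j := Ordinal qn.
have -> : take q.+1 (enum 'I_n) = rcons (take q (enum 'I_n)) j.
  by rewrite (take_nth j) ?size_enum_ord //; congr rcons; exact: (nth_ord_enum j j).
rewrite filter_rcons.
case: ifP => [mj|/negbT]; last first.
  by rewrite -leqNgt IH ?(ltnW qn) // => qm; rewrite !(maxn_idPr _) // ltnW.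
rewrite foldl_rcons IH ?(ltnW qn) //.
rewrite !(maxn_idPl _) //; last by rewrite ltnS ltnW.
by rewrite (@Ract_ltmove x j) ?neq_ltn ?mj //; apply: reg; rewrite neq_ltn mj.
Qed.

(** The arguments [c j] are kept separate because K_m writes them as x_m - x_j + a at the old point,
    while the weight function already sits at the shifted one. *)
Lemma foldl_before (x : 'I_n -> K) (c : 'I_n -> K)
    (l := [seq j : 'I_n <- enum 'I_n | (j < m)%N]) :
  (forall j, m != j -> c j = x m - x j) ->
  (forall j, m != j -> Rregular (x m - x j) (Lam m) r) ->
  foldl (fun u j => Ract m j (Lam m) (Lam j) (c j) u)
    (wvec (ltmove 0) s x Lam) l = wvec (fun i k : 'I_n => (i < k)%N) s x Lam.
Proof.
move=> cE reg; rewrite -(eq_wvec _ _ _ ltmove_self) /l.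
suff H q : (q <= n)%N ->
    foldl (fun u j => Ract m j (Lam m) (Lam j) (c j) u)
      (wvec (ltmove 0) s x Lam) [seq j : 'I_n <- take q (enum 'I_n) | (j < m)%N]
    = wvec (ltmove (minn q m)) s x Lam.
  have := H n (leqnn n); rewrite take_oversize ?size_enum_ord //.
  by rewrite (minn_idPr (ltnW (ltn_ord m))).
elim: q => [|q IH] qn.
  by rewrite take0 /= min0n.
pose j := Ordinal qn.
have -> : take q.+1 (enum 'I_n) = rcons (take q (enum 'I_n)) j.
  by rewrite (take_nth j) ?size_enum_ord //; congr rcons; exact: (nth_ord_enum j j).
rewrite filter_rcons.
case: ifP => [jm|/negbT]; last first.
  by rewrite -leqNgt IH ?(ltnW qn) // => qm; rewrite !(minn_idPr _) // ltnW.
have mj : m != j by rewrite neq_ltn jm orbT.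
rewrite foldl_rcons IH ?(ltnW qn) // !(minn_idPl _) ?(ltnW jm) //.
by rewrite (@Ract_ltmove x j) ?cE //; apply: reg.
Qed.

End MovingFactor.

(** * Discrete flatness on the lattice *)

Section LatticeFunctions.

Lemma const_on_lattice d (T : Type) (f : 'rV[int]_d -> T) :
  (forall z l, f (z + delta_mx 0 l) = f z) -> forall z w, f (z + w) = f z.
Proof.
move=> fd z w; have fD u l (k : nat) : f (u + delta_mx 0 l *+ k) = f u.
  by elim: k => [|k IH]; rewrite ?mulr0n ?addr0 // mulrSr addrA fd IH.
have fB u l (k : nat) : f (u - delta_mx 0 l *+ k) = f u.
  by rewrite -(fD _ l k) subrK.
rewrite [w]row_sum_delta; elim: (index_enum _) z => [|l s IH] z.
  by rewrite big_nil addr0.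
rewrite big_cons addrA IH; case: (w 0 l) => k.
  by rewrite -[Posz k]natz scaler_nat fD.
by rewrite NegzE scaleNr -[Posz _]natz scaler_nat fB.
Qed.

(* A Gamma function for the multiplicative difference equation with coefficient [g]. *)
Lemma lattice_gamma (K : fieldType) (g : int -> K) : (forall z, g z != 0) ->
  exists gam : int -> K, [/\ forall z, gam z != 0, gam 0 = 1
    & forall z, gam (z + 1) = gam z * g z].
Proof.
move=> g0; pose gam z := match z with
  | Posz k => \prod_(i < k) g (Posz i)
  | Negz k => (\prod_(i < k.+1) g (Negz i))^-1 end.
exists gam; split=> [[k|k]||[k|[|k]]] /=; rewrite ?big_ord0 //.
- by apply/prodf_neq0.
- by rewrite invr_eq0; apply/prodf_neq0.
- by rewrite addn1 big_ord_recr.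
- by rewrite big_ord_recl big_ord0 mulr1 mulVf.
- by rewrite subn1 /= [in RHS]big_ord_recr /= invfM mulfVK.
Qed.

Lemma lattice_sum_shift d p (V : nmodType) (f : 'rV[int]_d -> V) v : (0 < p)%N ->
  (forall z l, f (z + delta_mx 0 l *+ p) = f z) ->
  let J (i : 'rV['I_p]_d) : 'rV[int]_d := map_mx (fun t : 'I_p => Posz t) i in
  \sum_i f (J i + v) = \sum_i f (J i).
Proof.
case: p => // p _ fp J.
have fper z w : f (z + w *+ p.+1) = f z.
  have H := @const_on_lattice d V (fun u => f (z + u *+ p.+1)).
  have := H _ 0 w; rewrite add0r mul0rn addr0; apply=> u l.
  by rewrite mulrnDl addrA fp.
(* Translation by v becomes addition of its residue modulo p, a bijection of the box; J i + v and J
   (i + w) differ by p times the vector of quotients q. *)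
pose w : 'rV['I_p.+1]_d := map_mx (fun t : int => inZp `|(t %% p.+1)%Z|) v.
rewrite [RHS](reindex_inj (addIr w)) /=; apply: eq_bigr => i _.
pose q : 'rV[int]_d := \row_l divz ((J i + v) 0 l) p.+1.
rewrite -[RHS](fper _ q); congr f; apply/rowP => l; rewrite [RHS]mxE mulmxnE !mxE /=.
rewrite [LHS](divz_eq _ p.+1) [LHS]addrC -mulr_natr natz; congr (_ + _).
rewrite -modz_nat PoszD -modz_nat modzDmr gez0_abs ?modz_ge0 //.
by rewrite modzDmr.
Qed.

End LatticeFunctions.

Section NondegeneratePoint.
Variables (K : fieldType) (p : nat) (n r : nat) (a : K) (Lam : 'I_n -> K).
Hypothesis charK : p \in [pchar K].

(** Lets the conditions of [nondegenerate_point], indexed by natural numbers, be used for negative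
    shifts too. *)
Lemma pchar_int_nat (z : int) : exists c : nat, z%:~R = c%:R :> K.
Proof.
have p1 : (0 < p)%N := prime_gt0 (pcharf_prime charK).
case: z => k; first by exists k.
exists (k.+1 * p.-1)%N; rewrite NegzE mulrNz natrM -[in RHS]subn1 natrB //.
by rewrite (pcharf0 charK) sub0r mulrN1.
Qed.

Lemma lattice_ptE d (v : 'rV[K]_d) z l :
  lattice_pt a v z 0 l = v 0 l + a * (z 0 l)%:~R.
Proof. by rewrite /lattice_pt !mxE. Qed.

Lemma lattice_ptD d (v : 'rV[K]_d) z w :
  lattice_pt a v (z + w) = lattice_pt a (lattice_pt a v z) w.
Proof. by apply/rowP => l; rewrite !lattice_ptE mxE rmorphD /=; ring. Qed.

Lemma lattice_pt0 d (v : 'rV[K]_d) : lattice_pt a v 0 = v.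
Proof. by apply/rowP => l; rewrite lattice_ptE mxE mulr0 addr0. Qed.

Lemma lattice_pt_period d (v : 'rV[K]_d) z w :
  lattice_pt a v (z + w *+ p) = lattice_pt a v z.
Proof.
apply/rowP => l; rewrite !lattice_ptE mxE mulmxnE rmorphD rmorphMn /=.
by rewrite -mulr_natr (pcharf0 charK) mulr0 addr0.
Qed.

Lemma bump_lattice d (v : 'rV[K]_d) z l t :
  bump_coord a (lattice_pt a v z) l t = lattice_pt a v (z + delta_mx 0 l *+ t).
Proof.
apply/rowP => i; rewrite lattice_ptE /bump_coord !mxE mulmxnE !mxE !eqxx /=.
have -> : (i == l)%:R *+ t = ((i == l) * t)%N%:Z by rewrite -mulr_natr -natrM natz.
by rewrite intrD -pmulrn natrM -mulr_natr; ring.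
Qed.

Section At.
Variables (s : 'rV[K]_r) (x : 'rV[K]_n).
Hypothesis nd : nondegenerate_point a Lam s x.

Lemma nd_sx (z : int) k i : s 0 k - x 0 i + a * z%:~R != 0.
Proof. by have [c ->] := pchar_int_nat z; have [H _ _ _ _] := nd c; rewrite mulr_natr. Qed.

Lemma nd_sxL (z : int) k i : s 0 k - x 0 i + Lam i + a * z%:~R != 0.
Proof. by have [c ->] := pchar_int_nat z; have [_ H _ _ _] := nd c; rewrite mulr_natr. Qed.

Lemma nd_ss (z : int) k j : k != j -> s 0 k - s 0 j + a * z%:~R != 0.
Proof.
by have [c ->] := pchar_int_nat z; have [_ _ H _ _] := nd c; rewrite mulr_natr; apply: H.
Qed.

Lemma nd_ss1 (z : int) k j : k != j -> s 0 k - s 0 j + 1 + a * z%:~R != 0.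
Proof.
by have [c ->] := pchar_int_nat z; have [_ _ _ H _] := nd c; rewrite mulr_natr; apply: H.
Qed.

Lemma nd_xx (z : int) i m (b : nat) : i != m -> (b < r)%N ->
  x 0 i - x 0 m - Lam i + b%:R + a * z%:~R != 0.
Proof.
have [c ->] := pchar_int_nat z; have [_ _ _ _ H] := nd c => im br.
by rewrite mulr_natr; apply: H.
Qed.

End At.

Lemma nondegenerate_lattice s x j k : nondegenerate_point a Lam s x ->
  nondegenerate_point a Lam (lattice_pt a s j : 'rV_r) (lattice_pt a x k : 'rV_n).
Proof.
move=> nd c; split=> [l i|l i|l i li|l i li|i m im b br]; rewrite !lattice_ptE.
- rewrite (_ : _ + _ = s 0 l - x 0 i + a * (j 0 l - k 0 i + c%:Z)%:~R) ?nd_sx //.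
  by rewrite !rmorphD rmorphN /= -mulr_natr; ring.
- rewrite (_ : _ + _ = s 0 l - x 0 i + Lam i + a * (j 0 l - k 0 i + c%:Z)%:~R) ?nd_sxL //.
  by rewrite !rmorphD rmorphN /= -mulr_natr; ring.
- rewrite (_ : _ + _ = s 0 l - s 0 i + a * (j 0 l - j 0 i + c%:Z)%:~R) ?(nd_ss nd) //.
  by rewrite !rmorphD rmorphN /= -mulr_natr; ring.
- rewrite (_ : _ + _ = s 0 l - s 0 i + 1 + a * (j 0 l - j 0 i + c%:Z)%:~R) ?(nd_ss1 nd) //.
  by rewrite !rmorphD rmorphN /= -mulr_natr; ring.
- rewrite (_ : _ + _ = x 0 i - x 0 m - Lam i + b%:R + a * (k 0 i - k 0 m + c%:Z)%:~R).
    exact: (nd_xx nd).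
  by rewrite !rmorphD rmorphN /= -mulr_natr; ring.
Qed.

End NondegeneratePoint.

(** * Existence of the transport coefficients *)

Section TransportExistence.
Variables (K : fieldType) (p : nat) (n r : nat) (a kappa : K) (Lam : 'I_n -> K).
Variables (s0 : 'rV[K]_r) (x0 : 'rV[K]_n).
Hypothesis charK : p \in [pchar K].
Hypothesis kappa0 : kappa != 0.
Hypothesis nd : nondegenerate_point a Lam s0 x0.

Definition siteratio (i : 'I_n) (y : K) : K := (y + Lam i) / (y + a).
Definition pairratio (y : K) : K := ((y + a) * (y - 1)) / (y * (y + 1 + a)).

(** Compatibility of Phi_u and Phi_v: with y = s_u - s_v, a single function of y is multiplied by
    [pairratio y] when s_u is raised and divided by [pairratio (y - a)] when s_v is raised. *)
Lemma pairratio_refl y : y != 0 -> y - a != 0 -> y + 1 != 0 -> y - a - 1 != 0 ->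
  (pairratio (y - a))^-1 = pairratio (- y).
Proof.
move=> y0 ya y1 y1a.
have y1a' : - y + 1 + a != 0.
  by rewrite -oppr_eq0 (_ : - (- y + 1 + a) = y - a - 1) //; ring.
rewrite invf_div; apply/eqP; rewrite eqr_div ?mulf_neq0 ?oppr_eq0 ?subrK //.
by apply/eqP; ring.
Qed.

Lemma PhiE l (s : 'rV[K]_r) (x : 'rV[K]_n) : Phi a kappa Lam l s x =
  kappa * \prod_i siteratio i (s 0 l - x 0 i)
  * \prod_(j < r | j != l) pairratio (s 0 l - s 0 j).
Proof. by []. Qed.

(** Raising x_m lowers s_j - x_m, so Psi consists of inverses of the site factors of Phi, taken one
    step back. *)
Lemma PsiE m (s : 'rV[K]_r) (x : 'rV[K]_n) :
  Psi a Lam m s x = \prod_j (siteratio m (s 0 j - x 0 m - a))^-1.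
Proof.
apply: eq_bigr => j _; rewrite /siteratio subrK invf_div; congr (_ / _); ring.
Qed.

Let ltn_neq (u v : 'I_r) : (u < v)%N -> u != v.
Proof. by rewrite neq_ltn => ->. Qed.

Let G (l : 'I_r) (i : 'I_n) (z : int) := siteratio i (s0 0 l - x0 0 i + a * z%:~R).
Let H (u v : 'I_r) (z : int) := pairratio (s0 0 u - s0 0 v + a * z%:~R).

Let G_neq0 l i z : G l i z != 0.
Proof.
rewrite mulf_neq0 // ?invr_eq0.
  rewrite (_ : _ + _ = s0 0 l - x0 0 i + Lam i + a * z%:~R); last by ring.
  exact: (nd_sxL charK nd).
rewrite (_ : _ + _ = s0 0 l - x0 0 i + a * (z + 1)%:~R); last by rewrite rmorphD /=; ring.
exact: (nd_sx charK nd).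
Qed.

Let H_neq0 u v z : u != v -> H u v z != 0.
Proof.
move=> uv; have vu : v != u by rewrite eq_sym.
rewrite /H /pairratio !mulf_neq0 // ?invr_eq0 ?mulf_neq0 //.
- rewrite (_ : _ + a = s0 0 u - s0 0 v + a * (z + 1)%:~R); last by rewrite rmorphD /=; ring.
  exact: (nd_ss charK nd).
- rewrite (_ : _ - 1 = - (s0 0 v - s0 0 u + 1 + a * (- z)%:~R)); last by rewrite rmorphN /=; ring.
  by rewrite oppr_eq0; apply: (nd_ss1 charK nd).
- exact: (nd_ss charK nd).
- rewrite (_ : _ + a = s0 0 u - s0 0 v + 1 + a * (z + 1)%:~R); last by rewrite rmorphD /=; ring.
  exact: (nd_ss1 charK nd).
Qed.

Let H_refl u v z : u != v -> (H u v (z - 1))^-1 = H v u (- z).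
Proof.
move=> uv; have vu : v != u by rewrite eq_sym.
rewrite /H rmorphD !rmorphN /=.
set y := s0 0 u - s0 0 v + a * z%:~R.
have -> : s0 0 u - s0 0 v + a * (z%:~R - 1) = y - a by rewrite /y; ring.
have -> : s0 0 v - s0 0 u + a * - z%:~R = - y by rewrite /y; ring.
have y0 : y != 0 by apply: (nd_ss charK nd).
have ya : y - a != 0.
  rewrite /y (_ : _ - a = s0 0 u - s0 0 v + a * (z - 1)%:~R); last by rewrite rmorphD /=; ring.
  exact: (nd_ss charK nd).
have y1 : y + 1 != 0.
  rewrite /y (_ : _ + 1 = s0 0 u - s0 0 v + 1 + a * z%:~R); last by ring.
  exact: (nd_ss1 charK nd).
have y1a : y - a - 1 != 0.
  rewrite /y (_ : _ - 1 = - (s0 0 v - s0 0 u + 1 + a * (1 - z)%:~R)); last first.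
    by rewrite rmorphB /=; ring.
  by rewrite oppr_eq0; apply: (nd_ss1 charK nd).
exact: pairratio_refl.
Qed.

(** An explicit product: kappa to the sum of the j_l, a Gamma function of each j_l - k_i, and one of
    j_u - j_v for each pair u < v. Being a function on the lattice, it takes the place of a
    path-independence argument. *)
Lemma transport_exists : exists mu, is_transport a kappa Lam s0 x0 mu.
Proof.
have /fin_all_exists[gG gGP] (li : 'I_r * 'I_n) := lattice_gamma (G_neq0 li.1 li.2).
(* A function is required for every pair; on the diagonal, where [H u u 0] is 0, a dummy is
   supplied. *)
have /fin_all_exists[gH gHP] (uv : 'I_r * 'I_r) : exists g : int -> K, uv.1 != uv.2 ->
    [/\ forall z, g z != 0, g 0 = 1 & forall z, g (z + 1) = g z * H uv.1 uv.2 z].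
  have [->|uv12] := eqVneq uv.1 uv.2; first by exists (fun=> 1).
  by have [g gP] := lattice_gamma (fun z => H_neq0 z uv12); exists g.
pose mu (j : 'rV[int]_r) (k : 'rV[int]_n) := \prod_l kappa ^ (j 0 l)
  * \prod_l \prod_i gG (l, i) (j 0 l - k 0 i)
  * \prod_(u < r) \prod_(v < r | (u < v)%N) gH (u, v) (j 0 u - j 0 v).
exists mu; split.
- move=> j k; rewrite !mulf_neq0 //; apply/prodf_neq0 => u _.
  + exact: expfz_neq0.
  + by apply/prodf_neq0 => i _; have [] := gGP (u, i).
  + by apply/prodf_neq0 => v uv; have [] := gHP (u, v) (ltn_neq uv).
- rewrite /mu !big1 ?mulr1 // => u _.
  + apply: big1 => v uv; rewrite !mxE subr0.
    by have [] := gHP (u, v) (ltn_neq uv).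
  + by apply: big1 => i _; rewrite !mxE subr0; have [] := gGP (u, i).
  + by rewrite mxE expr0z.
- move=> l j k; rewrite /phi PhiE.
  have E1 : \prod_u kappa ^ ((j + delta_mx 0 l) 0 u) = \prod_u kappa ^ (j 0 u) * kappa.
    rewrite (bigD1 l) //= [in RHS](bigD1 l) //= !mxE !eqxx /= exprzDr ?unitfE // expr1z.
    rewrite mulrAC; congr (_ * _ * _); apply: eq_bigr => u ul.
    by rewrite !mxE (negPf ul) andbF addr0.
  have E2 : \prod_u \prod_i gG (u, i) ((j + delta_mx 0 l) 0 u - k 0 i)
     = \prod_u \prod_i gG (u, i) (j 0 u - k 0 i)
       * \prod_i siteratio i (lattice_pt a s0 j 0 l - lattice_pt a x0 k 0 i).
    rewrite (bigD1 l) //= [in RHS](bigD1 l) //= [RHS]mulrAC; congr (_ * _).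
      rewrite -big_split /=; apply: eq_bigr => i _; rewrite !mxE !eqxx /= addrAC.
      have [_ _ ->] := gGP (l, i); congr (_ * siteratio i _).
      by rewrite ?lattice_ptE /= rmorphB /=; ring.
    apply: eq_bigr => u ul; apply: eq_bigr => i _.
    by rewrite !mxE (negPf ul) andbF addr0.
  have E3 : \prod_(u < r) \prod_(v < r | (u < v)%N)
         gH (u, v) ((j + delta_mx 0 l) 0 u - (j + delta_mx 0 l) 0 v)
     = \prod_(u < r) \prod_(v < r | (u < v)%N) gH (u, v) (j 0 u - j 0 v)
       * \prod_(v < r | v != l) pairratio (lattice_pt a s0 j 0 l - lattice_pt a s0 j 0 v).
    pose T (v : 'I_r) := pairratio (lattice_pt a s0 j 0 l - lattice_pt a s0 j 0 v).
    have TE v : T v = H l v (j 0 l - j 0 v).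
      by rewrite /T /H !lattice_ptE rmorphB /=; congr pairratio; ring.
    rewrite -[X in _ = _ * X]/(\prod_(v < r | v != l) T v).
    move: T TE => T TE.
    transitivity (\prod_(u < r) \prod_(v < r | (u < v)%N) (gH (u, v) (j 0 u - j 0 v)
       * ((if u == l then T v else 1) * (if v == l then T u else 1)))).
      apply: eq_bigr => u _; apply: eq_bigr => v uv; have uv' := ltn_neq uv.
      have [_ _ gS] := gHP (u, v) uv'; rewrite !mxE /=.
      have [ul|ul] := eqVneq u l.
        rewrite -ul eq_sym (negPf uv') mulr1 addr0 addrAC gS TE -ul //.
      rewrite addr0 mul1r; have [vl|vl] := eqVneq v l; last by rewrite addr0 mulr1.
      (* Here l is the larger index of the pair, so its Gamma function takes one step down, and
         [H_refl] turns the inverse factor into the pair factor of Phi_l. *)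
      have -> : j 0 u - (j 0 v + 1) = j 0 u - j 0 v - 1 by ring.
      have := gS (j 0 u - j 0 v - 1); rewrite subrK => ->.
      rewrite -mulrA TE -vl -[j 0 v - j 0 u]opprB -H_refl // mulfV ?mulr1 //.
      exact: H_neq0.
    under eq_bigr do rewrite !big_split /=.
    rewrite !big_split /=; congr (_ * _).
    rewrite (bigD1 l) //= eqxx [X in _ * X * _]big1 ?mulr1; last first.
      by move=> u /negPf ->; rewrite big1.
    rewrite [RHS](bigID (fun v : 'I_r => (l < v)%N)) /=; congr (_ * _).
      by apply: eq_bigl => v; rewrite andb_idl // => lv; rewrite neq_ltn lv orbT.
    under eq_bigr do rewrite -big_mkcondr /=.
    rewrite (exchange_big_dep (fun v => v == l)) /=; last by move=> ? ? _ /andP[].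
    rewrite big_pred1_eq; apply: eq_bigl => u; rewrite eqxx andbT -leqNgt.
    by rewrite ltn_neqAle.
  by rewrite /mu E1 E2 E3; ring.
- move=> m j k; rewrite /psi PsiE /mu; rewrite -!mulrA; congr (_ * _).
  rewrite mulrCA [LHS]mulrC; congr (_ * _); rewrite -big_split /=; apply: eq_bigr => l _.
  rewrite (bigD1 m) //= [in RHS](bigD1 m) //= [RHS]mulrAC; congr (_ * _); last first.
    apply: eq_bigr => i im; rewrite !mxE (negPf im) andbF addr0 //.
  rewrite !mxE !eqxx /=.
  have -> : j 0 l - (k 0 m + 1) = j 0 l - k 0 m - 1 by ring.
  have [_ _ gS] := gGP (l, m); have := gS (j 0 l - k 0 m - 1); rewrite subrK => ->.
  rewrite /= -mulrA (_ : siteratio m _ = G l m (j 0 l - k 0 m - 1)).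
    by rewrite mulfV ?mulr1.
  by congr siteratio; rewrite !rmorphD !rmorphN /=; ring.
Qed.

End TransportExistence.

Section TransportTheory.
Variables (K : fieldType) (p : nat) (n r : nat) (a kappa : K) (Lam : 'I_n -> K).
Variables (s0 : 'rV[K]_r) (x0 : 'rV[K]_n).
Variable mu : 'rV[int]_r -> 'rV[int]_n -> K.
Hypothesis charK : p \in [pchar K].
Hypothesis nd : nondegenerate_point a Lam s0 x0.
Hypothesis tr : is_transport a kappa Lam s0 x0 mu.
Local Notation e_ l := (delta_mx 0 l).
Local Notation sl j := (lattice_pt a s0 j).
Local Notation xl k := (lattice_pt a x0 k).
Local Notation pr := (pairratio a).
Local Notation sr := (siteratio a Lam).

Let ndl j k : nondegenerate_point a Lam (sl j) (xl k).
Proof. exact: (nondegenerate_lattice charK). Qed.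

Lemma transport_iter_s j k l t :
  mu (j + e_ l *+ t) k = mu j k * \prod_(0 <= i < t) phi a kappa Lam s0 x0 l (j + e_ l *+ i) k.
Proof.
case: tr => _ _ trs _; elim: t => [|t IH]; first by rewrite mulr0n addr0 big_geq ?mulr1.
by rewrite mulrSr addrA trs IH big_nat_recr //= mulrA.
Qed.

Lemma transport_iter_x j k m t :
  mu j (k + e_ m *+ t) = mu j k * \prod_(0 <= i < t) psi a Lam s0 x0 m j (k + e_ m *+ i).
Proof.
case: tr => _ _ _ trx; elim: t => [|t IH]; first by rewrite mulr0n addr0 big_geq ?mulr1.
by rewrite mulrSr addrA trx IH big_nat_recr //= mulrA.
Qed.

(* By flatness the monodromy of [mu] over a period does not depend on the base point. *)
Lemma transport_monodromy_s j k l :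
  mu (j + e_ l *+ p) k = mu j k * PhiT p a kappa Lam l s0 x0.
Proof.
case: (tr) => mu0 mu1 trs trx.
pose R j k := mu (j + e_ l *+ p) k / mu j k.
have Rs k' j' i : R (j' + e_ i) k' = R j' k'.
  rewrite /R addrAC !trs /phi lattice_pt_period // -mulf_div divff ?mulr1 //.
  by apply: contra_neq (mu0 (j' + e_ i) k') => E; rewrite trs /phi E mulr0.
have Rx j' k' i : R j' (k' + e_ i) = R j' k'.
  rewrite /R !trx /psi lattice_pt_period // -mulf_div divff ?mulr1 //.
  by apply: contra_neq (mu0 j' (k' + e_ i)) => E; rewrite trx /psi E mulr0.
have : R j k = R 0 0.
  rewrite -[j]add0r -[k]add0r (const_on_lattice (f := fun j => R j (0 + k)) (Rs _)).
  by rewrite (const_on_lattice (f := fun k => R 0 k) (Rx _)).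
rewrite /R add0r -[e_ l *+ p]add0r transport_iter_s mu1 divr1 mul1r.
rewrite (eq_bigr (fun t => Phi a kappa Lam l (bump_coord a s0 l t) x0)); last first.
  by move=> i _; rewrite /phi -bump_lattice !lattice_pt0.
by rewrite add0r => /(canRL (divfK (mu0 j k))) ->; rewrite mulrC.
Qed.

Lemma transport_monodromy_x j k m :
  mu j (k + e_ m *+ p) = mu j k * psiT p a Lam s0 x0 m 0 0.
Proof.
case: (tr) => mu0 mu1 trs trx.
pose R j k := mu j (k + e_ m *+ p) / mu j k.
have Rs k' j' i : R (j' + e_ i) k' = R j' k'.
  rewrite /R !trs /phi lattice_pt_period // -mulf_div divff ?mulr1 //.
  by apply: contra_neq (mu0 (j' + e_ i) k') => E; rewrite trs /phi E mulr0.
have Rx j' k' i : R j' (k' + e_ i) = R j' k'.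
  rewrite /R addrAC !trx /psi lattice_pt_period // -mulf_div divff ?mulr1 //.
  by apply: contra_neq (mu0 j' (k' + e_ i)) => E; rewrite trx /psi E mulr0.
have : R j k = R 0 0.
  rewrite -[j]add0r -[k]add0r (const_on_lattice (f := fun j => R j (0 + k)) (Rs _)).
  by rewrite (const_on_lattice (f := fun k => R 0 k) (Rx _)).
rewrite /R add0r -[e_ m *+ p]add0r transport_iter_x mu1 divr1 mul1r.
rewrite (eq_bigr (fun t =>
  Psi a Lam m (lattice_pt a s0 0) (bump_coord a (lattice_pt a x0 0) m t))); last first.
  by move=> i _; rewrite /psi bump_lattice.
by rewrite add0r => /(canRL (divfK (mu0 j k))) ->; rewrite mulrC.
Qed.

(** The effect on mu of raising all s_l with l in S by a. Pairs inside S are absent: their two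
    contributions cancel. *)
Definition shiftfactor (S : {set 'I_r}) (s : 'rV[K]_r) (x : 'rV[K]_n) : K :=
  \prod_(l in S) (kappa * \prod_i sr i (s 0 l - x 0 i))
  * \prod_(l in S) \prod_(v in ~: S) pr (s 0 l - s 0 v).

Definition set_shift (S : {set 'I_r}) : 'rV[int]_r := \sum_(l in S) e_ l.

Lemma set_shiftE S l : set_shift S 0 l = (l \in S)%:R.
Proof.
rewrite /set_shift summxE.
have [lS|lS] := boolP (l \in S).
  rewrite (bigD1 l) //= mxE !eqxx big1 ?addr0 // => i /andP[_ il].
  by rewrite mxE eq_sym (negPf il) andbF.
rewrite big1 // => i iS; rewrite mxE eqxx /=.
by case: eqVneq lS => // ->; rewrite iS.
Qed.

Lemma lattice_set_shift S j l :
  sl (j + set_shift S) 0 l = sl j 0 l + a * (l \in S)%:R.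
Proof.
rewrite lattice_ptD lattice_ptE set_shiftE; congr (_ + _ * _).
by case: (l \in S).
Qed.

Lemma transport_set_shift S j k :
  mu (j + set_shift S) k = mu j k * shiftfactor S (sl j) (xl k).
Proof.
case: (tr) => mu0 _ trs _.
elim/set_ind: S => [|u S uS IH].
  by rewrite /set_shift /shiftfactor !big_set0 addr0 !mulr1.
have -> : set_shift (u |: S) = set_shift S + e_ u.
  by rewrite /set_shift big_setU1 //= addrC.
rewrite addrA trs IH -mulrA; congr (_ * _).
rewrite /phi PhiE /shiftfactor !big_setU1 //=.
set s := sl j; set x := xl k.
have -> : sl (j + set_shift S) 0 u = s 0 u.
  by rewrite lattice_set_shift (negPf uS) mulr0 addr0.
have E1 : \prod_(v < r | v != u) pr (s 0 u - sl (j + set_shift S) 0 v)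
  = \prod_(v in S) pr (s 0 u - s 0 v - a) * \prod_(v in ~: (u |: S)) pr (s 0 u - s 0 v).
  rewrite (bigID (fun v => v \in S)) /=; congr (_ * _).
    apply: eq_big => [v|v /andP[_ vS]].
      by rewrite andb_idl // => vS; apply: contraNneq uS => <-.
    by rewrite lattice_set_shift vS mulr1 opprD addrA.
  apply: eq_big => [v|v /andP[_ vS]]; first by rewrite !inE negb_or.
  by rewrite lattice_set_shift (negPf vS) mulr0 addr0.
have E2 : \prod_(l in S) \prod_(v in ~: S) pr (s 0 l - s 0 v)
  = \prod_(l in S) pr (s 0 l - s 0 u)
    * \prod_(l in S) \prod_(v in ~: (u |: S)) pr (s 0 l - s 0 v).
  rewrite -big_split /=; apply: eq_bigr => l lS.
  rewrite (bigD1 u) ?inE //=; congr (_ * _); apply: eq_bigl => v.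
  by rewrite !inE negb_or andbC.
(* Here u is raised after S: its pair factors with S are taken at y - a, and they cancel the factors
   by which S was raised past the still unmoved u. *)
have E3 : \prod_(v in S) pr (s 0 u - s 0 v - a) * \prod_(l in S) pr (s 0 l - s 0 u) = 1.
  rewrite -big_split /=; apply: big1 => v vS.
  have vu : v != u by apply: contraNneq uS => <-.
  have uv : u != v by rewrite eq_sym.
  have nd' := ndl j k.
  set y := s 0 u - s 0 v.
  have -> : s 0 v - s 0 u = - y by rewrite opprB.
  have y0 : y != 0 by have := nd_ss charK nd' 0 uv; rewrite mulr0 addr0.
  have ya : y - a != 0 by have := nd_ss charK nd' (-1) uv; rewrite mulrN1.
  have y1 : y + 1 != 0 by have := nd_ss1 charK nd' 0 uv; rewrite mulr0 addr0.
  have y1a : y - a - 1 != 0.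
    have := nd_ss1 charK nd' 1 vu; rewrite mulr1 -oppr_eq0.
    by congr (_ != 0); rewrite /y /s; ring.
  have ya' : y - a + 1 != 0 by have := nd_ss1 charK nd' (-1) uv; rewrite mulrN1 addrAC.
  rewrite -pairratio_refl // mulfV // /pairratio subrK mulf_neq0 ?invr_eq0 ?mulf_neq0 //.
  by rewrite addrAC subrK.
rewrite E1 E2 -[RHS]mulr1 -[X in _ = _ * X]E3; ring.
Qed.

End TransportTheory.

(** * Carrying a factor from the last place to the first *)

Section CyclicShift.
Variables (K : fieldType) (p : nat) (n r : nat) (a kappa : K) (Lam : 'I_n -> K).
Hypothesis charK : p \in [pchar K].
Local Notation pr := (pairratio a).
Local Notation sr := (siteratio a Lam).

(** The origin of the pair factor of Phi: it is the ratio of the pair factor in reversed order to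
    the one whose first variable has been raised by a. *)
Lemma pairratio_pairfactor (y : K) : y != 0 -> y + a != 0 -> y + 1 + a != 0 ->
  pr y * ((y + a + 1) / (y + a)) = (- y + 1) / (- y).
Proof.
move=> y0 ya y1a; have y1a' : y + a + 1 != 0 by rewrite addrAC.
rewrite /pairratio; field.
by rewrite oppr_eq0 y1a ya y0.
Qed.

Section At.
Variables (s s' : 'rV[K]_r) (x x' : 'rV[K]_n) (m : 'I_n).
Variable A : {ffun 'I_r -> 'I_n}.
Let S := [set i | A i == m].
Hypothesis nd : nondegenerate_point a Lam s x.
Hypothesis s'E : forall i, s' 0 i = s 0 i + a * (i \in S)%:R.
Hypothesis x'E : forall i, x' 0 i = x 0 i + a * (i == m)%:R.
Local Notation ltn_ := (ltmove m n).
Local Notation lt0_ := (ltmove m 0).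

Let lt_n i k : ltn_ i k = (i != m) && ((k == m) || (i < k)%N).
Proof.
rewrite /ltmove; case: (i == m) => /=; first by rewrite leqNgt ltn_ord andbF.
by case: (k == m) => //=; rewrite ltn_ord.
Qed.

Let lt_0 i k : lt0_ i k = (k != m) && ((i == m) || (i < k)%N).
Proof.
by rewrite /ltmove; case: (i == m) => /=; case: (k == m) => //=; rewrite andbT.
Qed.

Let sx0 l i : s 0 l - x 0 i != 0.
Proof. by have := nd_sx charK nd 0 l i; rewrite mulr0 addr0. Qed.
Let sxa l i : s 0 l - x 0 i + a != 0.
Proof. by have := nd_sx charK nd 1 l i; rewrite mulr1. Qed.
Let sxLa l i : s 0 l - x 0 i + Lam i - a != 0.
Proof. by have := nd_sxL charK nd (-1) l i; rewrite mulrN1. Qed.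

(** The m-th site factor, at x'_m = x_m + a, undoes the contribution of Psi; the remaining ones
    replace s_i + a - x_k by s_i - x_k + Lam k, that is, they move k from the right of [m] to its
    left. *)
Let site_in i : i \in S ->
  sitefactor ltn_ (x 0) Lam (s 0 i) (A i) =
  (sr m (s 0 i - x 0 m - a))^-1 * (\prod_k sr k (s 0 i - x' 0 k))
  * sitefactor lt0_ (x' 0) Lam (s' 0 i) (A i).
Proof.
move=> iS; have := iS; rewrite inE => /eqP Ai.
have h1 : sr m (s 0 i - x 0 m - a) != 0.
  rewrite mulf_neq0 ?invr_eq0 // ?subrK //.
  by rewrite addrAC.
have -> : \prod_k sr k (s 0 i - x' 0 k) =
    sr m (s 0 i - x 0 m - a) * \prod_(k | k != m) sr k (s 0 i - x' 0 k).
  by rewrite (bigD1 m) //= x'E eqxx mulr1 opprD addrA.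
rewrite mulKf //.
rewrite /sitefactor Ai [X in _ * X]big_pred0; last by move=> k; rewrite lt_n eqxx.
rewrite [X in _ = _ * (X * _)]big_pred0; last by move=> k; rewrite lt_0 eqxx.
rewrite mulr1 mul1r [X in _ = _ * X](eq_bigl (fun k => k != m)); last first.
  by move=> k; rewrite lt_0 eqxx andbT.
rewrite -big_split /=; apply: eq_big => k; first by rewrite lt_n eqxx andbT.
rewrite lt_n eqxx andbT => km; rewrite x'E (negPf km) mulr0 addr0 s'E iS mulr1.
by rewrite /siteratio [_ + a - _]addrAC mulfVK.
Qed.

(** Only the position of [m] relative to A i changes, from right to left: s_i - x_m becomes s_i -
    x'_m + Lam m, and Psi is the ratio. *)
Let site_out i : i \notin S ->
  sitefactor ltn_ (x 0) Lam (s 0 i) (A i) =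
  (sr m (s 0 i - x 0 m - a))^-1 * sitefactor lt0_ (x' 0) Lam (s' 0 i) (A i).
Proof.
move=> iS; have := iS; rewrite inE => Ai.
rewrite s'E (negPf iS) mulr0 addr0 /sitefactor.
rewrite [X in _ * X](bigD1 m) ?lt_n ?Ai ?eqxx //=.
rewrite [X in _ = _ * (X * _)](bigD1 m) ?lt_0 ?Ai ?eqxx //=.
rewrite (eq_bigl (fun k => (k != m) && (k < A i)%N)); last first.
  by move=> k; rewrite lt_n (negPf Ai).
rewrite [X in _ * (_ * X) = _](eq_bigl (fun k => (k != m) && (A i < k)%N)); last first.
  by move=> k; rewrite lt_n Ai andbC; case: eqP.
rewrite [X in _ = _ * ((_ * X) * _)](eq_big (fun k => (k != m) && (k < A i)%N)
   (fun k => s 0 i - x 0 k + Lam k)); first last.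
- by move=> k /andP[_ km]; rewrite x'E (negPf km) mulr0 addr0.
- by move=> k; rewrite lt_0 Ai andbC; case: eqP.
rewrite [X in _ = _ * (_ * X)](eq_big (fun k => (k != m) && (A i < k)%N)
   (fun k => s 0 i - x 0 k)); first last.
- by move=> k; rewrite lt_0 => /andP[km _]; rewrite x'E (negPf km) mulr0 addr0.
- by move=> k; rewrite lt_0 (negPf Ai).
rewrite x'E eqxx mulr1 /siteratio subrK invf_div.
have -> : s 0 i - (x 0 m + a) + Lam m = s 0 i - x 0 m - a + Lam m by ring.
have h : s 0 i - x 0 m - a + Lam m != 0 by rewrite addrAC.
by field.
Qed.

Let rest i i' : K := if (A i != m) && (A i' != m) && (A i < A i')%N
  then pairfactor (s 0 i) (s 0 i') else 1.

Let pairs_n : \prod_i \prod_i' (if ltn_ (A i) (A i') then pairfactor (s 0 i) (s 0 i') else 1)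
  = \prod_i \prod_i' rest i i' * \prod_(i in S) \prod_(i' in ~: S) pairfactor (s 0 i') (s 0 i).
Proof.
rewrite [X in _ = _ * X]big_mkcond /=.
have -> : \prod_i (if i \in S then \prod_(i' in ~: S) pairfactor (s 0 i') (s 0 i) else 1)
  = \prod_i \prod_i' (if (i \in S) && (i' \notin S) then pairfactor (s 0 i') (s 0 i) else 1).
  apply: eq_bigr => i _; case: (i \in S) => /=; last by rewrite big1.
  by rewrite big_mkcond; apply: eq_bigr => i' _; rewrite !inE.
rewrite [X in _ = _ * X]exchange_big -big_split /=; apply: eq_bigr => i _.
rewrite -big_split /=; apply: eq_bigr => i' _; rewrite lt_n /rest !inE.
by case: eqP => //= Ai; case: eqP => //= Ai'; rewrite ?mulr1 ?mul1r.
Qed.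

Let pairs_0 : \prod_i \prod_i' (if lt0_ (A i) (A i') then pairfactor (s' 0 i) (s' 0 i') else 1)
  = \prod_i \prod_i' rest i i'
    * \prod_(i in S) \prod_(i' in ~: S) pairfactor (s 0 i + a) (s 0 i').
Proof.
rewrite [X in _ = _ * X]big_mkcond -big_split /=; apply: eq_bigr => i _.
have -> : (if i \in S then \prod_(i' in ~: S) pairfactor (s 0 i + a) (s 0 i') else 1)
  = \prod_i' (if (i \in S) && (i' \notin S) then pairfactor (s 0 i + a) (s 0 i') else 1).
  case: (i \in S) => /=; last by rewrite big1.
  by rewrite big_mkcond; apply: eq_bigr => i' _; rewrite !inE.
rewrite -big_split /=; apply: eq_bigr => i' _; rewrite lt_0 /rest !s'E !inE.
case: eqP => //= Ai; case: eqP => //= Ai'; rewrite ?mulr1 ?mul1r ?mulr0 ?addr0 //.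
Qed.

(** The transport follows a path that raises x_m first and the variables in S next: hence Psi at (s,
    x) but the shift factor at (s, x'). *)
Lemma wterm_shift :
  kappa ^+ #|S| * wterm ltn_ (s 0) (x 0) Lam A =
  Psi a Lam m s x * shiftfactor a kappa Lam S s x' * wterm lt0_ (s' 0) (x' 0) Lam A.
Proof.
rewrite /wterm pairs_n pairs_0 PsiE /shiftfactor.
have E1 : kappa ^+ #|S| * \prod_i (sitefactor ltn_ (x 0) Lam (s 0 i) (A i) : K) =
   \prod_i (sr m (s 0 i - x 0 m - a))^-1
   * \prod_(i in S) (kappa * \prod_k sr k (s 0 i - x' 0 k))
   * \prod_i (sitefactor lt0_ (x' 0) Lam (s' 0 i) (A i) : K).
  rewrite -prodr_const ![\prod_(i in S) _]big_mkcond /= -!big_split /=.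
  apply: eq_bigr => i _; have [iS|iS] := boolP (i \in S).
    by rewrite site_in //; ring.
  by rewrite site_out //; ring.
have E2 : \prod_(i in S) \prod_(i' in ~: S) pairfactor (s 0 i') (s 0 i) =
   \prod_(i in S) \prod_(i' in ~: S) pr (s 0 i - s 0 i')
   * \prod_(i in S) \prod_(i' in ~: S) pairfactor (s 0 i + a) (s 0 i').
  rewrite -big_split /=; apply: eq_bigr => i iS; rewrite -big_split /=.
  apply: eq_bigr => i'; rewrite inE => iS'.
  have ii' : i != i' by apply: contraNneq iS' => <-.
  have h0 := nd_ss charK nd 0 ii'; rewrite mulr0 addr0 in h0.
  have ha := nd_ss charK nd 1 ii'; rewrite mulr1 in ha.
  have h1 := nd_ss1 charK nd 1 ii'; rewrite mulr1 in h1.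
  rewrite /pairfactor [s 0 i + a - s 0 i']addrAC pairratio_pairfactor //.
  by rewrite opprB.
rewrite [LHS]mulrA E1 E2; ring.
Qed.

End At.
End CyclicShift.

Section FlatSum.
Variables (K : fieldType) (p : nat) (n r : nat) (a kappa : K) (Lam : 'I_n -> K).
Variables (s0 : 'rV[K]_r) (x0 : 'rV[K]_n).
Variable mu : 'rV[int]_r -> 'rV[int]_n -> K.
Hypothesis charK : p \in [pchar K].
Hypothesis nd : nondegenerate_point a Lam s0 x0.
Hypothesis tr : is_transport a kappa Lam s0 x0 mu.
Hypothesis bethe : forall l : 'I_r, PhiT p a kappa Lam l s0 x0 = 1.
Local Notation sl j := (lattice_pt a s0 j).
Local Notation xl k := (lattice_pt a x0 k).
Local Notation J := (map_mx (fun t : 'I_p => Posz t)).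

Lemma transport_period j k l : mu (j + delta_mx 0 l *+ p) k = mu j k.
Proof. by rewrite (transport_monodromy_s charK tr) bethe mulr1. Qed.

Lemma transport_sum_shift (V : lmodType K) (g : 'rV[K]_r -> V) k S :
  \sum_(i : 'rV['I_p]_r) mu (J i) k *: g (sl (J i))
  = \sum_(i : 'rV['I_p]_r) (mu (J i) k * shiftfactor a kappa Lam S (sl (J i)) (xl k))
      *: g (sl (J i + set_shift S)).
Proof.
have p0 : (0 < p)%N := prime_gt0 (pcharf_prime charK).
rewrite -(lattice_sum_shift (f := fun j => mu j k *: g (sl j)) (set_shift S) p0).
  by apply: eq_bigr => i _; rewrite (transport_set_shift charK nd tr).
by move=> z l; rewrite transport_period lattice_pt_period.
Qed.

(** Stated for a single A, because the set of shifted variables depends on A; after that shift, the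
    sums over a full period agree. *)
Lemma wterm_sum_shift (A : {ffun 'I_r -> 'I_n}) m k :
  \sum_(i : 'rV['I_p]_r) mu (J i) k
    * (kappa ^+ content A m * wterm (ltmove m n) (sl (J i) 0) (xl k 0) Lam A)
  = \sum_(i : 'rV['I_p]_r) mu (J i) (k + delta_mx 0 m)
    * wterm (ltmove m 0) (sl (J i) 0) (xl (k + delta_mx 0 m) 0) Lam A.
Proof.
pose S := [set i | A i == m]; set k' := k + _.
have := transport_sum_shift (V := K^o)
  (fun s => wterm (ltmove m 0) (s 0) (xl k' 0) Lam A) k' S.
move=> ->; apply: eq_bigr => i _; rewrite mnmE.
rewrite (wterm_shift kappa charK (nondegenerate_lattice charK (J i) k nd)
  (s' := sl (J i + set_shift S)) (x' := xl k')).
- by case: tr => _ _ _ ->; rewrite /psi /GRing.scale /=; ring.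
- by move=> l; rewrite lattice_set_shift.
- move=> l; rewrite /k' lattice_ptD lattice_ptE; congr (_ + _ * _).
  by rewrite mxE /=; case: (l == m).
Qed.

End FlatSum.

(** * The action of e *)

Section DiagonalE.
Variables (K : fieldType) (n r : nat) (Lam : 'I_n -> K).
Variables (x : 'I_n -> K).
Local Notation lt0 := (fun i k : 'I_n => (i < k)%N).

HB.instance Definition _ (i : 'I_n) := GRing.Linear.copy (ve Lam i) (ve Lam i).

Definition restterm (l : 'I_r) (s : 'I_r -> K) (A : {ffun 'I_r -> 'I_n}) : K :=
  \prod_(j | j != l) sitefactor lt0 x Lam (s j) (A j)
  * \prod_(j | j != l) \prod_(j' | j' != l)
      (if (A j < A j')%N then pairfactor (s j) (s j') else 1).

Definition restcontent (l : 'I_r) (A : {ffun 'I_r -> 'I_n}) : 'X_{1..n} :=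
  [multinom #|[set j | (j != l) && (A j == t)]| | t < n].

(* The contribution of [s l] when it is placed between the factors [u - 1] and [u]. *)
Definition insertion (l : 'I_r) (s : 'I_r -> K) (A : {ffun 'I_r -> 'I_n}) (u : nat) : K :=
  \prod_(k < n | (k < u)%N) (s l - x k + Lam k) * \prod_(k < n | (u <= k)%N) (s l - x k)
  * (\prod_(j | (j != l) && (A j < u)%N) pairfactor (s j) (s l)
     * \prod_(j | (j != l) && (u <= A j)%N) pairfactor (s l) (s j)).

Definition last_insertion (l : 'I_r) (s : 'I_r -> K) : K :=
  \prod_k (s l - x k + Lam k) * \prod_(j | j != l) pairfactor (s j) (s l).

Definition first_insertion (l : 'I_r) (s : 'I_r -> K) : K :=
  \prod_k (s l - x k) * \prod_(j | j != l) pairfactor (s l) (s j).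

Lemma insertion0 l s A : insertion l s A 0 = first_insertion l s.
Proof.
rewrite /insertion [X in X * _ * _]big_pred0 // [X in _ * (X * _)]big_pred0; last first.
  by move=> j; rewrite ltn0 andbF.
by rewrite !mul1r; congr (_ * _); apply: eq_bigl => j; rewrite leq0n andbT.
Qed.

Lemma insertionn l s A : insertion l s A n = last_insertion l s.
Proof.
rewrite /insertion [X in _ * X * _]big_pred0; last by move=> k; rewrite leqNgt ltn_ord.
rewrite [X in _ * (_ * X)]big_pred0; last by move=> j; rewrite leqNgt ltn_ord andbF.
rewrite !mulr1; congr (_ * _); apply: eq_bigl => k; by rewrite ltn_ord ?andbT.
Qed.

Variable s : 'I_r -> K.
Hypothesis s_inj : injective s.

Definition fiber (A : {ffun 'I_r -> 'I_n}) t : {set 'I_r} := [set j | A j == t].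

(** In the [res] term s_l stands to the right of the other variables of its site, as if inserted
    after the factor t; in the [cores] term it stands to their left, as if inserted before t. *)
Lemma wterm_insertion (l : 'I_r) (A : {ffun 'I_r -> 'I_n}) (t := A l) :
  wterm lt0 s x Lam A * ((s l - x t + Lam t) * res s (fiber A t) l
                          - (s l - x t) * cores s (fiber A t) l)
  = restterm l s A * (insertion l s A t.+1 - insertion l s A t).
Proof.
pose U := \prod_(j | (j != l) && (A j < t)%N) pairfactor (s j) (s l).
pose V := \prod_(j | (j != l) && (t < A j)%N) pairfactor (s l) (s j).
pose X1 := \prod_(k < n | (k < t)%N) (s l - x k + Lam k).
pose X2 := \prod_(k < n | (t < k)%N) (s l - x k).
have resE : res s (fiber A t) l = \prod_(j | (j != l) && (A j == t)) pairfactor (s j) (s l).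
  by apply: eq_bigl => j; rewrite !inE.
have coresE' : cores s (fiber A t) l = \prod_(j | (j != l) && (A j == t)) pairfactor (s l) (s j).
  by apply: eq_bigl => j; rewrite !inE.
have E1 : insertion l s A t.+1
    = X1 * (s l - x t + Lam t) * X2 * (U * res s (fiber A t) l * V).
  rewrite /insertion; congr (_ * _ * (_ * _)).
    rewrite (bigD1 t) //= mulrC; congr (_ * _); apply: eq_bigl => k.
    by rewrite ltnS ltn_neqAle andbC.
  rewrite (bigID (fun j => A j == t)) /= mulrC resE; congr (_ * _); apply: eq_bigl => j.
    by rewrite ltnS ltn_neqAle -andbA [(_ <= _)%N && _]andbC.
  by rewrite -andbA; congr (_ && _); rewrite andbC andb_idr // => /eqP ->.
have E0 : insertion l s A t
    = X1 * (s l - x t) * X2 * (U * cores s (fiber A t) l * V).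
  have P1 : \prod_(k < n | (t <= k)%N) (s l - x k) = (s l - x t) * X2.
    rewrite (bigD1 t) //=; congr (_ * _); apply: eq_bigl => k.
    by rewrite ltn_neqAle andbC eq_sym.
  have P2 : \prod_(j | (j != l) && (t <= A j)%N) pairfactor (s l) (s j)
      = cores s (fiber A t) l * V.
    rewrite (bigID (fun j => A j == t)) /= coresE'; congr (_ * _); apply: eq_bigl => j.
      by rewrite -andbA; congr (_ && _); rewrite andbC andb_idr // => /eqP ->.
    by rewrite -andbA; congr (_ && _); rewrite ltn_neqAle eq_sym andbC.
  by rewrite /insertion P1 P2 -/X1 -/U; ring.
have E : wterm lt0 s x Lam A = restterm l s A * (X1 * X2 * (U * V)).
  rewrite /wterm /restterm (bigD1 l) //= [X in _ * X](bigD1 l) //=.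
  rewrite [X in _ * (X * _) = _](bigD1 l) //= ltnn mul1r.
  have -> : \prod_(i | i != l) \prod_i' (if (A i < A i')%N then pairfactor (s i) (s i') else 1)
    = U * \prod_(i | i != l) \prod_(i' | i' != l)
        (if (A i < A i')%N then pairfactor (s i) (s i') else 1).
    rewrite /U big_mkcondr -big_split /=; apply: eq_bigr => i il.
    by rewrite (bigD1 l).
  have -> : \prod_(i' | i' != l) (if (A l < A i')%N then pairfactor (s l) (s i') else 1) = V.
    by rewrite /V big_mkcondr.
  by rewrite /sitefactor -/t -/X1 -/X2; ring.
by rewrite E E1 E0; ring.
Qed.

Lemma contentB (A : {ffun 'I_r -> 'I_n}) l : (content A - U_(A l))%MM = restcontent l A.
Proof.
apply/mnmP => t; rewrite mnmBE mnm1E !mnmE; case: (eqVneq (A l) t) => [Al|Al].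
  rewrite (cardsD1 l) inE Al eqxx addKn; apply: eq_card => j; by rewrite !inE.
rewrite subn0; apply: eq_card => j; rewrite !inE; case: (eqVneq j l) => // ->.
by rewrite (negPf Al).
Qed.

(** The coefficient of e depends only on the number of variables at a site; [sum_res_cores] spreads
    it over these variables, which makes the telescoping possible. *)
Lemma ve_diag_content (A : {ffun 'I_r -> 'I_n}) :
  ve_diag Lam 'X_[content A] = \sum_l ((s l - x (A l) + Lam (A l)) * res s (fiber A (A l)) l
      - (s l - x (A l)) * cores s (fiber A (A l)) l) *: 'X_[restcontent l A].
Proof.
rewrite (partition_big A xpredT) //=; apply: eq_bigr => t _.
rewrite /ve linextX mnmE -/(fiber A t) -(sum_res_cores s_inj (Lam t) (x t) (fiber A t)).
rewrite scaler_suml; apply: eq_big => l; first by rewrite inE.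
by rewrite inE => /eqP Al; rewrite Al -contentB Al.
Qed.

(** The maps with A l = t0 encode the distributions of the variables other than s_l; t0 is an
    arbitrary parking place for l. *)
Lemma ve_diag_wvec (t0 : 'I_n) : ve_diag Lam (wvec lt0 s x Lam) =
  \sum_l \sum_(A : {ffun 'I_r -> 'I_n} | A l == t0)
    (restterm l s A * (last_insertion l s - first_insertion l s)) *: 'X_[restcontent l A].
Proof.
transitivity (\sum_(A : {ffun 'I_r -> 'I_n}) wterm lt0 s x Lam A *: ve_diag Lam 'X_[content A]).
  rewrite /wvec /ve_diag; under eq_bigr do rewrite linear_sum /=.
  rewrite exchange_big; apply: eq_bigr => A _; rewrite scaler_sumr.
  by apply: eq_bigr => i _; rewrite linearZ.
under eq_bigr do rewrite ve_diag_content scaler_sumr.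
rewrite exchange_big; apply: eq_bigr => l _.
pose put (A : {ffun 'I_r -> 'I_n}) t : {ffun 'I_r -> 'I_n} := [ffun j => if j == l then t else A j].
rewrite (partition_big (fun A => put A t0) (fun A => A l == t0)) /=; last first.
  by move=> A _; rewrite ffunE eqxx.
apply: eq_bigr => A0 /eqP A0l.
have putE A t : put A t l = t by rewrite ffunE eqxx.
have putN A t j : j != l -> put A t j = A j by move=> jl; rewrite ffunE (negPf jl).
rewrite (reindex_onto (put A0) (fun A => A l)) /=; last first.
  move=> A /eqP <-; apply/ffunP => j; rewrite !ffunE; case: (eqVneq j l) => // ->//.
rewrite (eq_bigl xpredT); last first.
  move=> t; rewrite putE eqxx andbT; apply/eqP/ffunP => j; rewrite !ffunE.
  by case: (eqVneq j l) => // ->.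
rewrite -(insertionn l s A0) -(insertion0 l s A0) -telescope_sumr //.
rewrite big_mkord mulr_sumr scaler_suml; apply: eq_bigr => t _.
rewrite scalerA wterm_insertion putE; congr (_ *: 'X_[_]).
  congr (_ * _); last congr (_ - _).
  - rewrite /restterm; congr (_ * _); apply: eq_bigr => j jl; first by rewrite putN.
    by apply: eq_bigr => j' jl'; rewrite !putN.
  - by rewrite /insertion; congr (_ * (_ * _)); apply: eq_bigl => j;
      case: (eqVneq j l) => //= jl; rewrite putN.
  - by rewrite /insertion; congr (_ * (_ * _)); apply: eq_bigl => j;
      case: (eqVneq j l) => //= jl; rewrite putN.
apply/mnmP => t'; rewrite !mnmE; apply: eq_card => j; rewrite !inE.
by case: (eqVneq j l) => //= jl; rewrite putN.
Qed.

End DiagonalE.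

(** * The symmetrization formula and its integrality *)

Lemma sum_perm_lift (V : nmodType) n (i0 : 'I_n.+1) (f : 'S_n.+1 -> V) :
  \sum_s f s = \sum_k \sum_(t : 'S_n) f (lift_perm i0 k t).
Proof.
rewrite (partition_big (fun s : 'S_n.+1 => s i0) xpredT) //=; apply: eq_bigr => k _.
pose g (s : 'S_n.+1) (k' : 'I_n) : 'I_n := odflt k' (unlift (s i0) (s (lift i0 k'))).
have gK (s : 'S_n.+1) k' : lift (s i0) (g s k') = s (lift i0 k').
  have : s i0 != s (lift i0 k') by rewrite (inj_eq perm_inj) neq_lift.
  by rewrite /g => /unlift_some[? ? ->].
have g_inj (s : 'S_n.+1) : injective (g s).
  by move=> a b /(congr1 (lift (s i0))); rewrite !gK => /perm_inj/lift_inj.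
rewrite (reindex_onto (lift_perm i0 k) (fun s => perm (@g_inj s))) /=; last first.
  move=> s /eqP si0; apply/permP => l; case: (unliftP i0 l) => [l'|] ->.
    by rewrite lift_perm_lift permE -si0 gK.
  by rewrite lift_perm_id.
apply: eq_bigl => t; rewrite lift_perm_id eqxx /=; apply/eqP/permP => l.
by rewrite permE /g lift_perm_id lift_perm_lift liftK.
Qed.

Lemma big_lift (R : Type) (idx : R) (op : Monoid.com_law idx) n (k : 'I_n.+1) (P : pred 'I_n.+1)
    (f : 'I_n.+1 -> R) :
  \big[op/idx]_(i | (i != k) && P i) f i = \big[op/idx]_(i < n | P (lift k i)) f (lift k i).
Proof.
rewrite big_mkcond (bigD1_ord k) //= eqxx Monoid.mul1m [RHS]big_mkcond.
by apply: eq_bigr => i _; rewrite eq_sym neq_lift.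
Qed.

(* The symmetrization identity over the subgroup preserving the fibers of a map:
   the value at the last index is split off, and [sum_res] does the induction step. *)
Lemma sum_perm_pairfactor (F : fieldType) (T : finType) r (s : 'I_r -> F) (blk A : 'I_r -> T) :
  injective s -> (forall t, #|[set j | blk j == t]| = #|[set j | A j == t]|) ->
  \sum_(sig : 'S_r | [forall j, A (sig j) == blk j])
    \prod_(j < r) \prod_(j' < r | (j < j')%N && (blk j == blk j'))
      pairfactor (s (sig j)) (s (sig j'))
  = (\prod_t #|[set j | blk j == t]|`!)%N%:R.
Proof.
elim: r s blk A => [|r IH] s blk A s_inj cnt.
  rewrite (eq_bigr (fun=> 1)); last by move=> sig _; rewrite big_ord0.
  rewrite (eq_bigl xpredT) => [|sig]; last by apply/forallP => -[].
  rewrite sumr_const [X in _ *+ X](_ : _ = 1%N).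
    by rewrite big1 // => t _; rewrite (_ : [set j | _] = set0) ?cards0 //; apply/setP => -[].
  by have := card_Sn 0; rewrite fact0 => <-; apply: eq_card => sig; rewrite !inE.
set b := blk ord_max; set S := [set j | A j == b].
pose w (j : 'I_r) := lift ord_max j.
have cardD (B : 'I_r.+1 -> T) (k : 'I_r.+1) t :
    #|[set j | B j == t]| = ((B k == t) + #|[set j : 'I_r | B (lift k j) == t]|)%N.
  rewrite -!sum1_card !(eq_bigl _ _ (in_set _)).
  by rewrite big_mkcond (bigD1_ord k) //= -big_mkcond; case: (B k == t).
have IHk k : A k = b ->
    \sum_(t : 'S_r | [forall j, A (lift k (t j)) == blk (w j)])
      \prod_(j < r) \prod_(j' < r | (j < j')%N && (blk (w j) == blk (w j')))
        pairfactor (s (lift k (t j))) (s (lift k (t j')))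
    = (\prod_t #|[set j | blk (w j) == t]|`!)%N%:R.
  move=> Ak; apply: (IH (s \o lift k) (blk \o w) (A \o lift k)).
    by move=> i j /s_inj/lift_inj.
  move=> t; have := cnt t; rewrite (cardD blk ord_max) (cardD A k) Ak.
  by move/addnI.
rewrite big_mkcond (sum_perm_lift ord_max) /=.
transitivity (\sum_(k in S) res s S k * (\prod_t #|[set j | blk (w j) == t]|`!)%N%:R).
  rewrite [RHS]big_mkcond; apply: eq_bigr => k _; rewrite inE; case: eqP => [Ak|Ak]; last first.
    apply: big1 => t _; case: ifP => // /forallP/(_ ord_max).
    by rewrite lift_perm_id => /eqP.
  rewrite -(IHk k Ak) mulr_sumr [RHS]big_mkcond; apply: eq_bigr => t _.
  have -> : [forall j, A (lift_perm ord_max k t j) == blk j]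
     = [forall j, A (lift k (t j)) == blk (w j)].
    apply/forallP/forallP => H j; first by have := H (w j); rewrite lift_perm_lift.
    by case: (unliftP ord_max j) => [j'|] ->; rewrite ?lift_perm_lift ?lift_perm_id ?Ak.
  case: ifP => // /forallP At.
  rewrite (bigD1_ord ord_max) //= [X in X * _]big_pred0 ?mul1r; last first.
    by move=> j; rewrite ltnNge -ltnS ltn_ord.
  have -> : res s S k = \prod_(j < r | blk (w j) == b)
      pairfactor (s (lift k (t j))) (s k).
    rewrite /res (eq_bigl (fun j => (j != k) && (A j == b))); last by move=> j; rewrite !inE.
    rewrite big_lift (reindex_inj (perm_inj (s := t))); apply: eq_bigl => j.
    by rewrite (eqP (At j)).
  rewrite [X in X * _]big_mkcond -big_split /=; apply: eq_bigr => j _.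
  rewrite big_mkcond (bigD1_ord ord_max) //= -big_mkcond lift_perm_id !lift_perm_lift.
  have bumpr (i : 'I_r) : bump r i = i by exact: lift_max.
  rewrite bumpr ltn_ord /=; congr (_ * _).
  by apply: eq_big => j'; rewrite ?bumpr ?lift_perm_lift.
rewrite -mulr_suml (sum_res s_inj) -natrM; congr _%:R.
rewrite (bigD1 b) //= [in RHS](bigD1 b) //= mulnA; congr (_ * _)%N.
  rewrite -cnt !(cardD blk ord_max b) eqxx add1n factS //.
by apply: eq_bigr => t tb; rewrite (cardD blk ord_max t) eq_sym (negPf tb).
Qed.

(** * From the symmetrization over permutations to the sum over maps *)

Section Blocks.
Variables (n r : nat) (rho : 'X_{1..n}).
Hypothesis rhoE : mdeg rho = r.

Let start (q : nat) : nat := (\sum_(i < n | i < q) rho i)%N.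

Let startS (i : 'I_n) : start i.+1 = (start i + rho i)%N.
Proof.
rewrite /start (bigD1 i) //= addnC; congr (_ + _)%N; apply: eq_bigl => k.
by rewrite ltnS ltn_neqAle andbC.
Qed.

Let start_mono q q' : (q <= q')%N -> (start q <= start q')%N.
Proof.
move=> qq'; rewrite /start [leqRHS](bigID (fun i : 'I_n => (i < q)%N)) /=.
rewrite (eq_bigl (fun i : 'I_n => (i < q')%N && (i < q)%N)) ?leq_addr // => i.
by rewrite andb_idl // => iq; apply: leq_trans iq qq'.
Qed.

Let startn : start n = r.
Proof. by rewrite -rhoE mdegE; apply: eq_bigl => i; rewrite ltn_ord. Qed.

Lemma block_of_subproof (j : 'I_r) :
  {i : 'I_n | (block_start rho i <= j < block_start rho i + rho i)%N}.
Proof.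
apply/sigW; have ex : exists q, (j < start q)%N by exists n; rewrite startn.
case: (ex_minnP ex) => -[|q]; first by rewrite /start big_pred0.
move=> jq qmin.
have qn : (q < n)%N.
  by rewrite -ltnS; apply: (leq_ltn_trans (qmin n _)); rewrite ?startn.
exists (Ordinal qn); rewrite -[block_start _ _]/(start q) -(startS (Ordinal qn)) jq andbT.
by rewrite leqNgt; apply/negP => /qmin; rewrite ltnn.
Qed.

Definition block_of (j : 'I_r) : 'I_n := sval (block_of_subproof j).

Lemma mem_block (i : 'I_n) (j : 'I_r) :
  (block_start rho i <= j < block_start rho i + rho i)%N = (block_of j == i).
Proof.
rewrite /block_of; case: block_of_subproof => k /= kP; apply/idP/eqP => [iP|<-//].
move: kP iP; rewrite -[block_start _ k]/(start k) -[block_start _ i]/(start i) -!startS.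
case/andP=> k1 k2 /andP[i1 i2]; apply: ord_inj; apply/eqP.
rewrite eqn_leq leqNgt [X in _ && X]leqNgt; apply/andP; split; apply/negP => lt.
  have := leq_trans (leq_trans i2 (start_mono lt)) k1; by rewrite ltnn.
have := leq_trans (leq_trans k2 (start_mono lt)) i1; by rewrite ltnn.
Qed.

Lemma block_of_mono (j j' : 'I_r) : (j <= j')%N -> (block_of j <= block_of j')%N.
Proof.
move=> jj'; rewrite leqNgt; apply/negP => lt.
have := mem_block (block_of j) j; rewrite eqxx => /andP[h1 _].
have := mem_block (block_of j') j'; rewrite eqxx => /andP[_ h2].
rewrite -[block_start _ _]/(start _) -startS in h2.
rewrite -[block_start _ _]/(start _) in h1.
have := leq_trans (leq_trans (leq_ltn_trans jj' h2) (start_mono lt)) h1.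
by rewrite ltnn.
Qed.

Lemma card_block i : #|[set j | block_of j == i]| = rho i.
Proof.
rewrite -sum1_card (eq_bigl (fun j : 'I_r => (start i <= j < start i.+1)%N)); last first.
  by move=> j; rewrite inE -mem_block startS.
have ri : (start i.+1 <= r)%N by rewrite -startn; apply: start_mono.
rewrite -(big_mkord (fun j => (start i <= j < start i.+1)%N) (fun=> 1%N)).
rewrite -big_filter.
have -> : [seq j <- index_iota 0 r | (start i <= j < start i.+1)%N]
    = index_iota (start i) (start i.+1).
  apply: (irr_sorted_eq ltn_trans ltnn); rewrite ?sorted_filter ?iota_ltn_sorted //.
  - exact: ltn_trans.
  - move=> j; rewrite mem_filter !mem_index_iota; lia.
by rewrite sum_nat_const_nat muln1 startS addKn.
Qed.

End Blocks.

Section WeightFormula.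
Variables (F : fieldType) (n r : nat) (s : 'I_r -> F) (x Lam : 'I_n -> F) (rho : 'X_{1..n}).
Hypothesis F0 : [pchar F] =i pred0.
Hypothesis s_inj : injective s.
Hypothesis rhoE : mdeg rho = r.
Local Notation lt0 := (fun i k : 'I_n => (i < k)%N).
Local Notation blk := (block_of rhoE).

Lemma weight_termE (s' : 'I_r -> F) : weight_term x Lam rho s' =
  \prod_j sitefactor lt0 x Lam (s' j) (blk j)
  * \prod_(j < r) \prod_(j' < r | (j < j')%N) pairfactor (s' j) (s' j').
Proof.
rewrite /weight_term; congr (_ * _).
rewrite (exchange_big_dep xpredT) //=; apply: eq_bigr => j _.
rewrite (eq_bigl (fun i => i == blk j)); last by move=> i; rewrite mem_block eq_sym.
by rewrite big_pred1_eq.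
Qed.

(** Group the permutations by the map A they induce. Pairs from different blocks give the pair
    factors of [wterm], as the blocks are increasing; those within a block sum to the factorials
    that the formula divides by. *)
Lemma weight_formulaE : weight_formula s x Lam rho =
  \sum_(A : {ffun 'I_r -> 'I_n} | content A == rho) wterm lt0 s x Lam A.
Proof.
rewrite /weight_formula; set N := (\prod_(i < n) (rho i)`!)%N.
have N0 : N%:R != 0 :> F.
  rewrite (pcharf0P F).1 // -lt0n; apply/prodn_gt0 => i; exact: fact_gt0.
apply: (mulfI N0); rewrite mulVKf // mulr_sumr.
pose col (sig : 'S_r) : {ffun 'I_r -> 'I_n} := [ffun k => blk (sig^-1%g k)].
have colE A sig : (col sig == A) = [forall j, A (sig j) == blk j].
  apply/eqP/forallP => [<- j|H]; first by rewrite ffunE permK.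
  by apply/ffunP => k; rewrite ffunE -(eqP (H _)) permKV.
have cnt t : #|[set j | blk j == t]| = rho t := card_block rhoE t.
rewrite (partition_big col (fun A => content A == rho)) /=; last first.
  move=> sig _; apply/eqP/mnmP => t; rewrite mnmE -cnt -[RHS](card_imset _ (@perm_inj _ sig)).
  apply: eq_card => k; rewrite inE ffunE; apply/eqP/imsetP => [H|[j]].
    by exists (sig^-1%g k); rewrite ?inE ?permKV // H.
  by rewrite inE => /eqP <- ->; rewrite permK.
apply: eq_bigr => A /eqP AE; rewrite (eq_bigl _ _ (colE A)) mulrC.
have <- : \sum_(sig : 'S_r | [forall j, A (sig j) == blk j])
    \prod_(j < r) \prod_(j' < r | (j < j')%N && (blk j == blk j'))
      pairfactor (s (sig j)) (s (sig j')) = N%:R.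
  rewrite sum_perm_pairfactor //; last by move=> t; rewrite cnt -AE mnmE.
  by congr _%:R; apply: eq_bigr => t _; rewrite cnt.
rewrite mulr_sumr; apply: eq_bigr => sig /forallP HA; rewrite weight_termE /wterm.
rewrite [in RHS](reindex_inj (perm_inj (s := sig))) /= -[RHS]mulrA; congr (_ * _).
  by apply: eq_bigr => j _; rewrite (eqP (HA j)).
rewrite [X in _ = X * _](reindex_inj (perm_inj (s := sig))) /= -big_split /=.
apply: eq_bigr => j _; rewrite [X in _ = X * _](reindex_inj (perm_inj (s := sig))) /=.
rewrite big_mkcond [X in _ = _ * X]big_mkcond -big_split /=; apply: eq_bigr => j' _.
rewrite !(eqP (HA _)); case: (ltngtP (blk j) (blk j')) => [lt|lt|/val_inj eq] /=.
- have -> : (j < j')%N.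
    by rewrite ltnNge; apply/negP => /(block_of_mono rhoE); rewrite leqNgt lt.
  have /negPf -> : blk j != blk j' by rewrite neq_ltn lt.
  by rewrite mulr1.
- have -> : (j < j')%N = false.
    by apply/negP => /ltnW/(block_of_mono rhoE); rewrite leqNgt lt.
  by rewrite mulr1.
- by rewrite eq eqxx andbT mul1r.
Qed.

End WeightFormula.

Section OrderedPairs.
Variable r : nat.

Lemma prod_pairs_split (R : comPzRingType) (f : 'I_r -> 'I_r -> R) :
  \prod_j \prod_j' f j j' = (\prod_j f j j)
    * \prod_(j < r) \prod_(j' < r | (j < j')%N) (f j j' * f j' j).
Proof.
have E : \prod_(j < r) \prod_(j' < r | (j < j')%N) (f j j' * f j' j)
    = \prod_(j < r) (\prod_(j' < r | (j < j')%N) f j j' * \prod_(j' < r | (j' < j)%N) f j j').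
  under eq_bigr do rewrite big_split /=; rewrite !big_split /=; congr (_ * _).
  by rewrite (exchange_big_dep xpredT).
rewrite E -big_split /=; apply: eq_bigr => j _; rewrite (bigD1 j) //=; congr (_ * _).
rewrite (bigID (fun j' : 'I_r => (j < j')%N)) /=; congr (_ * _); apply: eq_bigl => j'.
  by rewrite andb_idl // => jj'; rewrite neq_ltn jj' orbT.
by rewrite -leqNgt ltn_neqAle.
Qed.

Definition perm_sign (sig : 'S_r) : int :=
  \prod_(j < r) \prod_(j' < r | (j < j')%N) (if (sig j < sig j')%N then 1 else -1).

(** The pairs j < j' are reindexed by their images under the permutation put back in increasing
    order; each inversion costs a sign. *)
Lemma prod_antisym_perm (R : comNzRingType) (q : 'I_r -> 'I_r -> R) (sig : 'S_r) :
  (forall j j', q j' j = - q j j') ->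
  \prod_(j < r) \prod_(j' < r | (j < j')%N) q (sig j) (sig j')
  = (perm_sign sig)%:~R * \prod_(j < r) \prod_(j' < r | (j < j')%N) q j j'.
Proof.
move=> qN; pose sort (u : 'I_r * 'I_r) := if (u.1 < u.2)%N then u else (u.2, u.1).
rewrite /perm_sign rmorph_prod; under [X in _ = X * _]eq_bigr do rewrite rmorph_prod.
rewrite !pair_big_dep /= [X in _ = _ * X](reindex_onto
  (fun u => sort (sig u.1, sig u.2)) (fun u => sort (sig^-1%g u.1, sig^-1%g u.2))) /=; last first.
  move=> [u v] /= uv; rewrite /sort /=.
  by case: (ltnP (sig^-1%g u) _) => _ /=; rewrite !permKV ?uv // ltnNge ltnW.
rewrite [X in _ = _ * X](eq_bigl (fun u : 'I_r * 'I_r => (u.1 < u.2)%N)) => [|[u v]] /=; last first.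
  have [->|uv] := eqVneq u v; first by rewrite /sort /= !ltnn /= ?ltnn.
  have suv : sig u != sig v by rewrite (inj_eq perm_inj).
  have pair_neq : ((v, u) == (u, v)) = false.
    by apply/eqP => -[vu _]; rewrite vu eqxx in uv.
  rewrite /sort /=; case: (ltnP (sig u) (sig v)) => h /=.
    by rewrite ?h !permK; case: ltnP => _ /=; rewrite ?eqxx ?pair_neq.
  rewrite !permK ltn_neqAle eq_sym suv h /= ltnNge.
  have [uv'|uv'] := leqP u v; last by rewrite pair_neq ltnNge ltnW.
  by rewrite ltn_neqAle uv uv' eqxx.
rewrite -big_split /=; apply: eq_bigr => -[u v] /= uv; rewrite /sort /=.
case: ifP => _; first by rewrite mul1r.
by rewrite /= qN rmorphN1 mulN1r.
Qed.

(** Inversions are not counted: the Vandermonde determinant of the distinct integers 0, ..., r - 1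
    changes sign under a column exchange, and being nonzero it can be cancelled. *)
Lemma perm_sign_tperm j1 j2 : j1 != j2 -> perm_sign (tperm j1 j2) = -1.
Proof.
move=> j12; pose b : 'rV[int]_r := \row_j (j%:Z).
have qE (c : 'rV[int]_r) : \prod_(i < r) \prod_(j < r | (i < j)%N) (c 0 j - c 0 i)
  = \det (Vandermonde r c) by rewrite det_Vandermonde.
have := @prod_antisym_perm int (fun i j => b 0 j - b 0 i) (tperm j1 j2).
move=> /(_ (fun i j => esym (opprB _ _))).
have -> : \prod_(j < r) \prod_(j' < r | (j < j')%N) (b 0 (tperm j1 j2 j') - b 0 (tperm j1 j2 j))
   = \det (Vandermonde r (\row_j b 0 (tperm j1 j2 j))).
  by rewrite -qE; apply: eq_bigr => i _; apply: eq_bigr => j _; rewrite !mxE.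
have -> : Vandermonde r (\row_j b 0 (tperm j1 j2 j)) = xcol j1 j2 (Vandermonde r b).
  by apply/matrixP => i j; rewrite !mxE.
rewrite xcolE det_mulmx det_perm odd_tperm j12 expr1 mulrC qE intz => /mulIf H.
apply/esym/H; rewrite -qE; apply/prodf_neq0 => i _; apply/prodf_neq0 => j ij.
by rewrite !mxE subr_eq0 eqz_nat neq_ltn ij orbT.
Qed.

End OrderedPairs.

(** * Integrality of the weight polynomials *)

Section WeightNumerator.
Variables (n r : nat).
Local Notation lt0 := (fun i k : 'I_n => (i < k)%N).

(** The pair contribution to [wterm], multiplied by u - v. It is a polynomial, and it changes sign
    when (i, u) and (k, v) are exchanged. *)
Definition pairnum (R : comNzRingType) (i k : 'I_n) (u v : R) : R :=
  if (i < k)%N then u - v + 1 else if (k < i)%N then u - v - 1 else u - v.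

(* The numerator of the weight function over the common denominator [vdm]. *)
Definition weight_num (R : comNzRingType) (s : 'I_r -> R) (x Lam : 'I_n -> R)
    (rho : 'X_{1..n}) : R :=
  \sum_(A : {ffun 'I_r -> 'I_n} | content A == rho)
    \prod_j sitefactor lt0 x Lam (s j) (A j)
    * \prod_(j < r) \prod_(j' < r | (j < j')%N) pairnum (A j) (A j') (s j) (s j').

Definition vdm (R : comNzRingType) (s : 'I_r -> R) : R :=
  \prod_(j < r) \prod_(j' < r | (j < j')%N) (s j - s j').

Lemma weight_num_rmorph (R R' : comNzRingType) (f : {rmorphism R -> R'}) s x Lam rho :
  f (weight_num s x Lam rho) = weight_num (f \o s) (f \o x) (f \o Lam) rho.
Proof.
rewrite /weight_num rmorph_sum; apply: eq_bigr => A _; rewrite rmorphM !rmorph_prod.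
congr (_ * _); apply: eq_bigr => j _.
  rewrite /sitefactor rmorphM !rmorph_prod; congr (_ * _); apply: eq_bigr => k _ /=.
    by rewrite rmorphD rmorphB.
  by rewrite rmorphB.
rewrite rmorph_prod; apply: eq_bigr => j' _; rewrite /pairnum /=.
by case: ifP => _; [rewrite rmorphD rmorphB rmorph1|case: ifP => _; rewrite !rmorphB ?rmorph1].
Qed.

Lemma eq_weight_num (R : comNzRingType) (s s' : 'I_r -> R) x x' Lam Lam' rho :
  s =1 s' -> x =1 x' -> Lam =1 Lam' ->
  weight_num s x Lam rho = weight_num s' x' Lam' rho.
Proof.
move=> ss xx LL; apply: eq_bigr => A _; congr (_ * _); apply: eq_bigr => j _.
  by rewrite ss; congr (_ * _); apply: eq_bigr => k _; rewrite xx ?LL.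
by apply: eq_bigr => j' _; rewrite !ss.
Qed.

Lemma eq_vdm (R : comNzRingType) (s s' : 'I_r -> R) : s =1 s' -> vdm s = vdm s'.
Proof. by move=> ss; apply: eq_bigr => j _; apply: eq_bigr => j' _; rewrite !ss. Qed.

Lemma vdm_rmorph (R R' : comNzRingType) (f : {rmorphism R -> R'}) s :
  f (vdm s) = vdm (f \o s).
Proof.
rewrite /vdm rmorph_prod; apply: eq_bigr => j _; rewrite rmorph_prod.
by apply: eq_bigr => j' _; rewrite rmorphB.
Qed.

Lemma vdm_neq0 (F : idomainType) (s : 'I_r -> F) : injective s -> vdm s != 0.
Proof.
move=> s_inj; apply/prodf_neq0 => j _; apply/prodf_neq0 => j' jj'.
by rewrite subr_eq0 (inj_eq s_inj) neq_ltn jj'.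
Qed.

Lemma weight_num_field (F : fieldType) (s : 'I_r -> F) x Lam rho : injective s ->
  (\sum_(A : {ffun 'I_r -> 'I_n} | content A == rho) wterm lt0 s x Lam A) * vdm s
  = weight_num s x Lam rho.
Proof.
move=> s_inj; rewrite mulr_suml; apply: eq_bigr => A _; rewrite /wterm -mulrA.
congr (_ * _); rewrite prod_pairs_split big1 ?mul1r; last by move=> j _; rewrite ltnn.
rewrite /vdm -big_split /=; apply: eq_bigr => j _.
rewrite -big_split /=; apply: eq_bigr => j' jj'.
have h : s j - s j' != 0 by rewrite subr_eq0 (inj_eq s_inj) neq_ltn jj'.
have h' : s j' - s j != 0 by rewrite -opprB oppr_eq0.
rewrite /pairnum /pairfactor; case: (ltngtP (A j) (A j')) => _.
- by rewrite mulr1 divfK.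
- by rewrite mul1r -[X in _ * X]opprB mulrN divfK //; ring.
- by rewrite !mul1r.
Qed.

(* Swapping two equal variables changes the sign of the numerator. *)
Lemma weight_num_eq0 (R : idomainType) (s : 'I_r -> R) x Lam rho j1 j2 :
  2%:R != 0 :> R -> j1 != j2 -> s j1 = s j2 -> weight_num s x Lam rho = 0.
Proof.
move=> R2 j12 s12; pose tau := tperm j1 j2.
have st j : s (tau j) = s j by rewrite /tau; case: tpermP => // ->.
suff : weight_num s x Lam rho = - weight_num s x Lam rho.
  move/eqP; rewrite -addr_eq0 -mulr2n -mulr_natl mulf_eq0 (negPf R2) /=.
  by move/eqP.
pose T (A : {ffun 'I_r -> 'I_n}) : {ffun 'I_r -> 'I_n} := [ffun j => A (tau j)].
have TK : involutive T by move=> A; apply/ffunP => j; rewrite !ffunE tpermK.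
rewrite {1}/weight_num (reindex_inj (inv_inj TK)) /= -sumrN.
apply: eq_big => [A|A _].
  congr (_ == _); apply/mnmP => t; rewrite !mnmE.
  rewrite -(card_imset _ (@perm_inj _ tau)); apply: eq_card => j; rewrite !inE.
  apply/imsetP/idP => [[j'] |Aj]; first by rewrite inE ffunE => /eqP <- ->.
  by exists (tau j); rewrite ?inE ?ffunE tpermK.
rewrite [in RHS](reindex_inj (perm_inj (s := tau))) /= -mulrN; congr (_ * _).
  by apply: eq_bigr => j _; rewrite ffunE st.
have := @prod_antisym_perm _ R (fun j j' => pairnum (A j) (A j') (s j) (s j')) tau.
rewrite perm_sign_tperm // mulrN1z mulN1r => <- => [|j j'].
  by apply: eq_bigr => j _; apply: eq_bigr => j' _; rewrite !ffunE !st.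
by rewrite /pairnum; case: ltngtP => _; ring.
Qed.

End WeightNumerator.

Lemma congruence_mul (R : comNzRingType) (d a a' b b' q1 q2 : R) :
  a - a' = d * q1 -> b - b' = d * q2 -> a * b - a' * b' = d * (q1 * b + a' * q2).
Proof. by move=> E1 E2; rewrite mulrDr mulrA -E1 mulrCA -E2; ring. Qed.

Lemma congruence_add (R : comNzRingType) (d a a' b b' q1 q2 : R) :
  a - a' = d * q1 -> b - b' = d * q2 -> (a + b) - (a' + b') = d * (q1 + q2).
Proof. by move=> E1 E2; rewrite mulrDr -E1 -E2; ring. Qed.

Section FactorTheorem.
Variables (N : nat).
Local Notation Rx := {mpoly int[N]}.

Definition identify (u v : 'I_N) : N.-tuple Rx :=
  [tuple if t == v then 'X_u else 'X_t | t < N].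

Lemma identifyX u v t : 'X_t \mPo identify u v = if t == v then 'X_u else 'X_t.
Proof. by rewrite comp_mpolyXU -tnth_nth tnth_mktuple. Qed.

Lemma identify_dvd (u v : 'I_N) (P : Rx) :
  exists Q, P - (P \mPo identify u v) = ('X_v - 'X_u) * Q.
Proof.
pose D (P : Rx) := exists Q, P - (P \mPo identify u v) = ('X_v - 'X_u) * Q.
have D0 : D 0 by exists 0; rewrite comp_mpoly0 subrr mulr0.
have D1 : D 1 by exists 0; rewrite comp_mpoly1 subrr mulr0.
have DX t : D 'X_t.
  rewrite /D identifyX; case: (eqVneq t v) => [->|_]; first by exists 1; rewrite mulr1.
  by exists 0; rewrite subrr mulr0.
have DM P1 P2 : D P1 -> D P2 -> D (P1 * P2).
  move=> [Q1 E1] [Q2 E2]; exists (Q1 * P2 + (P1 \mPo identify u v) * Q2).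
  by rewrite rmorphM; apply: congruence_mul.
have DD P1 P2 : D P1 -> D P2 -> D (P1 + P2).
  move=> [Q1 E1] [Q2 E2]; exists (Q1 + Q2).
  by rewrite comp_mpolyD; apply: congruence_add.
change (D P); elim/mpolyind: P => [|c m P _ _ DP]; first exact: D0.
apply: DD DP.
have [Q E] : D 'X_[m].
  rewrite mpolyXE_id; apply: big_ind => // t _.
  by elim: (m t) => [|k IH]; rewrite ?expr0 ?exprS //; apply: DM.
by exists (c *: Q); rewrite comp_mpolyZ -scalerBr E scalerAr.
Qed.

Lemma mpolyX_inj (u v : 'I_N) : 'X_u = 'X_v :> Rx -> u = v.
Proof.
move=> /(congr1 (mcoeff U_(u))); rewrite !mcoeffXU eqxx.
by case: eqP => // _ /eqP.
Qed.

(** The factor theorem over the integers, one difference at a time: 'X_v - 'X_u survives the other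
    identifications, so in a domain the quotient still vanishes under them. *)
Lemma dvd_prod_differences (L : seq ('I_N * 'I_N)) (Q : Rx) :
  uniq L -> (forall u, u \in L -> (u.1 < u.2)%N) ->
  (forall u, u \in L -> Q \mPo identify u.1 u.2 = 0) ->
  exists P, Q = P * \prod_(u <- L) ('X_u.1 - 'X_u.2).
Proof.
elim: L Q => [|[u v] L IH] Q; first by exists Q; rewrite big_nil mulr1.
rewrite cons_uniq => /andP[uvL uL] lt0 Q0.
have [Q1] := identify_dvd u v Q; rewrite (Q0 (u, v)) ?mem_head // subr0 => QE.
have uv := lt0 _ (mem_head _ _); rewrite /= in uv.
have [||P PE] := IH Q1 uL.
- by move=> w wL; apply: lt0; rewrite inE wL orbT.
- move=> [u' v'] wL /=; have := Q0 (u', v'); rewrite inE wL orbT => /(_ isT) /=.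
  have uv' : (u' < v')%N by apply: (lt0 (u', v')); rewrite inE wL orbT.
  rewrite QE rmorphM rmorphB /= !identifyX => /eqP; rewrite mulf_eq0 subr_eq0.
  case/orP => [|/eqP] // /eqP H; exfalso; move: H.
  (* The difference could vanish only for the same pair, excluded by [uniq], or for the reversed
     one, excluded by u < v. *)
  case: (eqVneq v v') => [vE|_]; case: (eqVneq u v') => [uE|_] /mpolyX_inj H.
  + by rewrite uE vE ltnn in uv.
  + by move: uvL; rewrite vE -H wL.
  + by move: uv uv'; rewrite uE H => h1 /(ltn_trans h1); rewrite ltnn.
  + by rewrite H ltnn in uv.
by exists (- P); rewrite QE PE big_cons /=; ring.
Qed.

End FactorTheorem.

Section WeightPolynomial.
Variables (n r : nat) (rho : 'X_{1..n}).
Hypothesis rhoE : mdeg rho = r.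
Local Notation N := (r + (n + n))%N.
Local Notation lt0 := (fun i k : 'I_n => (i < k)%N).
Local Notation Zx := {mpoly int[N]}.
Local Notation Qx := {mpoly rat[N]}.
Local Notation Xs := (fun j : 'I_r => 'X_(ivar_s n j) : Zx).
Local Notation Xx := (fun i : 'I_n => 'X_(ivar_x r i) : Zx).
Local Notation XL := (fun i : 'I_n => 'X_(ivar_Lam r i) : Zx).

Let ivar_s_inj : injective (@ivar_s n r).
Proof. exact: lshift_inj. Qed.

Lemma weight_num_dvd : exists P : Zx, weight_num Xs Xx XL rho = P * vdm Xs.
Proof.
pose L := [seq (ivar_s n u.1, ivar_s n u.2) | u <- enum [pred u : 'I_r * 'I_r | (u.1 < u.2)%N]].
have [||w|P ->] := @dvd_prod_differences _ L (weight_num Xs Xx XL rho).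
- rewrite map_inj_uniq ?enum_uniq // => -[u v] [u' v'] /= [] H1 H2.
  by congr (_, _); apply/ord_inj.
- by move=> w /mapP[u]; rewrite mem_enum inE => uv ->.
- move=> /mapP[[u v]]; rewrite mem_enum inE /= => uv ->.
  rewrite (weight_num_rmorph (comp_mpoly (identify (ivar_s n u) (ivar_s n v)))).
  apply: (@weight_num_eq0 _ _ _ _ _ _ _ u v).
  + rewrite -(rmorph_nat (@mpolyC N int)) mpolyC_eq0 //.
  + by rewrite neq_ltn uv.
  + rewrite /= !identifyX eqxx (inj_eq ivar_s_inj).
    by rewrite (_ : (u == v) = false) //; apply/negbTE; rewrite neq_ltn uv.
exists P; congr (_ * _); rewrite /L big_map big_enum /= /vdm pair_big_dep.
by [].
Qed.

Let evQ : {rmorphism Zx -> {fraction Qx}} :=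
  @tofrac Qx \o map_mpoly (intr : int -> rat).

Let evQ_inj : injective evQ.
Proof.
move=> P P' /eqP; rewrite /= tofrac_eq => /eqP E; apply/mpolyP => m.
have := congr1 (mcoeff m) E; rewrite !mcoeff_map_mpoly => /eqP.
by rewrite eqr_int => /eqP.
Qed.

(** Clearing the denominators gives an identity over the integers, which ring morphisms carry to K
    even when the factorials vanish there. *)
Lemma is_weight_polyP (P : Zx) :
  is_weight_poly rho P <-> weight_num Xs Xx XL rho = P * vdm Xs.
Proof.
pose X t : {fraction Qx} := tofrac 'X_t.
have evX t : evQ 'X_t = X t by rewrite /= map_mpolyX.
have X_inj : injective (X \o @ivar_s n r).
  move=> j j' /eqP; rewrite /= /X tofrac_eq => /eqP /(congr1 (mcoeff U_(ivar_s n j))).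
  by rewrite !mcoeffXU eqxx; case: eqP => [/ivar_s_inj //|_ /eqP].
have V : evQ (vdm Xs) = vdm (X \o @ivar_s n r).
  by rewrite vdm_rmorph; apply: eq_vdm => j; apply: evX.
have E : weight_formula (X \o @ivar_s n r) (X \o @ivar_x n r) (X \o @ivar_Lam n r) rho
    * vdm (X \o @ivar_s n r) = evQ (weight_num Xs Xx XL rho).
  rewrite (weight_formulaE _ _ _ X_inj rhoE) ?weight_num_field //; last first.
    apply/pcharf0P => k; rewrite -(rmorph_nat (@tofrac _)) tofrac_eq0.
    rewrite -(rmorph_nat (@mpolyC N rat)) mpolyC_eq0.
    exact: (pcharf0P _).1 (Num.Theory.pchar_num _) _.
  by rewrite (weight_num_rmorph evQ); apply: eq_weight_num => j; apply/esym/evX.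
rewrite /is_weight_poly -/X; split=> [PE|PE].
  by apply: evQ_inj; rewrite -E -PE rmorphM V.
apply: (mulIf (vdm_neq0 X_inj)); rewrite E PE rmorphM V //.
Qed.

Lemma weight_poly_vdm : weight_num Xs Xx XL rho = weight_poly r rho * vdm Xs.
Proof.
apply/is_weight_polyP; rewrite /weight_poly; apply: epsilon_spec.
by have [P /is_weight_polyP] := weight_num_dvd; exists P.
Qed.

Variables (K : fieldType) (Lam : 'I_n -> K) (s : 'rV[K]_r) (x : 'rV[K]_n).
Hypothesis s_inj : injective (s 0).

(** Injectivity of s keeps the Vandermonde product nonzero after specialization, so it can be
    cancelled in K. *)
Lemma weight_coefE : weight_coef Lam s x rho =
  \sum_(A : {ffun 'I_r -> 'I_n} | content A == rho) wterm lt0 (s 0) (x 0) Lam A.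
Proof.
apply: (mulIf (vdm_neq0 s_inj)); rewrite weight_num_field // /weight_coef.
set v := (fun t => match split t with inl _ => _ | inr _ => _ end).
pose ev : {rmorphism Zx -> K} := meval v \o map_mpoly (intr : int -> K).
have evX t : ev 'X_t = v t by rewrite /= map_mpolyX mevalXU.
have vs j : ev (Xs j) = s 0 j.
  by rewrite evX /v /ivar_s -[lshift _ _]/(unsplit (inl j)) unsplitK.
have vx i : ev (Xx i) = x 0 i.
  by rewrite evX /v /ivar_x -[rshift _ _]/(unsplit (inr _)) unsplitK
    -[lshift _ _]/(unsplit (inl i)) unsplitK.
have vL i : ev (XL i) = Lam i.
  by rewrite evX /v /ivar_Lam -[rshift r _]/(unsplit (inr _)) unsplitK
    -[rshift _ _]/(unsplit (inr i)) unsplitK.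
have := congr1 ev weight_poly_vdm; rewrite weight_num_rmorph rmorphM vdm_rmorph.
rewrite (eq_weight_num _ vs vx vL) (eq_vdm vs) => ->; congr (_ * _).
Qed.

End WeightPolynomial.

Lemma mdeg_content n r (A : {ffun 'I_r -> 'I_n}) : mdeg (content A) = r.
Proof.
rewrite mdegE -[RHS]card_ord -sum1_card (partition_big A xpredT) //=.
by apply: eq_bigr => t _; rewrite mnmE -sum1_card; apply: eq_bigl => j; rewrite inE.
Qed.

Lemma weight_wvec (K : fieldType) n r (Lam : 'I_n -> K) (s : 'rV[K]_r) (x : 'rV[K]_n) :
  injective (s 0) ->
  weight Lam s x = wvec (fun i k : 'I_n => (i < k)%N) (s 0) (x 0) Lam.
Proof.
move=> s_inj; have lt (A : {ffun 'I_r -> 'I_n}) : (mdeg (content A) < r.+1)%N.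
  by rewrite mdeg_content.
rewrite /wvec (partition_big (fun A : {ffun 'I_r -> 'I_n} => BMultinom (lt A))
  (fun rho => mdeg rho == r)) /=.
  apply: eq_bigr => rho /eqP rhoE; rewrite (weight_coefE rhoE) // scaler_suml.
  by apply: eq_bigr => A /eqP <-.
by move=> A _; rewrite mdeg_content.
Qed.

(** * The section I *)

Section FlatSection.
Variables (K : fieldType) (p : nat) (n r : nat) (a kappa : K) (Lam : 'I_n -> K).
Variables (s0 : 'rV[K]_r) (x0 : 'rV[K]_n).
Hypothesis charK : p \in [pchar K].
Hypothesis kappa0 : kappa != 0.
Hypothesis nd : nondegenerate_point a Lam s0 x0.
Hypothesis bethe : forall l : 'I_r, PhiT p a kappa Lam l s0 x0 = 1.
Local Notation sl j := (lattice_pt a s0 j).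
Local Notation xl k := (lattice_pt a x0 k).
Local Notation J := (map_mx (fun t : 'I_p => Posz t)).
Local Notation mu := (transport a kappa Lam s0 x0).
Local Notation lt0 := (fun i k : 'I_n => (i < k)%N).
Local Notation I := (Isec p a kappa Lam s0 x0).

Let tr : is_transport a kappa Lam s0 x0 mu.
Proof. by apply: epsilon_spec; apply: transport_exists charK kappa0 nd. Qed.

Lemma lattice_pt_inj j : injective (sl j 0).
Proof.
have nd' := nondegenerate_lattice charK j 0 nd.
move=> u v uv; apply/eqP; apply: contraTT isT => h.
by have := nd_ss charK nd' 0 h; rewrite uv subrr mulr0 addr0 eqxx.
Qed.

Lemma Rregular_lattice k m j : m != j -> Rregular (xl k 0 m - xl k 0 j) (Lam m) r.
Proof.
have nd' := nondegenerate_lattice charK 0 k nd.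
by move=> mj b br; have := nd_xx charK nd' 0 mj br; rewrite mulr0 addr0.
Qed.

Lemma wlat_wvec j k : wlat a Lam s0 x0 j k = wvec lt0 (sl j 0) (xl k 0) Lam.
Proof. exact: weight_wvec (@lattice_pt_inj j). Qed.

Lemma IsecE k : I k = \sum_i mu (J i) k *: wvec lt0 (sl (J i) 0) (xl k 0) Lam.
Proof. by apply: eq_bigr => i _ /=; rewrite wlat_wvec. Qed.

Lemma Isec_homog k : I k \is r.-homog.
Proof.
rewrite IsecE; apply: rpred_sum => i _; apply: rpredZ; apply: rpred_sum => A _.
by apply: rpredZ; rewrite dhomogX /= mdeg_content.
Qed.

Lemma Isec_flat k m : I (k + delta_mx 0 m) = Lconn a kappa Lam x0 m k (I k).
Proof.
pose x := xl k; pose k' := k + delta_mx 0 m : 'rV[int]_n; pose x' := xl k'.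
have x'E i : x' 0 i = x 0 i + a * (i == m)%:R.
  rewrite /x' /k' lattice_ptD lattice_ptE; congr (_ + _ * _).
  by rewrite mxE /=; case: (i == m).
rewrite /Lconn /qKZ !IsecE.
rewrite (foldl_linear_sum (fun j => Ract m j (Lam m) (Lam j) (xl k 0 m - xl k 0 j))).
under [X in linext _ X]eq_bigr => i _.
  rewrite (foldl_after (@lattice_pt_inj (J i)) (@Rregular_lattice k m)).
  over.
have H (f : {linear {mpoly K[n]} -> {mpoly K[n]}}) :
    (forall rho, f 'X_[rho] = kappa ^+ rho m *: 'X_[rho]) ->
    f (\sum_i mu (J i) k *: wvec (ltmove m n) (sl (J i) 0) (xl k 0) Lam)
    = \sum_i mu (J i) k' *: wvec (ltmove m 0) (sl (J i) 0) (x' 0) Lam.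
  move=> fX; rewrite linear_sum.
  transitivity (\sum_(A : {ffun 'I_r -> 'I_n}) (\sum_i mu (J i) k
     * (kappa ^+ content A m * wterm (ltmove m n) (sl (J i) 0) (xl k 0) Lam A))
       *: ('X_[content A] : {mpoly K[n]})).
    under [RHS]eq_bigr do rewrite scaler_suml.
    rewrite [RHS]exchange_big; apply: eq_bigr => i _.
    rewrite linearZ linear_sum /= scaler_sumr.
    apply: eq_bigr => A _; rewrite linearZ /= fX !scalerA.
    by congr (_ *: _); ring.
  under eq_bigr do rewrite (wterm_sum_shift charK nd tr bethe) scaler_suml.
  rewrite exchange_big; apply: eq_bigr => i _; rewrite /wvec scaler_sumr.
  by apply: eq_bigr => A _; rewrite scalerA.
rewrite (H (linext (fun rho => kappa ^+ rho m *: 'X_[rho]))); last first.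
  by move=> rho; exact: linextX.
rewrite (foldl_linear_sum (fun j => Ract m j (Lam m) (Lam j) (xl k 0 m - xl k 0 j + a))).
apply: eq_bigr => i _; congr (_ *: _); apply/esym.
(* In the second half of K_m the argument x_m - x_j + a is the difference of the coordinates of x',
   the point at which the weight function now stands. *)
apply: (foldl_before (@lattice_pt_inj (J i))) => j mj; last exact: Rregular_lattice.
by rewrite !x'E eqxx eq_sym (negPf mj) mulr0 addr0 mulr1 addrAC.
Qed.

Lemma pcurv_Isec k m : Ccurv p a kappa Lam x0 m k (I k) = I (k + delta_mx 0 m *+ p).
Proof.
rewrite /Ccurv /pcurv.
suff H t : foldl (fun u t => qKZ a kappa Lam m (bump_coord a (xl k) m t) u) (I k)
  (iota 0 t) = I (k + delta_mx 0 m *+ t) by exact: H.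
elim: t => [|t IH]; first by rewrite mulr0n addr0.
by rewrite -[in iota _ _]addn1 iotaD foldl_cat IH /= add0n bump_lattice mulrSr addrA Isec_flat.
Qed.

Lemma Isec_period k m :
  I (k + delta_mx 0 m *+ p) = psiT p a Lam s0 x0 m 0 0 *: I k.
Proof.
rewrite !IsecE scaler_sumr; apply: eq_bigr => i _.
by rewrite (transport_monodromy_x charK tr) lattice_pt_period // scalerA mulrC.
Qed.

(** For kappa = 1 this factors Phi_l as the last insertion over the first insertion with s_l raised
    by a. *)
Lemma insertion_shift (l : 'I_r) (s s' : 'rV[K]_r) (x : 'rV[K]_n) :
  nondegenerate_point a Lam s x -> kappa = 1 ->
  (forall j, s' 0 j = s 0 j + a * (j \in [set l])%:R) ->
  shiftfactor a kappa Lam [set l] s x * first_insertion (x 0) l (s' 0)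
  = last_insertion Lam (x 0) l (s 0).
Proof.
move=> nd' k1 s'E; rewrite /shiftfactor !big_set1 k1 mul1r.
rewrite /first_insertion /last_insertion mulrACA -!big_split /=; congr (_ * _).
  apply: eq_bigr => k _; rewrite s'E inE eqxx mulr1 [_ + a - _]addrAC /siteratio divfK //.
  by have := nd_sx charK nd' 1 l k; rewrite mulr1.
rewrite (eq_bigl (fun j => j != l)) => [|j]; last by rewrite !inE.
rewrite -big_split /=; apply: eq_bigr => j jl; have lj : l != j by rewrite eq_sym.
rewrite !s'E !inE eqxx (negPf jl) mulr0 mulr1 addr0 /pairfactor [s 0 l + a - _]addrAC.
have h0 := nd_ss charK nd' 0 lj; rewrite mulr0 addr0 in h0.
have ha := nd_ss charK nd' 1 lj; rewrite mulr1 in ha.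
have h1 := nd_ss1 charK nd' 1 lj; rewrite mulr1 in h1.
by rewrite pairratio_pairfactor // opprB.
Qed.

Lemma Isec_sing k (t0 : 'I_n) : kappa = 1 -> ve_diag Lam (I k) = 0.
Proof.
move=> k1; rewrite IsecE.
have -> : ve_diag Lam (\sum_i mu (J i) k *: wvec lt0 (sl (J i) 0) (xl k 0) Lam)
  = \sum_i mu (J i) k *: ve_diag Lam (wvec lt0 (sl (J i) 0) (xl k 0) Lam).
  rewrite /ve_diag; under eq_bigr do rewrite linear_sum /=.
  rewrite exchange_big; apply: eq_bigr => i _; rewrite [RHS]scaler_sumr.
  by apply: eq_bigr => t _; rewrite linearZ.
under eq_bigr do rewrite (ve_diag_wvec _ _ (@lattice_pt_inj _) t0) scaler_sumr.
rewrite exchange_big; apply: big1 => l _.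
under eq_bigr do rewrite scaler_sumr.
rewrite exchange_big; apply: big1 => A _.
under eq_bigr do rewrite scalerA mulrBr mulrBr.
rewrite -scaler_suml sumrB.
have := transport_sum_shift charK nd tr bethe (V := K^o)
  (fun s => restterm Lam (xl k 0) l (s 0) A * first_insertion (xl k 0) l (s 0)) k [set l].
rewrite [X in X = _ -> _](_ : _ = \sum_i mu (J i) k *
  (restterm Lam (xl k 0) l (sl (J i) 0) A * first_insertion (xl k 0) l (sl (J i) 0))) //.
move=> ->; apply/eqP; rewrite scaler_eq0 subr_eq0; apply/orP; left; apply/eqP.
apply: eq_bigr => i _.
rewrite /GRing.scale /= -[RHS]mulrA; congr (_ * _).
have nd' := nondegenerate_lattice charK (J i) k nd.
have E := @lattice_set_shift _ _ a s0 [set l] (J i).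
rewrite -(insertion_shift nd' k1 E) mulrCA; congr (_ * _); congr (_ * _).
(* [restterm l] does not involve s_l, so the shift leaves it unchanged. *)
have rE j : j != l -> sl (J i + set_shift [set l]) 0 j = sl (J i) 0 j.
  by move=> jl; rewrite E inE (negPf jl) mulr0 addr0.
rewrite /restterm; congr (_ * _); apply: eq_bigr => j jl; first by rewrite rE.
by apply: eq_bigr => j' jl'; rewrite !rE.
Qed.

End FlatSection.

Theorem theorem6p2 (K : fieldType) (p : nat) (hp : p \in [pchar K]) (hp2 : (2 < p)%N)
    (n r : nat) (hn : (0 < n)%N) (hr : (0 < r)%N)
    (a kappa : K) (ha : a != 0) (hkappa : kappa != 0) (Lam : 'I_n -> K)
    (s0 : 'rV[K]_r) (x0 : 'rV[K]_n)
    (hnd : nondegenerate_point a Lam s0 x0)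
    (hBethe : forall l : 'I_r, PhiT p a kappa Lam l s0 x0 = 1) :
  let I : 'rV[int]_n -> {mpoly K[n]} := Isec p a kappa Lam s0 x0 in
  [/\ forall k : 'rV[int]_n, I k \is r.-homog,
      forall (k : 'rV[int]_n) (m : 'I_n),
        I (k + delta_mx 0 m) = Lconn a kappa Lam x0 m k (I k),
      forall (k : 'rV[int]_n) (m : 'I_n),
        Ccurv p a kappa Lam x0 m k (I k) = psiT p a Lam s0 x0 m 0 0 *: I k
    & kappa = 1 -> forall k : 'rV[int]_n, is_sing Lam r (I k)].
Proof.
move=> I; split=> [k|k m|k m|k1 k].
- exact: Isec_homog.
- exact: Isec_flat.
- by rewrite pcurv_Isec // Isec_period.
- by split; [exact: Isec_homog | exact: (Isec_sing hp hkappa hnd hBethe k (Ordinal hn))].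
Qed.
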